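(* Let $\boldsymbol\beta_3=(\beta_0,\beta_1,\beta_2,\beta_3)$ with $\beta_k\ge0$, let $\mathbf{W}=(W,\mathbb{W})\in\mathbf{C}^{\alpha,\boldsymbol\beta_3}([0,T]\times V;V)$ be a nonlinear rough path, and set $\gamma_2=\max\{\beta_0,\beta_1,\beta_2\}+\max\{\beta_1,\beta_2,\beta_3\}+\beta_1$. Assume $$\frac{\gamma_2}{\alpha}-\gamma_2+\beta_0\le1.$$ Then for every $\xi\in V$ the rough differential equation $$Y_t=\xi+\int_0^tW(dr,Y_r)$$ has a solution on any time interval $[0,T]$, and this solution is unique.
   Context: Here $T>0$ is arbitrary, $\alpha\in(\frac13,\frac12]$ and $V$ is a separable Banach space. For a function $\Phi$ of time, $\Phi_{s,t}:=\Phi_t-\Phi_s$ (for $W(t,x)$: $W_{s,t}(x)=W(t,x)-W(s,x)$). $\mathcal{C}^\alpha([0,T];V)$ is the space of $Y:[0,T]\to V$ with $\|Y\|_\alpha=\sup_{s\ne t}\|Y_{s,t}\|_V/|t-s|^\alpha<\infty$; $\mathcal{C}_2^{2\alpha}([0,T]^2;V)$ is the space of $R:[0,T]^2\to V$ with $\sup_{s\ne t}\|R_{s,t}\|_V/|t-s|^{2\alpha}<\infty$. For $\boldsymbol\beta_n=(\beta_0,\dots,\beta_n)$ with $\beta_k\ge0$, $\mathcal{C}^{\alpha,\boldsymbol\beta_n}([0,T]\times V;V)$ is the space of functions $\Phi$, $n$ times continuously Fréchet differentiable in space, with $$\|\Phi\|_{\alpha,\boldsymbol\beta_n}=\sum_{k=0}^n\sup_{s\ne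 t,\,x\in V}\frac{\|D^k\Phi_{s,t}(x)\|}{|t-s|^\alpha(1+\|x\|_V)^{\beta_k}}<\infty .$$ For multi-indices $\boldsymbol\beta^1,\boldsymbol\beta^2$ of length $m+1$ and $\gamma>0$, $\mathcal{C}_2^{\gamma,\boldsymbol\beta^1,\boldsymbol\beta^2}([0,T]^2\times V^2;V)$ is the space of $\Psi$, $m$ times continuously Fréchet differentiable in $(x_1,x_2)\in V^2$ (normed by $\|x_1\|_V+\|x_2\|_V$), with $$\|\Psi\|_{\gamma,\boldsymbol\beta^1,\boldsymbol\beta^2}=\sum_{k=0}^m\sup_{s\ne t,\,(x_1,x_2)\in V^2}\frac{\|D^k\Psi_{s,t}(x_1,x_2)\|}{|t-s|^\gamma(1+\|x_1\|_V)^{\beta^1_k}(1+\|x_2\|_V)^{\beta^2_k}}<\infty .$$ Given $\boldsymbol\beta_n$, $n\ge1$, set $\beta^*_k=\max\{\beta_0,\dots,\beta_k\}$, $\beta^{**}_k=\max\{\beta_1,\dots,\beta_{k+1}\}$ for $0\le k\le n-1$, $\boldsymbol\beta^*_{n-1}=(\beta^*_0,\dots,\beta^*_{n-1})$, $\boldsymbol\beta^{**}_{n-1}=(\beta^{**}_0,\dots,\beta^{**}_{n-1})$. A nonlinear rough path $\mathbf{W}=(W,\mathbb{W})\in\mathbf{C}^{\alpha,\boldsymbol\beta_n}([0,T]\times V;V)$ is a pair with $W\in\mathcal{C}^{\alpha,\boldsymbol\beta_n}([0,T]\times V;V)$, $\mathbb{W}\in\mathcal{C}_2^{2\alpha,\boldsymbol\beta^*_{n-1},\boldsymbol\beta^{**}_{n-1}}([0,T]^2\times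 V^2;V)$, satisfying Chen's relation $\mathbb{W}_{s,t}(x,y)-\mathbb{W}_{s,u}(x,y)-\mathbb{W}_{u,t}(x,y)=DW_{u,t}(y)(W_{s,u}(x))$ for all $x,y\in V$, $s,u,t\in[0,T]$. $\mathcal{E}_W^{2\alpha}$ is the set of pairs $(Y,\dot Y)\in\mathcal{C}^\alpha([0,T];V)^2$ such that $R^Y_{s,t}:=Y_{s,t}-W_{s,t}(\dot Y_s)$ belongs to $\mathcal{C}_2^{2\alpha}([0,T]^2;V)$. For such a pair the nonlinear rough integral is $$\int_s^tW(dr,Y_r):=\lim_{|\pi|\to0}\sum_{k=1}^n\big[W_{t_{k-1},t_k}(Y_{t_{k-1}})+\mathbb{W}_{t_{k-1},t_k}(\dot Y_{t_{k-1}},Y_{t_{k-1}})\big]$$ over partitions $\pi=(s=t_0<\dots<t_n=t)$ of mesh $|\pi|\to0$ (the limit exists). A solution on $[0,T]$ is an $\alpha$-Hölder continuous $Y:[0,T]\to V$ with $Y_0=\xi$, such that $(Y,Y)\in\mathcal{E}^{2\alpha}_W$ and the equation holds for all $t\in[0,T]$, the integral being the nonlinear rough integral with $\dot Y=Y$. *)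

(* Defs.v *)
From HB Require Import structures.
From mathcomp Require Import all_boot all_order all_algebra.
From mathcomp Require Import all_classical all_reals all_analysis.

Set Implicit Arguments.
Unset Strict Implicit.
Unset Printing Implicit Defensive.

Import Order.TTheory GRing.Theory Num.Theory.
Import numFieldNormedType.Exports.

Local Open Scope classical_set_scope.
Local Open Scope ring_scope.

Section ContinuousLinear.
Context {R : realType} (U V : normedModType R).

Definition clin_pred : {pred U -> V} :=
  fun f => `[< linear f /\ continuous f >].

Lemma clin_predP (f : U -> V) :
  reflect (linear f /\ continuous f) (f \in clin_pred).
Proof. exact: asboolP. Qed.

Lemma clin_submod_closed : submod_closed clin_pred.
Proof.
split.
  apply/clin_predP; split; last exact: cst_continuous.
  by move=> a x y; rewrite /= scaler0 addr0.
move=> a f g /clin_predP[lf cf] /clin_predP[lg cg]; apply/clin_predP; split.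
  move=> b x y; rewrite !addrfctE !scalrfctE lf lg !scalerDr !scalerA.
  by rewrite mulrC -!addrA; congr (_ + _); rewrite addrCA.
by move=> x; apply: cvgD; [apply: cvgZl_tmp; exact: cf|exact: cg].
Qed.

HB.instance Definition _ :=
  GRing.isSubmodClosed.Build R (U -> V) clin_pred clin_submod_closed.

Record clin := Clin { clin_val :> U -> V; _ : clin_val \in clin_pred }.

HB.instance Definition _ := [isSub for clin_val].
HB.instance Definition _ := [Choice of clin by <:].
HB.instance Definition _ := [SubChoice_isSubLmodule of clin by <:].

Lemma clin_linear (f : clin) : linear f.
Proof. by case: f => f /= /clin_predP[]. Qed.

Lemma clin_continuous (f : clin) : continuous f.
Proof. by case: f => f /= /clin_predP[]. Qed.

Definition opnorm (f : clin) : R :=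
  sup [set `|f x| | x in [set x : U | `|x| <= 1]].

Lemma clin_bounded (f : clin) :
  has_sup [set `|f x| | x in [set x : U | `|x| <= 1]].
Proof.
split; first by exists `|f 0|, 0 => //=; rewrite normr0 ler01.
pose F : {linear U -> V} :=
  HB.pack (clin_val f) (GRing.isLinear.Build _ _ _ _ _ (clin_linear f)).
have /bounded_funP/(_ 1)[M FM] : bounded_near F (nbhs (0 : U)).
  by apply/linear_bounded_continuous => x; exact: clin_continuous.
by exists M => _ [x /= x1 <-]; exact: FM.
Qed.

Lemma opnorm_ub (f : clin) (x : U) : `|x| <= 1 -> `|f x| <= opnorm f.
Proof.
move=> x1; apply: ub_le_sup; first by case: (clin_bounded f).
by exists x.
Qed.

Lemma opnorm_le (f : clin) (M : R) :
  (forall x, `|x| <= 1 -> `|f x| <= M) -> opnorm f <= M.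
Proof.
move=> fM; apply: ge_sup; first by case: (clin_bounded f).
by move=> _ [x /= x1 <-]; exact: fM.
Qed.

Lemma clin0 (f : clin) : f 0 = 0.
Proof.
have := clin_linear f 1 0 0; rewrite !scale1r addr0 => /eqP.
by rewrite -subr_eq0 opprD addNKr oppr_eq0 => /eqP.
Qed.

Lemma clinZ (f : clin) (a : R) (x : U) : f (a *: x) = a *: f x.
Proof. by have := clin_linear f a x 0; rewrite clin0 !addr0. Qed.

Lemma opnormD (f g : clin) : opnorm (f + g) <= opnorm f + opnorm g.
Proof.
apply: opnorm_le => x x1; rewrite (le_trans (ler_normD _ _))//.
by rewrite lerD// opnorm_ub.
Qed.

Lemma opnorm_ge0 (f : clin) : 0 <= opnorm f.
Proof. by apply: le_trans (opnorm_ub f (x := 0) _); rewrite ?normr0. Qed.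

Lemma opnormZ_le (a : R) (f : clin) : opnorm (a *: f) <= `|a| * opnorm f.
Proof.
apply: opnorm_le => x x1; rewrite [clin_val _ _]/= normrZ.
by rewrite ler_wpM2l// opnorm_ub.
Qed.

Lemma opnormZ (a : R) (f : clin) : opnorm (a *: f) = `|a| * opnorm f.
Proof.
apply/eqP; rewrite eq_le opnormZ_le/=.
have [->|a0] := eqVneq a 0; first by rewrite normr0 mul0r opnorm_ge0.
rewrite -ler_pdivlMl ?normr_gt0// -normfV.
by have := opnormZ_le a^-1 (a *: f); rewrite scalerA mulVf// scale1r.
Qed.

Lemma opnorm_eq0 (f : clin) : opnorm f = 0 -> f = 0.
Proof.
move=> f0; apply/val_inj/funext => x /=.
have [->|x0] := eqVneq x 0; first by rewrite clin0.
have nx0 : `|x| != 0 by rewrite normr_eq0.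
have : `|f (`|x|^-1 *: x)| <= 0.
  by rewrite -f0 opnorm_ub// normrZ normfV normr_id mulVf.
by rewrite normr_le0 clinZ scaler_eq0 invr_eq0 (negbTE nx0)/= => /eqP.
Qed.

HB.instance Definition _ :=
  Lmodule_isNormed.Build R clin opnormD opnormZ opnorm_eq0.

End ContinuousLinear.

(* The library norms [U * V] by the maximum; the alias [prod1 U V] carries
   the sum norm [|x1| + |x2|] instead. *)

Definition prod1 {R : realType} (U V : normedModType R) : Type := (U * V)%type.

Section SumNorm.
Context {R : realType} (U V : normedModType R).

HB.instance Definition _ := GRing.Lmodule.copy (prod1 U V) (U * V)%type.

Definition norm1 (x : prod1 U V) : R := `|x.1| + `|x.2|.

Lemma norm1D (x y : prod1 U V) : norm1 (x + y) <= norm1 x + norm1 y.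
Proof. by rewrite /norm1 addrACA lerD// ler_normD. Qed.

Lemma norm1Z (a : R) (x : prod1 U V) : norm1 (a *: x) = `|a| * norm1 x.
Proof. by rewrite /norm1 /= !normrZ mulrDr. Qed.

Lemma norm1_eq0 (x : prod1 U V) : norm1 x = 0 -> x = 0.
Proof.
case: x => x y /eqP; rewrite /norm1 paddr_eq0//= !normr_eq0.
by case/andP => /eqP-> /eqP->.
Qed.

HB.instance Definition _ :=
  Lmodule_isNormed.Build R (prod1 U V) norm1D norm1Z norm1_eq0.

End SumNorm.

Section IteratedDerivative.
Context {R : realType} (U V : normedModType R).

(* [L(U, L(U, ... L(U, V)))], isometric to the bounded [k]-linear maps. *)
Fixpoint multilin (k : nat) : normedModType R :=
  if k is k'.+1 then clin U (multilin k') else V.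

(* [insubd] packs the continuous linear map ['d (fderiv f k') x] as a [clin];
   the value at points of non-differentiability is irrelevant. *)
Fixpoint fderiv (f : U -> V) (k : nat) : U -> multilin k :=
  if k is k'.+1 return U -> multilin k
  then fun x => insubd (0 : clin U (multilin k')) ('d (fderiv f k') x : U -> _)
  else f.

Definition Cn (n : nat) (f : U -> V) : Prop :=
  (forall k x, (k < n)%N -> differentiable (fderiv f k) x) /\
  continuous (fderiv f n).

End IteratedDerivative.

Section Spaces.
Context {R : realType} {V : normedModType R}.
Implicit Types (T alpha gamma s t u : R) (n m : nat).
Local Open Scope ereal_scope.

Definition incr (A : zmodType) (Y : R -> A) s t : A := (Y t - Y s)%R.

Definition holder2_norm T gamma (A : R -> R -> V) : \bar R :=
  ereal_sup [set r | exists s t,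
    [/\ s \in `[0%R, T], t \in `[0%R, T], s != t
      & r = (`|A s t| / `|t - s| `^ gamma)%:E]].

Definition in_C2 T gamma (A : R -> R -> V) : Prop :=
  holder2_norm T gamma A < +oo.

Definition in_C T alpha (Y : R -> V) : Prop := in_C2 T alpha (incr Y).

(* Here [incr Phi s t] is the function [x |-> Phi t x - Phi s x]. *)
Definition field_norm T alpha n (beta : n.+1.-tuple R) (Phi : R -> V -> V) :
    \bar R :=
  \sum_(k < n.+1) ereal_sup [set r | exists s t x,
    [/\ s \in `[0%R, T], t \in `[0%R, T], s != t
      & r = (`|fderiv (incr Phi s t) k x| /
             (`|t - s| `^ alpha * (1 + `|x|) `^ tnth beta k))%:E]].

Definition in_Cfield T alpha n (beta : n.+1.-tuple R) (Phi : R -> V -> V) :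
    Prop :=
  (forall t, t \in `[0%R, T] -> Cn n (Phi t)) /\
  field_norm T alpha beta Phi < +oo.

Definition field2_norm T gamma m (beta1 beta2 : m.+1.-tuple R)
    (Psi : R -> R -> prod1 V V -> V) : \bar R :=
  \sum_(k < m.+1) ereal_sup [set r | exists s t x1 x2,
    [/\ s \in `[0%R, T], t \in `[0%R, T], s != t
      & r = (`|fderiv (Psi s t) k (x1, x2)| /
             (`|t - s| `^ gamma * (1 + `|x1|) `^ tnth beta1 k
                                * (1 + `|x2|) `^ tnth beta2 k))%:E]].

Definition in_C2field T gamma m (beta1 beta2 : m.+1.-tuple R)
    (Psi : R -> R -> prod1 V V -> V) : Prop :=
  (forall s t, s \in `[0%R, T] -> t \in `[0%R, T] -> Cn m (Psi s t)) /\
  field2_norm T gamma beta1 beta2 Psi < +oo.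

End Spaces.

Section RoughPaths.
Context {R : realType}.

(* [max {beta_0, ..., beta_k}] for [0 <= k <= n - 1] *)
Definition beta_star n (beta : n.+1.-tuple R) : n.-tuple R :=
  [tuple \big[Num.max/beta`_0]_(j < i.+1) beta`_j | i < n].

(* [max {beta_1, ..., beta_(k+1)}] for [0 <= k <= n - 1] *)
Definition beta_star2 n (beta : n.+1.-tuple R) : n.-tuple R :=
  [tuple \big[Num.max/beta`_1]_(j < i.+1) beta`_j.+1 | i < n].

Context {V : normedModType R}.
Implicit Types (T alpha s t u : R) (W : R -> V -> V)
  (WW : R -> R -> prod1 V V -> V) (Y Yd : R -> V).

Definition chen T W WW : Prop :=
  forall x y s u t, s \in `[0, T] -> u \in `[0, T] -> t \in `[0, T] ->
    WW s t (x, y) - WW s u (x, y) - WW u t (x, y) =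
    'd (incr W u t) y (incr W s u x).

(* The multi-index of [W] has length [n + 1] with [n = m + 1 >= 1]. *)
Definition nonlinear_rough_path T alpha m (beta : m.+2.-tuple R) W WW : Prop :=
  [/\ in_Cfield T alpha beta W,
      in_C2field T (2 * alpha) (beta_star beta) (beta_star2 beta) WW
    & chen T W WW].

Definition controlled T alpha W Y Yd : Prop :=
  [/\ in_C T alpha Y, in_C T alpha Yd
    & in_C2 T (2 * alpha) (fun s t => incr Y s t - incr W s t (Yd s))].

(* As in [itv_partition s t p], the partition is [s :: p]. *)
Definition mesh s (p : seq R) : R :=
  \big[Num.max/0]_(i < size p) (nth s (s :: p) i.+1 - nth s (s :: p) i).

Definition mesh_to0 s t : set_system (seq R) :=
  filter_from [set d : R | 0 < d]
    (fun d => [set p | itv_partition s t p /\ mesh s p < d]).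

Definition rough_sum W WW Y Yd s (p : seq R) : V :=
  \sum_(i < size p)
    let a := nth s (s :: p) i in let b := nth s (s :: p) i.+1 in
    (incr W a b (Y a) + WW a b (Yd a, Y a)).

Definition rough_integrable W WW Y Yd s t : Prop :=
  cvg (rough_sum W WW Y Yd s p @[p --> mesh_to0 s t]).

(* [\int_s^t W(dr, Y_r)]; it depends on the choice of the derivative [Yd]. *)
Definition rough_integral W WW Y Yd s t : V :=
  lim (rough_sum W WW Y Yd s p @[p --> mesh_to0 s t]).

Definition rde_solution T alpha W WW (xi : V) Y : Prop :=
  [/\ in_C T alpha Y, Y 0 = xi, controlled T alpha W Y Y
    & forall t, t \in `[0, T] ->
        rough_integrable W WW Y Y 0 t /\
        Y t = xi + rough_integral W WW Y Y 0 t].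

End RoughPaths.

Definition separable (T : topologicalType) : Prop :=
  exists2 D : set T, countable D & dense D.

(* Main.v *)
Require Import Defs.
From mathcomp Require Import all_boot all_order all_algebra.
From mathcomp Require Import all_classical all_reals all_analysis.
From mathcomp Require Import ring lra.

Set Implicit Arguments.
Unset Strict Implicit.
Unset Printing Implicit Defensive.

Import Order.TTheory GRing.Theory Num.Theory.
Import numFieldNormedType.Exports.

Local Open Scope classical_set_scope.
Local Open Scope ring_scope.

(** Consider one step [phi s t x = x + W_{s,t}(x) + WW_{s,t}(x, x)] of the
    second-order Euler scheme. By Chen's relation two consecutive steps agree
    with one long step up to an error of order [3 * alpha > 1] in time, and this
    error is Lipschitz in [x] on balls because [W] has three bounded derivatives
    there and [WW] two. Such an almost flow determines its paths. A path solves
    the equation if and only if it is bounded and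
    [Y t = phi s t (Y s) + O((t - s) ^ (3 * alpha))] ([davie], with the
    equivalence in [davie_rde] and [rde_davie]), and the theorem is proved for
    this notion.

    Everything rests on [discrete_sewing]: a quantity attached to intervals of a
    grid that is almost additive up to a superlinear error, and negligible on
    single cells, is itself superlinear, with a constant that does not depend on
    the grid. Applied to the distance between the Euler scheme and one long step
    it gives the expansion of the scheme ([euler_davie]). Applied to the
    difference of two paths minus that of their one-step predictions it gives
    [stability]: schemes on different partitions approach each other, so they
    converge to a solution ([almost_flow_path]), and two solutions with the same
    initial value coincide ([davie_unique]). Applied to Riemann sums it shows
    that solutions of the integral equation have the local expansion.

    These estimates hold on a ball of weight [M], a bound of [1 + |x|], for time
    intervals of length [h] as long as [M ^ gamma2 * h ^ alpha] is small. With
    the largest such [h], the path moves during this time by about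
    [M ^ beta_0 * h ^ alpha], that is, by [M ^ (gamma2 / alpha - gamma2 +
    beta_0)] times [h]. The growth condition says that the exponent is at most
    [1] ([time_step_growth]), so the weight grows at most exponentially in time,
    the lengths of the time steps stay away from zero, and finitely many local
    solutions cover the interval from [0] to [T] ([global_solution]). *)

(** * Identities in abelian groups *)

Inductive zexpr := ZVar of nat | ZZero | ZAdd of zexpr & zexpr | ZOpp of zexpr.

Fixpoint zcoef (e : zexpr) (i : nat) : int :=
  match e with
  | ZVar j => (i == j)%:Z
  | ZZero => 0
  | ZAdd e1 e2 => zcoef e1 i + zcoef e2 i
  | ZOpp e1 => - zcoef e1 i
  end.

Fixpoint zeval (V : zmodType) (env : seq V) (e : zexpr) : V :=
  match e with
  | ZVar j => nth 0 env j
  | ZZero => 0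
  | ZAdd e1 e2 => zeval env e1 + zeval env e2
  | ZOpp e1 => - zeval env e1
  end.

Lemma zevalE (V : zmodType) (env : seq V) (e : zexpr) :
  zeval env e = \sum_(i < size env) nth 0 env i *~ zcoef e i.
Proof.
elim: e => [j||e1 IH1 e2 IH2|e IH] /=.
- have [jn|nj] := ltnP j (size env).
    rewrite (bigD1 (Ordinal jn))//= eqxx mulr1z big1 ?addr0// => i.
    by rewrite -val_eqE /= => /negbTE ->; rewrite mulr0z.
  rewrite nth_default// big1// => i _.
  by rewrite ltn_eqF ?mulr0z// (leq_trans (ltn_ord i)).
- by rewrite big1// => i _; rewrite mulr0z.
- by rewrite IH1 IH2 -big_split; apply: eq_bigr => i _; rewrite mulrzDr.
- by rewrite IH -sumrN; apply: eq_bigr => i _; rewrite mulrNz.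
Qed.

Lemma zeval_eq (V : zmodType) (env : seq V) (e1 e2 : zexpr) :
  all (fun i => zcoef e1 i == zcoef e2 i) (iota 0 (size env)) ->
  zeval env e1 = zeval env e2.
Proof.
move=> /allP e12; rewrite !zevalE; apply: eq_bigr => i _; congr (_ *~ _).
by apply/eqP/e12; rewrite mem_iota /= ltn_ord.
Qed.

(* Two copies of the same term may differ in the paths of canonical structures
   inside: these paths are skipped when atoms are compared. *)
Ltac zsame x y :=
  first
  [ constr_eq x y
  | lazymatch constr:((x, y)) with
    | (@GRing.scale _ _ ?a ?v, @GRing.scale _ _ ?b ?w) =>
        zsame a b; zsame v w
    | (?a + ?v, ?b + ?w)%R => zsame a b; zsame v w
    | (- ?a, - ?b)%R => zsame a b
    | (?f ?a, ?g ?b) => zsame a b; zsame f g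
    end ].
Ltac zfind x env :=
  lazymatch env with
  | ?y :: ?e =>
      match constr:(O) with
      | _ => let _ := match constr:(O) with _ => zsame x y end in constr:(0%N)
      | _ => let n := zfind x e in constr:(S n)
      end
  end.
Ltac zadd x env :=
  match constr:(O) with
  | _ => let n := zfind x env in env
  | _ => constr:(x :: env)
  end.
Ltac zatoms t env :=
  lazymatch t with
  | (?a + ?b)%R => let env := zatoms a env in zatoms b env
  | (- ?a)%R => zatoms a env
  | 0%R => env
  | _ => zadd t env
  end.
Ltac zreify t env :=
  lazymatch t with
  | (?a + ?b)%R =>
      let a := zreify a env in let b := zreify b env in constr:(ZAdd a b)
  | (- ?a)%R => let a := zreify a env in constr:(ZOpp a)
  | 0%R => constr:(ZZero)
  | _ => let n := zfind t env in constr:(ZVar n)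
  end.

(** Reflexive decision: both sides are read as integer combinations of one
    list of atoms, whose coefficients are compared by computation. *)
Ltac zmod :=
  lazymatch goal with |- @eq ?V ?a ?b =>
    let env := zatoms a (@nil V) in
    let env := zatoms b env in
    let ea := zreify a env in
    let eb := zreify b env in
    apply: (@zeval_eq _ env ea eb); vm_compute; reflexivity
  end.

(** * Taylor estimates for Frechet derivatives *)

Section MeanValue.
Context {R : realType}.

(** The supremum of the [x] with [P 0 x] belongs to them and cannot be less
    than [1], by the local assumption at this supremum. *)
Lemma segment_induction (P : R -> R -> Prop) :
  (forall a b c, 0 <= a -> a <= b -> b <= c -> c <= 1 ->
     P a b -> P b c -> P a c) ->
  (forall c, 0 <= c <= 1 -> exists2 e, 0 < e &
     forall a b, 0 <= a -> a <= c -> c <= b -> b <= 1 ->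
       c - a < e -> b - c < e -> P a b) ->
  P 0 1.
Proof.
move=> Padd Ploc.
pose S := [set x : R | 0 <= x <= 1 /\ P 0 x].
have S0 : S 0.
  have [e e0 Pe] := Ploc 0 (introT andP (conj (lexx _) ler01)).
  split; first by rewrite lexx ler01.
  by apply: Pe => //; rewrite subrr.
have hS : has_sup S.
  by split; [exists 0|exists 1 => x [] /andP[]].
have s0 : 0 <= sup S by apply: ub_le_sup => //; exact: hS.2.
have s1 : sup S <= 1 by apply: ge_sup => [|x []/andP[]//]; exact: hS.1.
have [e e0 Pe] := Ploc (sup S) (introT andP (conj s0 s1)).
have [x [/andP[x0 x1] Px] xe] := sup_adherent e0 hS.
have xs : x <= sup S by apply: ub_le_sup; [exact: hS.2|split => //; apply/andP].
pose b := Num.min 1 (sup S + e / 2).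
have sb : sup S <= b by rewrite le_min s1/= lerDl divr_ge0// ltW.
have b1 : b <= 1 by rewrite ge_min lexx.
have bs : b - sup S < e.
  rewrite ltrBlDl; apply: (@le_lt_trans _ _ (sup S + e / 2)).
    by rewrite ge_min lexx orbT.
  by rewrite ltrD2l ltr_pdivrMr// ltr_pMr// ltrDl.
have Pb : P 0 b.
  by apply: (Padd 0 x b) => //; [exact: le_trans sb|apply: Pe => //; lra].
have [<-//|bn1] := eqVneq b 1.
have : b <= sup S.
  apply: ub_le_sup; first exact: hS.2.
  by split => //; apply/andP; split => //; exact: le_trans sb.
move: bn1; rewrite /b /Num.min; case: ifP => _; first by rewrite eqxx.
by move=> _; rewrite leNgt ltrDl divr_gt0.
Qed.

Section Derivatives.
Context {U X : normedModType R}.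

(** First-order expansions with an arbitrary function as principal part: they
    are stable under differences and translations without any bookkeeping of
    linearity and continuity. *)
Definition has_deriv (F : U -> X) (x : U) (A : U -> X) : Prop :=
  forall e, 0 < e -> exists2 d, 0 < d &
    forall v, `|v| < d -> `|F (x + v) - F x - A v| <= e * `|v|.

Lemma differentiable_has_deriv (F : U -> X) (x : U) :
  differentiable F x -> has_deriv F x ('d F x).
Proof.
move=> /diff_locally/eqaddoP Fx e e0.
have /nbhs_norm0P[d /= d0 dF] := Fx _ e0.
exists d => // v vd; have := dF v vd.
by rewrite !fctE /= [v + x]addrC opprD addrA.
Qed.

Lemma has_deriv_eq (F : U -> X) (x : U) (A B : U -> X) :
  A =1 B -> has_deriv F x A -> has_deriv F x B.
Proof. by move=> AB FA e /FA[d d0 dA]; exists d => // v /dA; rewrite AB. Qed.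

Lemma has_derivB (F G : U -> X) (x : U) (A B : U -> X) :
  has_deriv F x A -> has_deriv G x B ->
  has_deriv (fun y => F y - G y) x (fun v => A v - B v).
Proof.
move=> FA GB e e0; have e20 : 0 < e / 2 by rewrite divr_gt0.
have [d d0 dA] := FA _ e20; have [d' d'0 dB] := GB _ e20.
exists (Num.min d d') => [|v]; first by rewrite lt_min d0.
rewrite lt_min => /andP[/dA vA /dB vB].
have -> : F (x + v) - G (x + v) - (F x - G x) - (A v - B v) =
    (F (x + v) - F x - A v) - (G (x + v) - G x - B v).
  by zmod.
rewrite (le_trans (ler_normB _ _))// (le_trans (lerD vA vB))//.
by rewrite -mulrDl -splitr.
Qed.

Lemma has_deriv_shift (F : U -> X) (x z : U) (A : U -> X) :
  has_deriv F (x + z) A -> has_deriv (fun y => F (y + z)) x A.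
Proof.
by move=> FA e /FA[d d0 dA]; exists d => // v /dA; rewrite (addrAC x v).
Qed.

Lemma has_deriv_clin (L : clin U X) (x : U) : has_deriv L x L.
Proof.
move=> e e0; exists 1 => // v _.
have := clin_linear L 1 v x; rewrite !scale1r [v + x]addrC => ->.
by rewrite addrK subrr normr0 mulr_ge0// ltW.
Qed.


Definition convex_set (B : set U) : Prop :=
  forall x y c, B x -> B y -> 0 <= c <= 1 -> B (x + c *: (y - x)).

(** Vector-valued, hence without an intermediate point: with a slack [e] the
    estimate holds near each point of the segment, on both sides, and it is
    additive on adjacent intervals. *)
Lemma mean_value_ineq (B : set U) (F : U -> X) (A : U -> U -> X) (m : R) :
  convex_set B -> (forall w, B w -> has_deriv F w (A w)) ->
  (forall w v, B w -> `|A w v| <= m * `|v|) ->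
  forall x y, B x -> B y -> `|F y - F x| <= m * `|y - x|.
Proof.
move=> Bc FA Am x y Bx By; set v := y - x.
have [v0|v0] := eqVneq v 0.
  by move: (v0) => /subr0_eq ->; rewrite v0 subrr !normr0 mulr0.
have nv0 : 0 < `|v| by rewrite normr_gt0.
apply/ler_addgt0Pr => e e0; have e'0 : 0 < e / `|v| by rewrite divr_gt0.
have -> : m * `|v| + e = (m + e / `|v|) * (1 - 0) * `|v|.
  by rewrite subr0 mulr1 mulrDl divfK// gt_eqF.
pose g c := F (x + c *: v).
have -> : F y - F x = g 1 - g 0.
  by rewrite /g scale1r scale0r addr0 /v [x + _]addrC subrK.
apply: (@segment_induction
  (fun a b => `|g b - g a| <= (m + e / `|v|) * (b - a) * `|v|)).
  move=> a b c _ ab bc _ gab gbc.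
  have -> : g c - g a = (g b - g a) + (g c - g b) by zmod.
  rewrite (le_trans (ler_normD _ _))// (le_trans (lerD gab gbc))//.
  by rewrite -mulrDl -mulrDr; have -> : b - a + (c - b) = c - a by ring.
move=> c c01; have Bw : B (x + c *: v) by exact: Bc.
have [d d0 dF] := FA _ Bw _ e'0.
exists (d / `|v|) => [|a b a0 ac cb b1 cad bcd]; first by rewrite divr_gt0.
(* one side of [c] at a time *)
have gc u : `|u - c| < d / `|v| ->
    `|g u - g c| <= (m + e / `|v|) * `|u - c| * `|v|.
  move=> ucd; rewrite -mulrA -normrZ.
  have := dF ((u - c) *: v); rewrite normrZ -ltr_pdivlMr // => /(_ ucd); rewrite -normrZ.
  have -> : x + c *: v + (u - c) *: v = x + u *: v by rewrite scalerBl; zmod.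
  rewrite -/(g u) -/(g c) => uc.
  rewrite mulrDl -[g u - g c](subrK (A (x + c *: v) ((u - c) *: v))) addrC.
  by rewrite (le_trans (ler_normD _ _))// lerD// Am.
have -> : g b - g a = (g b - g c) - (g a - g c) by zmod.
rewrite (le_trans (ler_normB _ _))//.
have -> : b - a = `|b - c| + `|a - c|.
  by rewrite (ger0_norm (_ : 0 <= b - c)) ?(ler0_norm (_ : a - c <= 0)); lra.
rewrite mulrDr mulrDl lerD// gc//.
  by rewrite ger0_norm// subr_ge0.
by rewrite ler0_norm ?opprB// subr_le0.
Qed.

End Derivatives.

Lemma clin_le {U X : normedModType R} (L : clin U X) (v : U) :
  `|L v| <= `|L| * `|v|.
Proof.
have [->|v0] := eqVneq v 0; first by rewrite clin0 !normr0 mulr0.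
have nv0 : 0 < `|v| by rewrite normr_gt0.
rewrite -ler_pdivrMr// mulrC.
have -> : `|v|^-1 * `|L v| = `|L (`|v|^-1 *: v)|.
  by rewrite clinZ normrZ normfV normr_id.
by apply: opnorm_ub; rewrite normrZ normfV normr_id mulVf// gt_eqF.
Qed.

Section Taylor.
Context {U X : normedModType R} (B : set U) (m : R).
Hypothesis Bc : convex_set B.

Lemma convex_setI (B' B'' : set U) :
  convex_set B' -> convex_set B'' -> convex_set (B' `&` B'').
Proof. by move=> c c' x y a [? ?] [? ?] a01; split; [exact: c|exact: c']. Qed.

Lemma convex_shift (z : U) : convex_set [set w | B (w + z)].
Proof.
move=> x y c /= Bx By c01.
have -> : x + c *: (y - x) + z = (x + z) + c *: ((y + z) - (x + z)).
  by rewrite (_ : (y + z) - (x + z) = y - x); zmod.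
exact: Bc.
Qed.

Lemma convex_ball (z : U) (r : R) : convex_set [set w : U | `|w - z| <= r].
Proof.
move=> x y c /= xr yr /andP[c0 c1].
have -> : x + c *: (y - x) - z = (1 - c) *: (x - z) + c *: (y - z).
  by rewrite scalerBl scale1r !scalerBr; zmod.
rewrite (le_trans (ler_normD _ _))// !normrZ ger0_norm ?subr_ge0// ger0_norm//.
have -> : r = (1 - c) * r + c * r by ring.
by rewrite lerD// ler_wpM2l// subr_ge0.
Qed.

Lemma clin_lipschitz (F : U -> X) (D : U -> clin U X) :
  (forall w, B w -> has_deriv F w (D w)) -> (forall w, B w -> `|D w| <= m) ->
  forall x y, B x -> B y -> `|F y - F x| <= m * `|y - x|.
Proof.
move=> FD Dm; apply: (mean_value_ineq Bc FD) => w v Bw.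
by rewrite (le_trans (clin_le _ _))// ler_wpM2r// Dm.
Qed.

Lemma clinB (L M : clin U X) (v : U) : (L - M) v = L v - M v.
Proof. by []. Qed.

Lemma clin_subr (L : clin U X) (v w : U) : L (v - w) = L v - L w.
Proof.
by rewrite addrC -scaleN1r (clin_linear L (-1) w v) scaleN1r addrC.
Qed.

End Taylor.

(** The increment [w |-> F (w + z) - F w] is the function to which the mean
    value inequality applies: its derivative is an increment of [D1]. *)
Lemma four_point {U X : normedModType R} (B : set U) (m : R)
    (F : U -> X) (D1 : U -> clin U X) (D2 : U -> clin U (clin U X)) :
  convex_set B ->
  (forall w, B w -> has_deriv F w (D1 w)) ->
  (forall w, B w -> has_deriv D1 w (D2 w)) ->
  (forall w, B w -> `|D2 w| <= m) ->
  forall x x' z, B x -> B (x + z) -> B x' -> B (x' + z) ->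
    `|F (x + z) - F x - (F (x' + z) - F x')| <= m * `|z| * `|x - x'|.
Proof.
move=> Bc FD1 FD2 Dm x x' z Bx Bxz Bx' Bx'z.
have Bc2 := convex_setI Bc (convex_shift Bc (z := z)).
apply: (mean_value_ineq (A := fun w v => D1 (w + z) v - D1 w v) Bc2
  (F := fun w => F (w + z) - F w)) => //.
  by move=> w [Bw Bwz]; apply: has_derivB; [apply: has_deriv_shift|]; exact: FD1.
move=> w v [Bw Bwz]; rewrite -clinB (le_trans (clin_le _ _))// ler_wpM2r//.
rewrite -[X in _ * `|X|](_ : w + z - w = z); last by rewrite addrC addKr.
exact: (clin_lipschitz Bc FD2 Dm).
Qed.

(** Subtracting [D1 x] from [F] leaves a function whose derivative is at most
    [m * r] in the ball of radius [r] around [x]. *)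
Lemma taylor {U X : normedModType R} (B : set U) (m : R)
    (F : U -> X) (D1 : U -> clin U X) (D2 : U -> clin U (clin U X)) :
  convex_set B ->
  (forall w, B w -> has_deriv F w (D1 w)) ->
  (forall w, B w -> has_deriv D1 w (D2 w)) ->
  (forall w, B w -> `|D2 w| <= m) -> 0 <= m ->
  forall x z z' r, B x -> B (x + z) -> B (x + z') -> `|z| <= r -> `|z'| <= r ->
    `|F (x + z) - F (x + z') - D1 x (z - z')| <= m * r * `|z - z'|.
Proof.
move=> Bc FD1 FD2 Dm m0 x z z' r Bx Bxz Bxz' zr z'r.
have Bc2 := convex_setI Bc (convex_ball (z := x) (r := r)).
have -> : F (x + z) - F (x + z') - D1 x (z - z') =
   (F (x + z) - D1 x (x + z)) - (F (x + z') - D1 x (x + z')).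
  rewrite (_ : z - z' = (x + z) - (x + z')); last by zmod.
  by rewrite clin_subr; zmod.
rewrite (_ : z - z' = (x + z) - (x + z')); last by zmod.
apply: (mean_value_ineq (A := fun w v => D1 w v - D1 x v) Bc2
  (F := fun w => F w - D1 x w)) => //=.
- by move=> w [Bw _]; apply: has_derivB; [exact: FD1|exact: has_deriv_clin].
- move=> w v [Bw wr]; rewrite -clinB (le_trans (clin_le _ _))// ler_wpM2r//.
  by rewrite (le_trans (clin_lipschitz Bc FD2 Dm _ _))// ler_wpM2l.
- by split => //=; rewrite addrC addKr.
- by split => //=; rewrite addrC addKr.
Qed.

(** With [x] and [x'] frozen, the derivative in [z] is a second difference of
    [D1]. Differentiating in [x] instead would require the symmetry of the
    second derivative. *)
Lemma taylor_diff {U X : normedModType R} (B : set U) (m : R)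
    (F : U -> X) (D1 : U -> clin U X) (D2 : U -> clin U (clin U X))
    (D3 : U -> clin U (clin U (clin U X))) :
  convex_set B ->
  (forall w, B w -> has_deriv F w (D1 w)) ->
  (forall w, B w -> has_deriv D1 w (D2 w)) ->
  (forall w, B w -> has_deriv D2 w (D3 w)) ->
  (forall w, B w -> `|D3 w| <= m) -> 0 <= m ->
  forall x x' z, B x -> B (x + z) -> B x' -> B (x' + z) ->
    `|F (x + z) - F x - D1 x z - (F (x' + z) - F x' - D1 x' z)|
      <= m * `|z| ^+ 2 * `|x - x'|.
Proof.
move=> Bc FD1 FD2 FD3 Dm m0 x x' z Bx Bxz Bx' Bx'z.
pose Bz := [set w : U | `|w - 0| <= `|z|].
have Bc3 := convex_setI (convex_setI (convex_shift Bc (z := x))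
  (convex_shift Bc (z := x'))) (@convex_ball U 0 `|z|).
pose L := D1 x - D1 x'.
pose H w := (F (w + x) - F (w + x')) - L w.
have -> : F (x + z) - F x - D1 x z - (F (x' + z) - F x' - D1 x' z) = H z - H 0.
  by rewrite /H clin0 !add0r clinB [z + x]addrC [z + x']addrC; zmod.
have -> : m * `|z| ^+ 2 * `|x - x'| = (m * `|z| * `|x - x'|) * `|z - 0|.
  by rewrite subr0; ring.
apply: (mean_value_ineq (F := H)
  (A := fun w v => D1 (w + x) v - D1 (w + x') v - L v) Bc3) => /=.
- move=> w [[Bwx Bwx'] _]; apply: has_derivB; last exact: has_deriv_clin.
  by apply: has_derivB; apply: has_deriv_shift; exact: FD1.
- move=> w v [[/= Bwx Bwx'] /=]; rewrite subr0 => wz.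
  have -> : D1 (w + x) v - D1 (w + x') v - L v =
    (D1 (x + w) - D1 x - (D1 (x' + w) - D1 x')) v.
    by rewrite !clinB [w + x]addrC [w + x']addrC; zmod.
  rewrite (le_trans (clin_le _ _))// ler_wpM2r//.
  apply: (le_trans (four_point Bc FD2 FD3 Dm _ _ _ _)); rewrite // 1?addrC//.
  by rewrite ler_wpM2r// ler_wpM2l.
- by rewrite subrr normr0 !add0r.
- by rewrite subr0 ![z + _]addrC.
Qed.

End MeanValue.

Section PowR.
Context {R : realType}.

Definition scaled (h s t : R) : R := (t - s) / h.

Lemma powR_small (C p e : R) : 0 <= C -> 0 < p -> 0 < e ->
  exists2 mu : R, 0 < mu & C * mu `^ p <= e.
Proof.
move=> C0 p0 e0; have C1 : 0 < C + 1 by rewrite ltr_wpDl.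
exists ((e / (C + 1)) `^ p^-1); first by rewrite powR_gt0// divr_gt0.
rewrite -powRrM mulVf ?gt_eqF// powRr1; last exact/ltW/divr_gt0.
rewrite mulrCA -[leRHS]mulr1 ler_wpM2l ?(ltW e0)// ler_pdivrMr// mul1r.
by rewrite lerDl.
Qed.

Lemma powR_split (x mu a b : R) : 0 <= x -> x <= mu -> b <= a -> 0 < a ->
  x `^ a <= mu `^ (a - b) * x `^ b.
Proof.
move=> x0 xmu ba a0.
have -> : x `^ a = x `^ (a - b) * x `^ b by rewrite -powRD subrK// gt_eqF.
rewrite ler_wpM2r ?powR_ge0// ge0_ler_powR// ?nnegrE ?subr_ge0//.
exact: le_trans xmu.
Qed.

Lemma powR_scaled (h s t a : R) : 0 < h -> s <= t ->
  (t - s) `^ a = h `^ a * scaled h s t `^ a.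
Proof.
move=> h0 st; rewrite -powRM ?(ltW h0)//; last first.
  by rewrite divr_ge0 ?subr_ge0// ltW.
by rewrite /scaled mulrC divfK// gt_eqF.
Qed.

End PowR.

(** * Discrete sewing *)

Section DiscreteSewing.
Context {R : realType}.
Implicit Types (tau : nat -> R) (e : nat -> nat -> R) (b c del Q eta : R).

(** The condition under which a bound with constant [c] reproduces itself when
    an interval is halved. *)
Definition sewing_const b c del : Prop :=
  [/\ 0 <= del, 1 <= c &
   ((1 + del) ^+ 2 + 1) * 2^-1 `^ b * c + (2 + del) <= c].

Lemma half_powR_lt b : 1 < b -> 2^-1 `^ b < 2^-1 :> R.
Proof.
move=> b1; rewrite -[X in _ < X](@powRr1 _ 2^-1) ?invr_ge0//.
by rewrite /powR ifF ?ifF ?gt_eqF ?invr_gt0// ltr_expR ltr_nM2r// ln_lt0//; lra.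
Qed.

Lemma sewing_const_ex b : 1 < b ->
  exists2 del0, 0 < del0 & exists c, forall del, 0 <= del <= del0 ->
    sewing_const b c del.
Proof.
move=> b1; have := half_powR_lt b1; set k := _ `^ b => k2.
have k0 : 0 <= k by exact: powR_ge0.
exists (Num.min 1 ((1 - 2 * k) / 3)); first by rewrite lt_min ltr01/=; lra.
exists (6 / (1 - 2 * k)) => del /andP[del0].
rewrite le_min => /andP[del1 delk].
have u0 : 0 < 1 - 2 * k by lra.
split => //; first by rewrite ler_pdivlMr//; lra.
set c := _ / _.
have cu : c * (1 - 2 * k) = 6 by rewrite /c divfK// gt_eqF.
have c0 : 0 <= c by rewrite divr_ge0// ltW.
rewrite -/k.
have : ((1 + del) ^+ 2 + 1) * k <= (1 + 2 * k) / 2 by nra.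
by move=> /(ler_wpM2r c0); lra.
Qed.

Lemma index_split tau (m : R) i j : (i < j)%N -> tau i <= m -> m <= tau j ->
  exists2 k, (i <= k < j)%N & tau k <= m <= tau k.+1.
Proof.
elim: j => // j IH; rewrite ltnS leq_eqVlt => /predU1P[<-|ij] im mj.
  by exists i; [rewrite leqnn/=|rewrite im].
have [jm|mj'] := leP (tau j) m.
  by exists j; [rewrite (ltnW ij)/=|rewrite jm].
have [k /andP[ik kj] km] := IH ij im (ltW mj').
by exists k => //; rewrite ik ltnS ltnW.
Qed.

(** The interval is cut at the cell that contains its midpoint, so that both
    remaining parts are at most half as long. For [b > 1] two halves contribute
    less than the whole, even after the factors [1 + del], and the constant is
    the same for all grids. *)
Lemma discrete_sewing tau e b c del Q eta N :
  sewing_const b c del -> 0 <= b -> 0 <= Q -> 0 <= eta ->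
  (forall i j, (i <= j <= N)%N -> tau i <= tau j) ->
  (forall i, (i <= N)%N -> e i i <= 0) ->
  (forall i, (i < N)%N -> e i i.+1 <= eta * (tau i.+1 - tau i) `^ b) ->
  (forall i k j, (i < k)%N -> (k < j)%N -> (j <= N)%N ->
     e i j <= (1 + del) * e i k + e k j + Q * (tau j - tau i) `^ b) ->
  forall i j, (i <= j <= N)%N ->
    e i j <= c * (Q + eta) * (tau j - tau i) `^ b.
Proof.
move=> [del0 c1 cc] b0 Q0 eta0 mono e0 e1 etri i j.
have c0 : 0 <= c by apply: le_trans c1.
have K0 : 0 <= c * (Q + eta) by rewrite mulr_ge0// addr_ge0.
have [n] := ubnP (j - i)%N; elim: n i j => // n IH i j nij /andP[ij jN].
move: ij; rewrite leq_eqVlt => /predU1P[->|ij].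
  by rewrite (le_trans (e0 _ jN))// mulr_ge0// powR_ge0.
set h := tau j - tau i.
have h0 : 0 <= h by rewrite subr_ge0 mono// (ltnW ij).
have hb0 : 0 <= h `^ b by exact: powR_ge0.
have le_h i' j' : (i <= i')%N -> (i' <= j' <= j)%N ->
    (tau j' - tau i') `^ b <= h `^ b.
  move=> ii' /andP[ij' jj']; apply: ge0_ler_powR => //.
  - by rewrite nnegrE subr_ge0 mono// ij' (leq_trans jj').
  - by rewrite lerB// mono// ?ii' ?(leq_trans ij') ?(leq_trans jj') ?jN.
have [k /andP[ik kj] /andP[tk tk1]] : exists2 k, (i <= k < j)%N &
    tau k <= (tau i + tau j) / 2 <= tau k.+1.
  by apply: index_split => //; have := h0; rewrite /h; lra.
have kN : (k < N)%N by rewrite (leq_trans kj).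
have half i' j' : (i' <= j' <= N)%N -> tau j' - tau i' <= h / 2 ->
    (tau j' - tau i') `^ b <= 2^-1 `^ b * h `^ b.
  move=> ij' hh; rewrite -powRM// 1?mulrC//.
  by apply: ge0_ler_powR; rewrite ?nnegrE ?divr_ge0// subr_ge0 mono.
set p := 2^-1 `^ b in cc half.
have p0 : 0 <= p by exact: powR_ge0.
have eik1 : e i k.+1 <= (1 + del) * (c * (Q + eta) * (p * h `^ b)) +
    (Q + eta) * h `^ b.
  have dc0 : 0 <= (1 + del) * (c * (Q + eta) * (p * h `^ b)).
    by rewrite !mulr_ge0// ?addr_ge0.
  move: ik; rewrite leq_eqVlt => /predU1P[ik|ik].
    rewrite -ik in kN dc0 *.
    rewrite (le_trans (e1 _ kN))// -[leLHS]add0r lerD// ler_pM//.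
    - exact: powR_ge0.
    - by rewrite lerDr.
    - by rewrite le_h// leqnSn.
  rewrite (le_trans (etri _ _ _ ik (ltnSn k) kN))//.
  have eik : e i k <= c * (Q + eta) * (p * h `^ b).
    rewrite (le_trans (IH i k _ _))//.
    - by rewrite -ltnS (leq_trans _ nij)// ltnS ltn_sub2r.
    - by rewrite (ltnW ik) ltnW.
    - rewrite ler_wpM2l// half ?(ltnW ik) ?(ltnW kN)//.
      by rewrite /h; lra.
  rewrite -addrA lerD//; first by rewrite ler_wpM2l// addr_ge0.
  rewrite [Q + eta]addrC mulrDl lerD//.
    by rewrite (le_trans (e1 _ kN))// ler_wpM2l// le_h// ?leqnSn ?(ltnW ik).
  by rewrite ler_wpM2l// le_h// (leq_trans (ltnW ik)).
have last_ineq : (1 + del) * ((1 + del) * (c * (Q + eta) * (p * h `^ b)) +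
    (Q + eta) * h `^ b) + c * (Q + eta) * (p * h `^ b) + Q * h `^ b <=
    c * (Q + eta) * h `^ b.
  have : (((1 + del) ^+ 2 + 1) * p * c + (2 + del)) * ((Q + eta) * h `^ b) <=
      c * ((Q + eta) * h `^ b) by rewrite ler_wpM2r// mulr_ge0// addr_ge0.
  have : 0 <= eta * h `^ b by rewrite mulr_ge0.
  set H := h `^ b; lra.
apply: le_trans last_ineq.
move: kj; rewrite leq_eqVlt => /predU1P[<-|kj].
  apply: (le_trans eik1); rewrite -addrA.
  have E0 : 0 <= (1 + del) * (c * (Q + eta) * (p * h `^ b)) +
    (Q + eta) * h `^ b.
    by rewrite addr_ge0// ?mulr_ge0// ?addr_ge0.
  apply: (@le_trans _ _ ((1 + del) * ((1 + del) * (c * (Q + eta) * (p * h `^ b)) +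
    (Q + eta) * h `^ b))); first by rewrite ler_peMl// lerDl.
  by rewrite lerDl addr_ge0// ?mulr_ge0// ?addr_ge0.
have ik1 : (i < k.+1)%N by rewrite ltnS.
rewrite (le_trans (etri _ _ _ ik1 kj jN))// lerD// lerD//.
  by rewrite ler_wpM2l// addr_ge0.
rewrite (le_trans (IH k.+1 j _ _))//.
- by rewrite -ltnS (leq_trans _ nij)// ltnS ltn_sub2l.
- by rewrite (ltnW kj).
- rewrite ler_wpM2l// half ?(ltnW kj)//.
  by rewrite /h; lra.
Qed.

End DiscreteSewing.

(** * Partitions and harmonic errors *)

Section Partitions.
Context {R : realType}.
Implicit Types (s t d : R) (p : seq R).

Lemma mesh_ltP s p d : 0 < d ->
  (mesh s p < d) <->
  (forall k, (k < size p)%N -> nth s (s :: p) k.+1 - nth s (s :: p) k < d).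
Proof.
move=> d0; split => [/bigmax_ltP[_ H] k kp|H]; first exact: (H (Ordinal kp)).
by apply/bigmax_ltP; split => // i _; exact: H.
Qed.

Lemma partition_ex s t d : s <= t -> 0 < d ->
  exists p, itv_partition s t p /\ mesh s p < d.
Proof.
move=> st d0; have d20 : 0 < d / 2 by rewrite divr_gt0.
have : t - s <= (Num.bound ((t - s) / (d / 2)))%:R * (d / 2).
  rewrite -ler_pdivrMr//; apply/ltW/archi_boundP.
  by rewrite divr_ge0 ?subr_ge0// ltW.
move: (Num.bound _) => n; elim: n s st => [|n IH] s st.
  rewrite mul0r subr_le0 => ts; exists [::]; split.
    by split => //=; rewrite eq_le st ts.
  by rewrite /mesh big_ord0.
rewrite -natr1 mulrDl mul1r => tsn.
have [tsd|tsd] := ltP (t - s) d.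
  have [->|sNt] := eqVneq s t.
    by exists [::]; split; [split => /=|rewrite /mesh big_ord0].
  exists [:: t]; split; first by apply: itv_partition1; rewrite lt_neqAle sNt.
  by apply/mesh_ltP => // -[].
have sd : s + d / 2 <= t by lra.
have tsn' : t - (s + d / 2) <= n%:R * (d / 2) by lra.
have [p [pP pm]] := IH _ sd tsn'.
exists (s + d / 2 :: p); split.
  by case: pP => pp pl; split => //=; rewrite pp andbT ltrDl.
apply/mesh_ltP => // -[_ /=|k kp] /=; first by lra.
move/(mesh_ltP _ _ d0): pm => /(_ k kp).
by rewrite ![nth (s + d / 2) _ _](set_nth_default s)//= ltnW.
Qed.

Lemma path_nth_mono s p : path <%R s p ->
  forall i j, (i <= j <= size p)%N -> nth s (s :: p) i <= nth s (s :: p) j.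
Proof.
move=> sp i j /andP[ij jp].
apply: (@le_sorted_leq_nth _ _ s (s :: p)) => //=; rewrite ?inE ?ltnS//.
  by apply: sub_path sp => x y /ltW.
by rewrite (leq_trans ij).
Qed.

Lemma index_le s p x : x \in s :: p -> (index x (s :: p) <= size p)%N.
Proof. by rewrite -[(_ <= _)%N]/(_ < size (s :: p))%N index_mem. Qed.

Lemma index_mono s p x y : path <%R s p -> x \in s :: p -> y \in s :: p ->
  x <= y -> (index x (s :: p) <= index y (s :: p))%N.
Proof.
move=> sp xp yp xy; rewrite leqNgt; apply/negP => yx.
have := path_nth_mono sp (i := index y (s :: p)) (j := index x (s :: p)).
rewrite (ltnW yx) index_le// => /(_ isT); rewrite !nth_index// => yx'.
by move: yx; rewrite (_ : x = y) ?ltnn//; apply/le_anti/andP.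
Qed.

Lemma path_le_last s p x : path <%R s p -> x \in s :: p -> x <= last s p.
Proof.
move=> sp xp; rewrite -(nth_index s xp) -[last s p](nth_last s (s :: p)) /=.
by apply: path_nth_mono => //; rewrite index_le//=.
Qed.

Lemma common_refinement s p p' : path <%R s p -> path <%R s p' ->
  exists r, [/\ path <%R s r, {subset p <= r}, {subset p' <= r} &
    {subset r <= p ++ p'}].
Proof.
move=> sp sp'; exists (sort <=%R (undup (p ++ p'))); split.
- rewrite path_min_sorted ?sort_lt_sorted ?undup_uniq//.
  apply/allP => x; rewrite mem_sort mem_undup mem_cat => /orP[].
    exact: (allP (lt_path_min sp)).
  exact: (allP (lt_path_min sp')).
- by move=> x xp; rewrite mem_sort mem_undup mem_cat xp.
- by move=> x xp; rewrite mem_sort mem_undup mem_cat xp orbT.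
- by move=> x; rewrite mem_sort mem_undup.
Qed.

End Partitions.

Section Harmonic.
Context {R : realType}.

Lemma harmonic_small (e : R) : 0 < e -> exists n : nat, n.+1%:R^-1 < e.
Proof.
move=> e0; have e1 : 0 <= e^-1 by rewrite invr_ge0 ltW.
exists (Num.bound e^-1); rewrite invf_plt ?posrE//.
by rewrite (lt_trans (archi_boundP e1))// ltr_nat.
Qed.

Lemma le_of_harmonic (x y C : R) : 0 <= C ->
  (forall n : nat, x <= y + C * n.+1%:R^-1) -> x <= y.
Proof.
move=> C0 xy; apply/ler_addgt0Pr => e e0.
have C1 : 0 < C + 1 by rewrite ltr_wpDl.
have [n ne] := @harmonic_small (e / (C + 1)) (divr_gt0 e0 C1).
rewrite (le_trans (xy n))// lerD2l.
rewrite ltr_pdivlMr// in ne.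
have : 0 <= n.+1%:R^-1 :> R by rewrite invr_ge0.
by move: ne; set k := _^-1; lra.
Qed.

Lemma harmonic_cauchy_cvg (V : completeNormedModType R) (y : nat -> V) :
  (forall n m, `|y n - y m| <= n.+1%:R^-1 + m.+1%:R^-1) ->
  exists l, forall n, `|y n - l| <= n.+1%:R^-1.
Proof.
move=> ynm.
have inv_le n m : (n <= m)%N -> m.+1%:R^-1 <= n.+1%:R^-1 :> R.
  by move=> nm; rewrite lef_pV2 ?posrE// ler_nat.
have /cvgP yl : cvg (y @ \oo).
  apply: cauchy_cvg; apply: cauchy_exP => e e0.
  have e20 : 0 < e / 2 by rewrite divr_gt0.
  have [n ne] := harmonic_small e20.
  exists (y n), n => //= m nm; rewrite -ball_normE /=.
  rewrite (le_lt_trans (ynm n m))// [e]splitr ltr_leD//.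
  by rewrite (le_trans (inv_le _ _ nm))// ltW.
exists (lim (y @ \oo)) => n; apply/ler_addgt0Pr.
suff H (e : R) : 0 < e -> `|y n - limn y| <= n.+1%:R^-1 + e by exact: H.
move=> e0.
have e20 : 0 < e / 2 by rewrite divr_gt0.
have [k ke] := harmonic_small e20.
move/cvgrPdist_lt : yl => /(_ _ e20) [N _ yN].
have /ltW := yN (maxn N k) (leq_maxl _ _); rewrite distrC => ml.
have := le_trans (inv_le _ _ (leq_maxr N k)) (ltW ke).
move: ml; have := ynm n (maxn N k); set m := maxn N k => nm ml mk.
rewrite -[y n - _](subrK (y n - y m)) (_ : _ - _ - _ = y m - lim (y @ \oo)).
  rewrite (le_trans (ler_normD _ _))//; move: nm ml mk.
  move: (n.+1%:R^-1 : R) (m.+1%:R^-1 : R) (`|y n - y m| : R).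
  by move: (`|y m - limn y| : R) => r1 r2 r3 r4; lra.
by zmod.
Qed.

End Harmonic.

(** * Almost flows and the Euler scheme *)

Section AlmostFlow.
Context {R : realType} {V : normedModType R}.
Implicit Types (s t u h alpha a b c eps q : R) (B : set V).

(** One step of a numerical scheme on a short time interval. [B] contains the
    paths and [B1] the points that one step reaches from there. Time is measured
    in units of [h], so that smallness is carried by [eps] alone, while [q] is
    the size of the increments. *)
Record almost_flow (s0 s1 h alpha a eps q : R) (B B1 : set V)
    (phi : R -> R -> V -> V) : Prop := AlmostFlow {
  af_h : 0 < h;
  af_len : s1 - s0 <= h;
  af_sub : B `<=` B1;
  af_maps : forall s t x, s0 <= s -> s <= t -> t <= s1 -> B x ->
    B1 (phi s t x);
  af_id : forall s x, s0 <= s -> s <= s1 -> phi s s x = x;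
  af_move : forall s t x, s0 <= s -> s <= t -> t <= s1 -> B x ->
    `|phi s t x - x| <= 2 * q * scaled h s t `^ alpha;
  af_lip : forall s t x y, s0 <= s -> s <= t -> t <= s1 -> B1 x -> B1 y ->
    `|phi s t x - phi s t y| <= (1 + 2 * eps) * `|x - y|;
  af_4pt : forall s t x y x' y', s0 <= s -> s <= t -> t <= s1 ->
    B1 x -> B1 y -> B1 x' -> B1 y' ->
    `|phi s t x - phi s t y - (phi s t x' - phi s t y')| <=
      (1 + 2 * eps) * `|x - y - (x' - y')| + 2 * eps * `|x - y| * `|y - y'|;
  af_defect : forall s u t x, s0 <= s -> s <= u -> u <= t -> t <= s1 -> B x ->
    `|phi u t (phi s u x) - phi s t x| <= 7 * eps * q * scaled h s t `^ a;
  af_defect_lip : forall s u t x y, s0 <= s -> s <= u -> u <= t -> t <= s1 ->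
    B x -> B y ->
    `|phi u t (phi s u x) - phi s t x - (phi u t (phi s u y) - phi s t y)| <=
      14 * eps * scaled h s t `^ a * `|x - y|
}.

Fixpoint euler (phi : R -> R -> V -> V) (tau : nat -> R) (x : V) k : V :=
  if k is k'.+1 then phi (tau k') (tau k) (euler phi tau x k') else x.

Definition time_grid s0 s1 (tau : nat -> R) (N : nat) : Prop :=
  [/\ s0 <= tau 0%N, tau N <= s1 &
    forall i j, (i <= j <= N)%N -> tau i <= tau j].

Lemma time_gridP s0 s1 tau N i j : time_grid s0 s1 tau N -> (i <= j <= N)%N ->
  [/\ s0 <= tau i, tau i <= tau j & tau j <= s1].
Proof.
move=> [t0 tN mono] /andP[ij jN]; split.
- by rewrite (le_trans t0)// mono// (leq_trans ij).
- by rewrite mono// ij.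
- by rewrite (le_trans _ tN)// mono// jN leqnn.
Qed.

Lemma time_grid_le s0 s1 tau N n : time_grid s0 s1 tau N -> (n <= N)%N ->
  time_grid s0 s1 tau n.
Proof.
move=> tg nN; have [_ _ mono] := tg; split; first by case: tg.
  by have [] := @time_gridP s0 s1 tau N n n tg; rewrite ?leqnn.
by move=> i j /andP[ij jn]; rewrite mono// ij (leq_trans jn).
Qed.

Section Estimates.
Variables (s0 s1 h alpha a b c eps q : R) (B B1 : set V).
Variable phi : R -> R -> V -> V.
Hypothesis AF : almost_flow s0 s1 h alpha a eps q B B1 phi.
Hypothesis eps01 : 0 <= eps <= 1.
Hypothesis q0 : 0 <= q.
Hypothesis b1 : 1 < b.
Hypothesis ba : b <= a.
Hypothesis alpha0 : 0 <= alpha.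
Hypothesis ca : sewing_const a c (2 * eps).
Hypothesis cb : sewing_const b c (2 * eps).
Hypothesis ceps : c * (20 * eps) <= 2^-1.

Let h0 : 0 < h := af_h AF.
Let c0 : 0 <= c. Proof. by case: ca => _ ? _; apply: le_trans ler01 _. Qed.
Let eps0 : 0 <= eps. Proof. by case/andP: eps01. Qed.
Let eps1 : eps <= 1. Proof. by case/andP: eps01. Qed.
Let a0 : 0 <= a. Proof. by apply: le_trans ba; apply: ltW; apply: lt_trans b1. Qed.
Let b0 : 0 <= b. Proof. by apply: ltW; apply: lt_trans b1. Qed.

Lemma scaled_ge0 s t : s <= t -> 0 <= scaled h s t.
Proof. by move=> st; rewrite divr_ge0 ?subr_ge0// ltW. Qed.

Lemma scaled_le1 s t : s0 <= s -> t <= s1 -> scaled h s t <= 1.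
Proof.
move=> s0s ts1; rewrite ler_pdivrMr// mul1r (le_trans _ (af_len AF))//.
by rewrite lerB.
Qed.

Lemma scaledE s t : scaled h s t = t / h - s / h.
Proof. exact: mulrBl. Qed.

Lemma powR_scaled_le1 s t x : s0 <= s -> s <= t -> t <= s1 -> 0 <= x ->
  scaled h s t `^ x <= 1.
Proof.
move=> s0s st ts1 x0; rewrite -[leRHS](powRr0 (scaled h s t)).
have := scaled_ge0 st; rewrite le_eqVlt => /predU1P[<-|sp].
  by rewrite powRr0 /powR eqxx; case: (x == 0).
by apply: ger_powR => //; rewrite sp scaled_le1.
Qed.

Lemma powR_scaled_ba s t : s0 <= s -> s <= t -> t <= s1 ->
  scaled h s t `^ a <= scaled h s t `^ b.
Proof.
move=> s0s st ts1.
have := scaled_ge0 st; rewrite le_eqVlt => /predU1P[<-|sp].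
  by rewrite !powR0// gt_eqF// ?(lt_le_trans _ ba)// (lt_trans _ b1).
by apply: ger_powR => //; rewrite sp scaled_le1.
Qed.

(** The distance between the scheme and a single step is almost additive, by
    the Lipschitz bound and the bound on the defect, and it vanishes on single
    cells: this is the situation of [discrete_sewing]. *)
Lemma euler_davie tau y N : time_grid s0 s1 tau N ->
  (forall k, (k < N)%N -> B (y k)) ->
  (forall k, (k < N)%N -> y k.+1 = phi (tau k) (tau k.+1) (y k)) ->
  forall i j, (i <= j <= N)%N ->
    `|y j - phi (tau i) (tau j) (y i)| <= q * scaled h (tau i) (tau j) `^ a.
Proof.
move=> tg By yS i j ijN; have := ijN => /andP[ij jN].
pose e i j := `|y j - phi (tau i) (tau j) (y i)|.
have Q0 : 0 <= 7 * eps * q by rewrite !mulr_ge0.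
suff: e i j <= c * (7 * eps * q + 0) * (tau j / h - tau i / h) `^ a.
  move=> /le_trans; apply; rewrite addr0 -scaledE ler_wpM2r ?powR_ge0//.
  rewrite mulrA -[leRHS]mul1r ler_wpM2r//.
  by have := mulr_ge0 c0 eps0; have := ceps; lra.
apply: (@discrete_sewing _ (fun k => tau k / h) e a c (2 * eps) _ 0 N) => //.
- by move=> i' j' /(time_gridP tg)[_ ? _]; rewrite ler_pM2r ?invr_gt0.
- move=> k kN; have [tk _ kt] := time_gridP tg (introT andP (conj (leqnn k) kN)).
  by rewrite /e (af_id AF)// subrr normr0.
- by move=> k kN; rewrite /e yS// subrr normr0 mul0r.
- move=> i' k j' ik kj jN'; rewrite -scaledE.
  have kN : (k < N)%N by rewrite (leq_trans kj).
  have iN : (i' < N)%N by rewrite (ltn_trans ik).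
  have [s0i tik _] := time_gridP tg (introT andP (conj (ltnW ik) (ltnW kN))).
  have [s0k tkj js1] := time_gridP tg (introT andP (conj (ltnW kj) jN')).
  have := af_lip AF s0k tkj js1 (af_sub AF (By _ kN))
    (af_maps AF s0i tik (le_trans tkj js1) (By _ iN)).
  have := af_defect AF s0i tik tkj js1 (By _ iN).
  rewrite /e; set f1 := phi _ _ (y k); set f2 := phi _ _ (phi _ _ _).
  set f3 := phi _ _ _ => D L.
  (* [f1 - f2] moves the starting point, [f2 - f3] is the defect *)
  have -> : y j' - f3 = (f1 - f2) + (y j' - f1) + (f2 - f3) by zmod.
  by rewrite (le_trans (ler_normD _ _))// lerD// (le_trans (ler_normD _ _))// lerD.
Qed.

(** The path has to stay in [B] only strictly before the end for
    [euler_davie], so the induction on time does not need a larger ball. *)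
Lemma euler_near xi tau y N : time_grid s0 s1 tau N -> 3 * q <= 1 ->
  (forall x, `|x - xi| <= 1 -> B x) ->
  y 0%N = xi ->
  (forall k, (k < N)%N -> y k.+1 = phi (tau k) (tau k.+1) (y k)) ->
  forall k, (k <= N)%N -> `|y k - xi| <= 3 * q.
Proof.
move=> tg q1 Bxi y0 yS k; have [n] := ubnP k; elim: n k => // n IH k kn kN.
have kN' : (0 <= k <= N)%N by [].
have By j : (j < k)%N -> B (y j).
  move=> jk; apply/Bxi/(le_trans (IH j _ _)) => //.
    by rewrite (leq_trans jk).
  by rewrite (leq_trans (ltnW jk)).
have yk : `|y k - phi (tau 0) (tau k) xi| <= q * 1.
  have := @euler_davie tau y k (time_grid_le tg kN) By; rewrite -y0.
  move=> /(_ (fun j jk => yS j (leq_trans jk kN)) 0%N k).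
  rewrite leqnn => /(_ isT) /le_trans; apply.
  have [? ? ?] := time_gridP tg kN'.
  by rewrite ler_wpM2l// powR_scaled_le1.
have Bx : B xi by apply: Bxi; rewrite subrr normr0.
have xk : `|phi (tau 0) (tau k) xi - xi| <= 2 * q * 1.
  have [? ? ?] := time_gridP tg kN'.
  rewrite (le_trans (af_move AF _ _ _ Bx))// ler_wpM2l ?powR_scaled_le1//.
  by rewrite mulr_ge0.
have -> : y k - xi =
    (y k - phi (tau 0) (tau k) xi) + (phi (tau 0) (tau k) xi - xi) by zmod.
by rewrite (le_trans (ler_normD _ _))//; lra.
Qed.

(** The error of one step is measured against the flow, so that only its sum
    over the grid matters; the quadratic term in [af_4pt] involves the
    expansion error of [y] alone, hence [z] may have any quality. *)
Lemma stability tau y z N D eta : time_grid s0 s1 tau N ->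
  (forall k, (k <= N)%N -> B (y k)) -> (forall k, (k <= N)%N -> B (z k)) ->
  0 <= eta ->
  (forall i j, (i <= j <= N)%N ->
    `|y j - phi (tau i) (tau j) (y i)| <= scaled h (tau i) (tau j) `^ a) ->
  (forall k, (k < N)%N ->
    `|y k.+1 - z k.+1 - (phi (tau k) (tau k.+1) (y k)
        - phi (tau k) (tau k.+1) (z k))|
      <= eta * scaled h (tau k) (tau k.+1) `^ b) ->
  `|y 0%N - z 0%N| <= D ->
  forall k, (k <= N)%N -> `|y k - z k| <= 2 * (3 * D + c * eta).
Proof.
move=> tg By Bz eta0 yd yz D0.
pose S := \big[Num.max/0]_(i < N.+1) `|y i - z i|.
have S0 : 0 <= S by exact: bigmax_ge_id.
have leS k : (k <= N)%N -> `|y k - z k| <= S.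
  by move=> kN; apply: (le_bigmax_cond _ (j := Ordinal (kN : (k < N.+1)%N))).
suff bnd k : (k <= N)%N -> `|y k - z k| <= 3 * D + c * eta + S / 2.
  have SS : S <= 3 * D + c * eta + S / 2.
    apply/bigmax_leP; split => [|[i iN] _]; last exact: bnd.
    exact: le_trans (bnd 0%N _).
  by move=> k kN; rewrite (le_trans (leS _ kN))//; lra.
move=> kN.
pose e i j := `|y j - z j - (phi (tau i) (tau j) (y i)
        - phi (tau i) (tau j) (z i))|.
pose Q := 20 * eps * S.
have Q0 : 0 <= Q by rewrite !mulr_ge0.
have e0k : e 0%N k <= c * (Q + eta) * (tau k / h - tau 0%N / h) `^ b.
  apply: (@discrete_sewing _ (fun k => tau k / h) e b c (2 * eps) _ _ N) => //.
  - by move=> i' j' /(time_gridP tg)[_ ? _]; rewrite ler_pM2r ?invr_gt0.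
  - move=> i iN; have [ti _ it] := time_gridP tg (introT andP (conj (leqnn i) iN)).
    by rewrite /e !(af_id AF)// subrr normr0.
  - by move=> i iN; rewrite -scaledE; exact: yz.
  - move=> i m j im mj jN; rewrite -scaledE.
    have mN : (m <= N)%N by rewrite (leq_trans (ltnW mj)).
    have iN : (i <= N)%N by rewrite (leq_trans (ltnW im)).
    have imN : (i <= m <= N)%N by rewrite (ltnW im).
    have [s0i tim ms1] := time_gridP tg imN.
    have [s0m tmj js1] := time_gridP tg (introT andP (conj (ltnW mj) jN)).
    have tij : tau i <= tau j := le_trans tim tmj.
    have B1y := af_maps AF s0i tim ms1 (By _ iN).
    have B1z := af_maps AF s0i tim ms1 (Bz _ iN).
    have := af_4pt AF s0m tmj js1 (af_sub AF (By _ mN)) B1y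
      (af_sub AF (Bz _ mN)) B1z.
    have := af_defect_lip AF s0i tim tmj js1 (By _ iN) (Bz _ iN).
    have := af_lip AF s0i tim ms1 (af_sub AF (By _ iN)) (af_sub AF (Bz _ iN)).
    have := yd _ _ imN; have := leS _ iN.
    rewrite /e; set y1 := phi _ _ (y m); set z1 := phi _ _ (z m).
    set y2 := phi _ _ (y i); set z2 := phi _ _ (z i).
    set y3 := phi _ _ y2; set z3 := phi _ _ z2.
    set y4 := phi (tau i) (tau j) (y i); set z4 := phi _ _ (z i).
    move=> iS ym L DL P.
    have dij : scaled h (tau i) (tau j) `^ a <= scaled h (tau i) (tau j) `^ b.
      exact: powR_scaled_ba.
    have dim : scaled h (tau i) (tau m) `^ a <= scaled h (tau i) (tau j) `^ b.
      apply: le_trans dij; apply: ge0_ler_powR; rewrite ?nnegrE ?scaled_ge0//.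
      by rewrite ler_pM2r ?invr_gt0// lerB.
    have -> : y j - z j - (y4 - z4) = (y1 - y3 - (z1 - z3))
      + (y j - z j - (y1 - z1)) + (y3 - y4 - (z3 - z4)) by zmod.
    rewrite (le_trans (ler_normD _ _))//.
    apply: (le_trans (lerD (le_trans (ler_normD _ _) (lerD P (lexx _))) DL)).
    have -> : y m - y2 - (z m - z2) = y m - z m - (y2 - z2) by zmod.
    have PP : 2 * eps * `|y m - y2| * `|y2 - z2| <=
        6 * eps * S * scaled h (tau i) (tau j) `^ b.
      apply: (@le_trans _ _ (2 * eps * scaled h (tau i) (tau j) `^ b * (3 * S))).
        rewrite ler_pM ?mulr_ge0//.
          by rewrite ler_wpM2l ?mulr_ge0// (le_trans ym).
        rewrite (le_trans L)// ler_pM ?addr_ge0 ?mulr_ge0//.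
        by have := eps1; lra.
      by rewrite le_eqVlt; apply/orP; left; apply/eqP; ring.
    have DD : 14 * eps * scaled h (tau i) (tau j) `^ a * `|y i - z i| <=
        14 * eps * S * scaled h (tau i) (tau j) `^ b.
      rewrite -!mulrA !ler_wpM2l// [S * _]mulrC ler_pM// ?powR_ge0//.
    by rewrite /Q; move: PP DD; set E := _ `^ b; lra.
have [s0t t0k ks1] := @time_gridP s0 s1 tau N 0 k tg kN.
have := af_lip AF s0t t0k ks1 (af_sub AF (By _ (leq0n N)))
  (af_sub AF (Bz _ (leq0n N))).
move: e0k; rewrite /e -scaledE.
set y4 := phi _ _ (y _); set z4 := phi _ _ (z _) => e0k L.
have -> : y k - z k = y k - z k - (y4 - z4) + (y4 - z4) by zmod.
rewrite (le_trans (ler_normD _ _))//.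
have e0k1 : `|y k - z k - (y4 - z4)| <= c * (Q + eta) * 1.
  rewrite (le_trans e0k)// ler_wpM2l ?mulr_ge0 ?addr_ge0//.
  by rewrite powR_scaled_le1.
have L1 : `|y4 - z4| <= 3 * D.
  by rewrite (le_trans L)// ler_pM ?addr_ge0 ?mulr_ge0//; have := eps1; lra.
have : c * Q <= S / 2.
  by rewrite /Q mulrA [S / 2]mulrC ler_wpM2r.
by move: e0k1 L1; rewrite mulrDr; lra.
Qed.


Lemma path_time_grid p : s0 <= s1 -> path <%R s0 p -> last s0 p <= s1 ->
  time_grid s0 s1 (nth s0 (s0 :: p)) (size p).
Proof.
move=> s01 sp ls; split => //; last exact: path_nth_mono.
by rewrite [leLHS](nth_last s0 (s0 :: p)).
Qed.

(** On the coarse grid the fine scheme is a path whose steps are wrong by at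
    most [q * scaled ^ a], a small multiple of [scaled ^ b]. *)
Lemma euler_refine p p' xi mu : s0 <= s1 -> path <%R s0 p -> path <%R s0 p' ->
  last s0 p' <= s1 -> {subset p <= p'} -> 3 * q <= 1 ->
  (forall x, `|x - xi| <= 1 -> B x) -> 0 <= mu ->
  (forall k, (k < size p)%N ->
    scaled h (nth s0 (s0 :: p) k) (nth s0 (s0 :: p) k.+1) <= mu) ->
  forall k, (k <= size p)%N ->
    `|euler phi (nth s0 (s0 :: p)) xi k -
      euler phi (nth s0 (s0 :: p')) xi (index (nth s0 (s0 :: p) k) (s0 :: p'))|
    <= 2 * (c * (q * mu `^ (a - b))).
Proof.
move=> s01 sp sp' lp' pp' q1 Bxi mu0 mup.
set tau := nth s0 (s0 :: p); set tau' := nth s0 (s0 :: p').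
have ss' : {subset s0 :: p <= s0 :: p'}.
  move=> x; rewrite !inE => /predU1P[->|/pp' ->]; first by rewrite eqxx.
  by rewrite orbT.
have mtau k : (k <= size p)%N -> tau k \in s0 :: p by move=> kp; exact: mem_nth.
have lp : last s0 p <= s1.
  by rewrite (le_trans _ lp')// path_le_last// ss'// mem_last.
have tg := path_time_grid s01 sp lp.
have tg' := path_time_grid s01 sp' lp'.
pose sig k := index (tau k) (s0 :: p').
have sigP k : (k <= size p)%N -> tau' (sig k) = tau k.
  by move=> kp; rewrite /tau' nth_index// ss'// mtau.
have sig_le k : (k <= size p)%N -> (sig k <= size p')%N.
  by move=> kp; rewrite index_le// ss'// mtau.
have near k : (k <= size p)%N -> `|euler phi tau xi k - xi| <= 3 * q.
  by apply: (euler_near tg) => //.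
have near' k : (k <= size p')%N -> `|euler phi tau' xi k - xi| <= 3 * q.
  by apply: (euler_near tg') => //.
have By k : (k <= size p)%N -> B (euler phi tau xi k).
  by move=> /near kn; apply: Bxi; apply: le_trans q1.
have By' k : (k <= size p')%N -> B (euler phi tau' xi k).
  by move=> /near' kn; apply: Bxi; apply: le_trans q1.
have d i j := euler_davie tg (fun k kN => By k (ltnW kN)) (fun _ _ => erefl)
  (i := i) (j := j).
have d' i j := euler_davie tg' (fun k kN => By' k (ltnW kN)) (fun _ _ => erefl)
  (i := i) (j := j).
have q1' : q <= 1 by lra.
move=> k kp.
have -> : c * (q * mu `^ (a - b)) = 3 * 0 + c * (q * mu `^ (a - b)).
  by rewrite mulr0 add0r.
apply: (@stability tau (euler phi tau xi) (fun k => euler phi tau' xi (sig k))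
  (size p) 0 (q * mu `^ (a - b)) tg By) => //.
- by move=> j jp; apply: By'; exact: sig_le.
- by rewrite mulr_ge0// powR_ge0.
- move=> i j ij; rewrite (le_trans (d _ _ ij))// -[leRHS]mul1r.
  by rewrite ler_wpM2r// powR_ge0.
- move=> j jp.
  have jjp : (j <= j.+1 <= size p)%N by rewrite leqnSn.
  have [sj jS Ss] := time_gridP tg jjp.
  have sij : (sig j <= sig j.+1 <= size p')%N.
    rewrite sig_le// andbT /sig index_mono// ?ss'// ?mtau//.
    exact: ltnW.
  have := d' _ _ sij; rewrite -/tau' !sigP// ?(ltnW jp)//.
  rewrite [euler phi tau xi j.+1]/= => dj.
  set y1 := phi _ _ _; set z1 := phi _ _ _ in dj *.
  have -> : y1 - euler phi tau' xi (sig j.+1) - (y1 - z1) =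
    - (euler phi tau' xi (sig j.+1) - z1) by zmod.
  rewrite normrN (le_trans dj)// -mulrA ler_wpM2l//.
  have dd0 := scaled_ge0 jS.
  by apply: powR_split; rewrite ?mup// (lt_le_trans _ ba)// (lt_trans _ b1).
- by rewrite /sig /tau /= eqxx subrr normr0.
Qed.

(** For each time [t] the scheme runs on its own partition of the interval from
    [s0] to [t]; common refinements compare the results for different times and
    different meshes. Thus no time needs to be approximated by grid points. *)
Lemma approximations xi : s0 <= s1 -> b < a -> 3 * q <= 1 ->
  (forall x, `|x - xi| <= 1 -> B x) ->
  exists Yn : nat -> R -> V, [/\
    forall n, Yn n s0 = xi,
    forall n t, s0 <= t <= s1 -> `|Yn n t - xi| <= 3 * q,
    forall n m t, s0 <= t <= s1 ->
      `|Yn n t - Yn m t| <= n.+1%:R^-1 + m.+1%:R^-1 &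
    forall n s t, s0 <= s -> s <= t -> t <= s1 ->
      `|Yn n t - phi s t (Yn n s)| <= q * scaled h s t `^ a + 4 * n.+1%:R^-1].
Proof.
move=> s01 lt_ba q1 Bxi.
have ab0 : 0 < a - b by rewrite subr_gt0.
have cq0 : 0 <= 2 * (c * q) by rewrite mulr_ge0// mulr_ge0.
have /choice[mu muP] : forall n : nat, exists mu, 0 < mu /\
    2 * (c * (q * mu `^ (a - b))) <= n.+1%:R^-1.
  move=> n; have n0 : 0 < n.+1%:R^-1 :> R by rewrite invr_gt0.
  have [mu mu0 muP] := powR_small cq0 ab0 n0.
  by exists mu; split; rewrite // [c * _]mulrA mulrA.
have mu_gt0 n : 0 < mu n by case: (muP n).
have /choice[p pP] : forall nt : nat * R, exists p, s0 <= nt.2 ->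
    itv_partition s0 nt.2 p /\ mesh s0 p < mu nt.1 * h.
  move=> [n t]; have [st|st] := leP s0 t; last by exists [::].
  have [|p pP] := @partition_ex _ s0 t (mu n * h) st; first by rewrite mulr_gt0.
  by exists p.
pose Y n t := euler phi (nth s0 (s0 :: p (n, t))) xi (size (p (n, t))).
(* [p] compared with any finer grid *)
have cmp n t r : s0 <= t -> path <%R s0 r -> last s0 r <= s1 ->
    {subset p (n, t) <= r} ->
    [/\ t \in s0 :: r & `|Y n t - euler phi (nth s0 (s0 :: r)) xi
      (index t (s0 :: r))| <= n.+1%:R^-1].
  move=> st sr lr pr; have [[sp /eqP /= pl] pm] := pP (n, t) st.
  have tp : nth s0 (s0 :: p (n, t)) (size (p (n, t))) = t.
    by rewrite -[RHS]pl [LHS](nth_last s0 (s0 :: p (n, t))).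
  split.
    move: (mem_last s0 (p (n, t))); rewrite pl !inE => /predU1P[->|/pr ->].
      by rewrite eqxx.
    by rewrite orbT.
  apply: le_trans (muP n).2.
  have mup k : (k < size (p (n, t)))%N -> scaled h (nth s0 (s0 :: p (n, t)) k)
      (nth s0 (s0 :: p (n, t)) k.+1) <= mu n.
    move=> kp; rewrite ler_pdivrMr//; apply: ltW.
    by apply: ((mesh_ltP _ _ _).1 pm k kp); rewrite mulr_gt0.
  have := euler_refine s01 sp sr lr pr q1 Bxi (ltW (mu_gt0 n)) mup (leqnn _).
  by rewrite tp.
have fine n m s t : s0 <= s -> s <= t -> t <= s1 -> exists r,
    [/\ path <%R s0 r, last s0 r <= s1, {subset p (n, s) <= r} &
      {subset p (m, t) <= r}].
  move=> ss st ts; have st0 := le_trans ss st.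
  have [[sp /eqP /= pl] _] := pP (n, s) ss; have [[sp' /eqP /= pl'] _] := pP (m, t) st0.
  have [r [sr pr p'r rp]] := common_refinement sp sp'; exists r; split => //.
  move: (mem_last s0 r); rewrite inE => /predU1P[->//|/rp].
  rewrite mem_cat => /orP[] lr.
    rewrite (le_trans _ (le_trans st ts))// -[leRHS]pl path_le_last//.
    by rewrite inE lr orbT.
  by rewrite (le_trans _ ts)// -[leRHS]pl' path_le_last// inE lr orbT.
have rgrid r : path <%R s0 r -> last s0 r <= s1 -> forall k, (k <= size r)%N ->
    `|euler phi (nth s0 (s0 :: r)) xi k - xi| <= 3 * q.
  move=> sr lr; apply: (euler_near (path_time_grid s01 sr lr)) => //.
exists Y; split.
- move=> n; rewrite /Y; have [pp _] := pP (n, s0) (lexx _).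
  by rewrite (itv_partitionxx pp).
- move=> n t /andP[st ts]; have [[sp /eqP /= pl] _] := pP (n, t) st.
  by apply: rgrid => //; rewrite pl.
- move=> n m t /andP[st ts].
  have [r [sr lr pr p'r]] := fine n m t t st (lexx _) ts.
  have [_ Yn] := cmp n t r st sr lr pr; have [_ Ym] := cmp m t r st sr lr p'r.
  rewrite -(subrK (euler phi (nth s0 (s0 :: r)) xi (index t (s0 :: r))) (Y n t)).
  by rewrite -addrA (le_trans (ler_normD _ _))// lerD// distrC.
move=> n s t ss st ts; have st0 := le_trans ss st.
have [r [sr lr pr p'r]] := fine n n s t ss st ts.
have [rs Ys] := cmp n s r ss sr lr pr; have [rt Yt] := cmp n t r st0 sr lr p'r.
have tg := path_time_grid s01 sr lr.
have near := rgrid r sr lr.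
have By k : (k <= size r)%N -> B (euler phi (nth s0 (s0 :: r)) xi k).
  by move=> /near kn; apply: Bxi; apply: le_trans q1.
have ij : (index s (s0 :: r) <= index t (s0 :: r) <= size r)%N.
  by rewrite index_mono// index_le.
have := euler_davie tg (fun k kN => By k (ltnW kN)) (fun _ _ => erefl) ij.
rewrite !nth_index//.
set ys := euler _ _ _ (index s _) in Ys *; set yt := euler _ _ _ _ in Yt * => D.
have Bs : B (Y n s).
  have [[sp /eqP /= pl] _] := pP (n, s) ss.
  apply: Bxi; apply: le_trans q1; apply: rgrid => //.
  by rewrite pl (le_trans st).
have Bys : B ys by apply: By; rewrite index_le.
have L := af_lip AF ss st ts (af_sub AF Bys) (af_sub AF Bs).
have -> : Y n t - phi s t (Y n s) =
  (Y n t - yt) + (yt - phi s t ys) + (phi s t ys - phi s t (Y n s)) by zmod.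
rewrite (le_trans (ler_normD _ _))//.
have {}L : `|phi s t ys - phi s t (Y n s)| <= 3 * n.+1%:R^-1.
  rewrite (le_trans L)// distrC ler_pM ?addr_ge0 ?mulr_ge0//.
  by have := eps1; lra.
have := ler_normD (Y n t - yt) (yt - phi s t ys).
move: Yt D L; move: (n.+1%:R^-1 : R) => i; lra.
Qed.

End Estimates.
End AlmostFlow.

Section LocalExistence.
Context {R : realType} {V : completeNormedModType R}.

Lemma almost_flow_path (s0 s1 h alpha a b c eps q : R) (B B1 : set V)
    (phi : R -> R -> V -> V) (xi : V) :
  almost_flow s0 s1 h alpha a eps q B B1 phi ->
  0 <= eps <= 1 -> 0 <= q -> 1 < b -> b < a -> 0 <= alpha ->
  sewing_const a c (2 * eps) -> sewing_const b c (2 * eps) ->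
  c * (20 * eps) <= 2^-1 -> s0 <= s1 -> 3 * q <= 1 ->
  (forall x, `|x - xi| <= 1 -> B x) ->
  exists Y : R -> V, [/\ Y s0 = xi,
    forall t, s0 <= t <= s1 -> `|Y t - xi| <= 3 * q &
    forall s t, s0 <= s -> s <= t -> t <= s1 ->
      `|Y t - phi s t (Y s)| <= q * scaled h s t `^ a].
Proof.
move=> AF eps01 q0 b1 lt_ba alpha0 ca cb ceps s01 q1 Bxi.
have [Yn [Yn0 Ynq Ync Ynd]] := approximations AF eps01 q0 b1 (ltW lt_ba) alpha0
  ca cb ceps s01 lt_ba q1 Bxi.
have /choice[Y YP] : forall t, exists l, s0 <= t <= s1 ->
    forall n, `|Yn n t - l| <= n.+1%:R^-1.
  move=> t; have [ts|] := boolP (s0 <= t <= s1); last by exists 0.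
  by have [l lP] := harmonic_cauchy_cvg (fun n m => Ync n m t ts); exists l.
have near t : s0 <= t <= s1 -> `|Y t - xi| <= 3 * q.
  move=> ts; apply: (le_of_harmonic ler01) => n; rewrite mul1r.
  have := Ynq n t ts; have := YP t ts n; rewrite distrC.
  have := ler_normD (Y t - Yn n t) (Yn n t - xi).
  rewrite (_ : Y t - Yn n t + (Yn n t - xi) = Y t - xi); last by zmod.
  move: (n.+1%:R^-1 : R) => i; lra.
have BY t : s0 <= t <= s1 -> B (Y t).
  by move=> /near tn; apply: Bxi; apply: le_trans q1.
exists Y; split => //.
- apply/eqP; rewrite -subr_eq0 -normr_le0; apply: (le_of_harmonic ler01) => n.
  by rewrite -(Yn0 n) add0r mul1r distrC YP// lexx s01.
move=> s t ss st ts; apply: (@le_of_harmonic _ _ _ 8) => // n.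
have ssi : s0 <= s <= s1 by rewrite ss (le_trans st).
have tsi : s0 <= t <= s1 by rewrite ts (le_trans ss).
have Bn : B (Yn n s).
  by apply: Bxi; apply: le_trans q1; exact: Ynq.
have := af_lip AF ss st ts (af_sub AF (BY s ssi)) (af_sub AF Bn).
have := Ynd n s t ss st ts; have := YP t tsi n; rewrite distrC => dt D L.
have {}L : `|phi s t (Yn n s) - phi s t (Y s)| <= 3 * n.+1%:R^-1.
  rewrite distrC (le_trans L)// ler_pM ?addr_ge0 ?mulr_ge0//.
  - by case/andP: eps01.
  - by case/andP: eps01; lra.
  - by rewrite distrC YP.
have -> : Y t - phi s t (Y s) = (Y t - Yn n t) +
  (Yn n t - phi s t (Yn n s)) + (phi s t (Yn n s) - phi s t (Y s)) by zmod.
rewrite (le_trans (ler_normD _ _))//.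
have := ler_normD (Y t - Yn n t) (Yn n t - phi s t (Yn n s)).
move: dt D L; move: (n.+1%:R^-1 : R) => i; lra.
Qed.

End LocalExistence.

(** * Iterated derivatives and norms of fields *)

Section IteratedDerivatives.
Context {R : realType} {U X : normedModType R}.
Implicit Types (f g : U -> X) (k n : nat).

Lemma clin_val_inj {V' W' : normedModType R} (L M : clin V' W') :
  (forall v, L v = M v) -> L = M.
Proof. by move=> LM; apply/val_inj/funext. Qed.

Lemma fderivSE f k x : differentiable (fderiv f k) x ->
  forall v, fderiv f k.+1 x v = 'd (fderiv f k) x v.
Proof.
move=> df v; rewrite [fderiv f k.+1 x]/= -[LHS]/(val _ v) insubdK//.
apply/clin_predP; split; first by move=> a y z; rewrite linearP.
by move=> y; apply: diff_continuous.
Qed.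

Lemma fderivB f g n : Cn n f -> Cn n g ->
  forall k, (k <= n)%N -> fderiv (f - g) k = fderiv f k - fderiv g k.
Proof.
move=> [df _] [dg _]; elim=> [//|k IH] kn; apply/funext => x.
apply: clin_val_inj => v.
have dfg := IH (ltnW kn).
have dk := df k x kn; have dk' := dg k x kn.
rewrite fderivSE ?dfg; last exact: differentiableB.
by rewrite -[RHS]/(fderiv f k.+1 x v - fderiv g k.+1 x v) !fderivSE// diffB.
Qed.

Lemma differentiable_fderivB f g n : Cn n f -> Cn n g ->
  forall k x, (k < n)%N -> differentiable (fderiv (f - g) k) x.
Proof.
move=> Cf Cg k x kn; rewrite (fderivB Cf Cg (ltnW kn)).
by apply: differentiableB; [exact: Cf.1|exact: Cg.1].
Qed.

Lemma fderiv_has_deriv f k x : differentiable (fderiv f k) x ->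
  has_deriv (fderiv f k) x (fderiv f k.+1 x).
Proof.
move=> df; apply: has_deriv_eq (differentiable_has_deriv df) => v.
by rewrite fderivSE.
Qed.

End IteratedDerivatives.

Section FieldNorms.
Context {R : realType} {V : normedModType R}.
Local Open Scope ereal_scope.

Lemma bounded_of_sup_sum n (S : 'I_n -> set (\bar R)) :
  (forall k, exists2 r, S k r & 0 <= r) ->
  \sum_(k < n) ereal_sup (S k) < +oo ->
  exists2 K : R, (1 <= K)%R & forall k r, S k r%:E -> (r <= K)%R.
Proof.
move=> Sne Sfin.
have S0 k : 0 <= ereal_sup (S k).
  by have [r Sr r0] := Sne k; apply: le_trans r0 _; exact: ereal_sup_ubound.
have Sk k : ereal_sup (S k) \is a fin_num.
  rewrite ge0_fin_numE//; apply: le_lt_trans Sfin.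
  by rewrite (bigD1 k)//= leeDl// sume_ge0.
exists (1 + \sum_(k < n) fine (ereal_sup (S k)))%R.
  by rewrite lerDl sumr_ge0// => k _; exact: fine_ge0.
move=> k r Sr; apply: (@le_trans _ _ (fine (ereal_sup (S k)))).
  by rewrite -lee_fin fineK//; exact: ereal_sup_ubound.
rewrite (bigD1 k)//= addrCA lerDl addr_ge0// sumr_ge0// => j _.
exact: fine_ge0.
Qed.


Lemma cn_incr T alpha n (beta : n.+1.-tuple R) (Phi : R -> V -> V) s t :
  in_Cfield T alpha beta Phi -> s \in `[0%R, T] -> t \in `[0%R, T] ->
  Cn n (Phi s) /\ Cn n (Phi t).
Proof. by move=> [C _] sT tT; split; exact: C. Qed.

Local Close Scope ereal_scope.
Local Open Scope ring_scope.

Lemma field_bound T alpha n (beta : n.+1.-tuple R) (Phi : R -> V -> V) :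
  0 < T -> 0 < alpha -> in_Cfield T alpha beta Phi ->
  exists2 K : R, 1 <= K & forall (k : 'I_n.+1) s t x,
    s \in `[0, T] -> t \in `[0, T] ->
    `|fderiv (incr Phi s t) k x| <=
      K * (`|t - s| `^ alpha * (1 + `|x|) `^ tnth beta k).
Proof.
move=> T0 a0 PhiC; have [_ Pfin] := PhiC.
have [|K K1 KP] := bounded_of_sup_sum _ Pfin.
  move=> k; eexists; first by exists 0, T, 0; split; last reflexivity;
    rewrite ?in_itv/= ?lexx ?ltW// eq_sym gt_eqF.
  by rewrite lee_fin divr_ge0// mulr_ge0// powR_ge0.
exists K => // k s t x sT tT; have [st|st] := eqVneq s t.
  have [Cs Ct] := cn_incr PhiC sT tT.
  rewrite /incr (fderivB Ct Cs) -1?ltnS//.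
  rewrite [X in X <= _](_ : _ = `|fderiv (Phi t) k x - fderiv (Phi s) k x|)//.
  by rewrite st !subrr !normr0 powR0 ?gt_eqF// mul0r mulr0.
have p0 : 0 < `|t - s| `^ alpha * (1 + `|x|) `^ tnth beta k.
  have ts : 0 < `|t - s| by rewrite normr_gt0 subr_eq0 eq_sym.
  by rewrite mulr_gt0// powR_gt0// ltr_pwDl.
by rewrite -ler_pdivrMr//; apply: (KP k); exists s, t, x.
Qed.

Lemma field2_bound T gamma m (beta1 beta2 : m.+1.-tuple R)
    (Psi : R -> R -> prod1 V V -> V) :
  0 < T -> 0 < gamma -> in_C2field T gamma beta1 beta2 Psi ->
  (forall s z, s \in `[0, T] -> Psi s s z = 0) ->
  exists2 K : R, 1 <= K & forall (k : 'I_m.+1) s t (z : prod1 V V),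
    s \in `[0, T] -> t \in `[0, T] ->
    `|fderiv (Psi s t) k z| <=
      K * (`|t - s| `^ gamma * (1 + `|z.1|) `^ tnth beta1 k
             * (1 + `|z.2|) `^ tnth beta2 k).
Proof.
move=> T0 a0 [PsiC Pfin] Psi0.
have [|K K1 KP] := bounded_of_sup_sum _ Pfin.
  move=> k; eexists; first by exists 0, T, 0, 0; split; last reflexivity;
    rewrite ?in_itv/= ?lexx ?ltW// eq_sym gt_eqF.
  by rewrite lee_fin divr_ge0// !mulr_ge0// powR_ge0.
exists K => // k s t z sT tT; have [st|st] := eqVneq s t.
  rewrite -{t}st in tT *.
  (* the zero function is its own difference with itself *)
  have -> : Psi s s = Psi s s - Psi s s.
    by apply/funext => y; rewrite subrr /= Psi0.
  have Cs := PsiC s s sT sT.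
  rewrite (fderivB Cs Cs) -1?ltnS//.
  rewrite [X in X <= _](_ : _ = `|fderiv (Psi s s) k z - fderiv (Psi s s) k z|)//.
  by rewrite !subrr !normr0 powR0 ?gt_eqF// !mul0r mulr0.
have p0 : 0 < `|t - s| `^ gamma * (1 + `|z.1|) `^ tnth beta1 k
             * (1 + `|z.2|) `^ tnth beta2 k.
  have ts : 0 < `|t - s| by rewrite normr_gt0 subr_eq0 eq_sym.
  by rewrite !mulr_gt0// powR_gt0// ltr_pwDl.
by rewrite -ler_pdivrMr//; apply: (KP k); exists s, t, z.1, z.2; case: z p0.
Qed.

End FieldNorms.

(** * Estimates on balls *)

Section Bounds.
Context {R : realType} {V : normedModType R}.

(** Here [w0] bounds the values of [F] and [w] everything in which a derivative
    of [F] is involved. The second level [P] has the size of a product of two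
    first-level quantities. *)
Record vf_bounds (C : set V) (w0 w : R) (F P : V -> V) (D : V -> clin V V) :
    Prop := VfBounds {
  vf_F : forall x, C x -> `|F x| <= w0;
  vf_lip : forall x y, C x -> C y -> `|F x - F y| <= w * `|x - y|;
  vf_4pt : forall x x' z, C x -> C (x + z) -> C x' -> C (x' + z) ->
    `|F (x + z) - F x - (F (x' + z) - F x')| <= w * `|z| * `|x - x'|;
  vf_D : forall x v, C x -> `|D x v| <= w * `|v|;
  vf_D_lip : forall x y v, C x -> C y ->
    `|D x v - D y v| <= w * `|x - y| * `|v|;
  vf_taylor : forall x z z' r, C x -> C (x + z) -> C (x + z') ->
    `|z| <= r -> `|z'| <= r ->
    `|F (x + z) - F (x + z') - D x (z - z')| <= w * r * `|z - z'|;
  vf_taylor_diff : forall x x' z, C x -> C (x + z) -> C x' -> C (x' + z) ->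
    `|F (x + z) - F x - D x z - (F (x' + z) - F x' - D x' z)| <=
      w * `|z| ^+ 2 * `|x - x'|;
  vf_P : forall x, C x -> `|P x| <= w0 * w;
  vf_P_lip : forall x y, C x -> C y -> `|P x - P y| <= w ^+ 2 * `|x - y|;
  vf_P_4pt : forall x x' z, C x -> C (x + z) -> C x' -> C (x' + z) ->
    `|P (x + z) - P x - (P (x' + z) - P x')| <= w ^+ 2 * `|z| * `|x - x'|
}.

Lemma vf_bounds_mono (C : set V) w0 w w0' w' F P D :
  vf_bounds C w0 w F P D -> 0 <= w0 -> w0 <= w0' -> 0 <= w -> w <= w' ->
  vf_bounds C w0' w' F P D.
Proof.
move=> [F0 Fl F4 Dv Dl Ft Ftd P0 Pl P4] w00 w0w0' wp ww'.
have w2 : w ^+ 2 <= w' ^+ 2 by rewrite ler_pXn2r// nnegrE (le_trans wp).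
have w'0 := le_trans wp ww'; have w'00 := le_trans w00 w0w0'.
split.
- by move=> x Cx; exact: le_trans (F0 x Cx) _.
- by move=> x y Cx Cy; apply: le_trans (Fl x y Cx Cy) _; rewrite ler_wpM2r.
- move=> x x' z c1 c2 c3 c4; apply: le_trans (F4 x x' z c1 c2 c3 c4) _.
  by rewrite -!mulrA ler_wpM2r// mulr_ge0.
- by move=> x v Cx; apply: le_trans (Dv x v Cx) _; rewrite ler_wpM2r.
- move=> x y v Cx Cy; apply: le_trans (Dl x y v Cx Cy) _.
  by rewrite -!mulrA ler_wpM2r// mulr_ge0.
- move=> x z z' r c1 c2 c3 zr zr'; apply: le_trans (Ft x z z' r c1 c2 c3 zr zr') _.
  by rewrite -!mulrA ler_wpM2r// mulr_ge0// (le_trans _ zr).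
- move=> x x' z c1 c2 c3 c4; apply: le_trans (Ftd x x' z c1 c2 c3 c4) _.
  by rewrite -!mulrA ler_wpM2r// mulr_ge0// exprn_ge0.
- by move=> x Cx; apply: le_trans (P0 x Cx) _; rewrite ler_pM.
- by move=> x y Cx Cy; apply: le_trans (Pl x y Cx Cy) _; rewrite ler_wpM2r.
- move=> x x' z c1 c2 c3 c4; apply: le_trans (P4 x x' z c1 c2 c3 c4) _.
  by rewrite -[leLHS]mulrA -[leRHS]mulrA ler_wpM2r// mulr_ge0.
Qed.

Lemma norm_diag (x : V) : `|((x, x) : prod1 V V)| = 2 * `|x|.
Proof. by rewrite [LHS]/(`|x| + `|x|) mulrDl mul1r. Qed.

(** Restricting [Q] to the diagonal doubles norms, hence the factor [4] for its
    second differences. *)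
Lemma vf_bounds_intro (C : set V) (w0 w m m' : R) (F : V -> V)
    (D1 : V -> clin V V) (D2 : V -> clin V (clin V V))
    (D3 : V -> clin V (clin V (clin V V)))
    (Q : prod1 V V -> V) (E1 : prod1 V V -> clin (prod1 V V) V)
    (E2 : prod1 V V -> clin (prod1 V V) (clin (prod1 V V) V)) :
  convex_set C -> 0 <= m -> m <= w -> 4 * m' <= w ^+ 2 ->
  (forall x, has_deriv F x (D1 x)) -> (forall x, has_deriv D1 x (D2 x)) ->
  (forall x, has_deriv D2 x (D3 x)) ->
  (forall z, has_deriv Q z (E1 z)) -> (forall z, has_deriv E1 z (E2 z)) ->
  (forall x, C x -> `|F x| <= w0) ->
  (forall x, C x -> `|D1 x| <= m) -> (forall x, C x -> `|D2 x| <= m) ->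
  (forall x, C x -> `|D3 x| <= m) ->
  (forall x, C x -> `|Q (x, x)| <= w0 * w) ->
  (forall z : prod1 V V, C z.1 -> C z.2 -> `|E1 z| <= m') ->
  (forall z : prod1 V V, C z.1 -> C z.2 -> `|E2 z| <= m') ->
  vf_bounds C w0 w F (fun x => Q (x, x)) D1.
Proof.
move=> Cc m0 mw m'w FD1 FD2 FD3 QE1 QE2 F0 D1m D2m D3m Q0 E1m E2m.
pose C2 : set (prod1 V V) := [set z | C z.1 /\ C z.2].
have Cc2 : convex_set C2.
  by move=> x y c [? ?] [? ?] c01; split; exact: Cc.
have E1m' z : C2 z -> `|E1 z| <= m' by move=> []; exact: E1m.
have E2m' z : C2 z -> `|E2 z| <= m' by move=> []; exact: E2m.
have FB1 w' : C w' -> has_deriv F w' (D1 w') by [].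
have FB2 w' : C w' -> has_deriv D1 w' (D2 w') by [].
have FB3 w' : C w' -> has_deriv D2 w' (D3 w') by [].
have QB1 w' : C2 w' -> has_deriv Q w' (E1 w') by [].
have QB2 w' : C2 w' -> has_deriv E1 w' (E2 w') by [].
have wp := le_trans m0 mw.
split => //.
- move=> x y Cx Cy; rewrite (le_trans (clin_lipschitz Cc FB1 D1m Cy Cx))//.
  by rewrite ler_wpM2r.
- move=> x x' z c1 c2 c3 c4.
  rewrite (le_trans (four_point Cc FB1 FB2 D2m c1 c2 c3 c4))//.
  by rewrite -!mulrA ler_wpM2r// mulr_ge0.
- move=> x v Cx; rewrite (le_trans (clin_le _ _))// ler_wpM2r//.
  by rewrite (le_trans (D1m _ Cx)).
- move=> x y v Cx Cy; rewrite -clinB (le_trans (clin_le _ _))// ler_wpM2r//.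
  rewrite (le_trans (clin_lipschitz Cc FB2 D2m Cy Cx))//.
  by rewrite ler_wpM2r.
- move=> x z z' r c1 c2 c3 zr zr'.
  rewrite (le_trans (taylor Cc FB1 FB2 D2m m0 c1 c2 c3 zr zr'))//.
  by rewrite -!mulrA ler_wpM2r// mulr_ge0// (le_trans _ zr).
- move=> x x' z c1 c2 c3 c4.
  rewrite (le_trans (taylor_diff Cc FB1 FB2 FB3 D3m m0 c1 c2 c3 c4))//.
  by rewrite -!mulrA ler_wpM2r// mulr_ge0// exprn_ge0.
- move=> x y Cx Cy.
  have := clin_lipschitz Cc2 QB1 E1m' (x := (y, y)) (y := (x, x)) (conj Cy Cy)
    (conj Cx Cx).
  rewrite (norm_diag (x - y)) => /le_trans; apply.
  rewrite mulrA ler_wpM2r//.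
  have : 0 <= m' by rewrite (le_trans _ (E1m (x, x) Cx Cx)).
  by move: m'w; set W := w ^+ 2; lra.
- move=> x x' z c1 c2 c3 c4.
  have := four_point Cc2 QB1 QB2 E2m' (x := (x, x)) (x' := (x', x'))
    (z := (z, z)) (conj c1 c1) (conj c2 c2) (conj c3 c3) (conj c4 c4).
  rewrite (norm_diag z) (norm_diag (x - x')) => /le_trans; apply.
  have -> : m' * (2 * `|z|) * (2 * `|x - x'|) = 4 * m' * (`|z| * `|x - x'|).
    by ring.
  by rewrite -[leRHS]mulrA ler_wpM2r// mulr_ge0.
Qed.

End Bounds.

(** * Growth exponents *)

Section Exponents.
Context {R : realType}.
Implicit Types (beta : 4.-tuple R).

Definition growth beta : R :=
  Num.max beta`_0 (Num.max beta`_1 beta`_2) +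
  Num.max beta`_1 (Num.max beta`_2 beta`_3) + beta`_1.

Variable beta : 4.-tuple R.
Hypothesis beta0 : forall k, 0 <= tnth beta k.

Lemma beta_nth_ge0 k : 0 <= beta`_k.
Proof.
have [k4|k4] := ltnP k 4; last by rewrite nth_default// size_tuple.
by rewrite -(tnth_nth 0 beta (Ordinal k4)).
Qed.

Let b0 := beta_nth_ge0 0.
Let b1 := beta_nth_ge0 1.
Let b2 := beta_nth_ge0 2.
Let b3 := beta_nth_ge0 3.

Lemma beta_le_growth k : tnth beta k <= growth beta.
Proof.
rewrite (tnth_nth 0) /growth.
set A := Num.max beta`_0 _; set C := Num.max beta`_1 (Num.max _ beta`_3).
have C0 : 0 <= C by rewrite le_max b1.
have A0 : 0 <= A by rewrite le_max b0.
case: k => -[|[|[|[|//]]]] /= _; have := b1.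
- have : beta`_0 <= A by rewrite le_max lexx.
  by lra.
- by lra.
- have : beta`_2 <= A by rewrite !le_max lexx !orbT.
  by lra.
- have : beta`_3 <= C by rewrite !le_max lexx !orbT.
  by lra.
Qed.

Lemma beta_star_sum_le (k : 'I_3) :
  [/\ 0 <= tnth (beta_star beta) k, 0 <= tnth (beta_star2 beta) k &
  tnth (beta_star beta) k + tnth (beta_star2 beta) k <= growth beta].
Proof.
rewrite !tnth_mktuple; split.
- by rewrite (le_trans b0)// bigmax_ge_id.
- by rewrite (le_trans b1)// bigmax_ge_id.
rewrite /growth -[leLHS]addr0 lerD// lerD//; apply/bigmax_leP; split.
- by rewrite le_max lexx.
- move=> [j jk] _ /=; have := leq_trans jk (ltn_ord k).
  by case: j {jk} => [|[|[|//]]] _; rewrite !le_max lexx ?orbT.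
- by rewrite le_max lexx.
- move=> [j jk] _ /=; have := leq_trans jk (ltn_ord k).
  by case: j {jk} => [|[|[|//]]] _; rewrite !le_max lexx ?orbT.
Qed.

Lemma beta_star0 : tnth (beta_star beta) ord0 = beta`_0.
Proof. by rewrite tnth_mktuple /= big_ord_recl big_ord0 maxxx. Qed.

Lemma beta_star20 : tnth (beta_star2 beta) ord0 = beta`_1.
Proof. by rewrite tnth_mktuple /= big_ord_recl big_ord0 maxxx. Qed.

End Exponents.

Section RoughBounds.
Context {R : realType} {V : normedModType R}.

Definition weight_ball (N : R) : set V := [set x | 1 + `|x| <= N].

Lemma convex_weight_ball N : convex_set (weight_ball N).
Proof.
move=> x y c xN yN c01.
have := @convex_ball _ V 0 (N - 1) x y c; rewrite /weight_ball /= !subr0.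
by move: xN yN; rewrite /weight_ball /= -!lerBrDl => xN yN; apply.
Qed.

Lemma weight_powR_le (N x e G : R) : 0 <= x -> 1 + x <= N -> 0 <= e -> e <= G ->
  (1 + x) `^ e <= N `^ G.
Proof.
move=> x0 xN e0 eG; have N1 : 1 <= N by rewrite (le_trans _ xN)// lerDl.
have N0 : 0 <= N by apply: le_trans N1.
rewrite (@le_trans _ _ (N `^ e))//; last exact: ler_powR.
by apply: ge0_ler_powR => //; rewrite nnegrE// addr_ge0.
Qed.

Lemma chen_diag0 T W (WW : R -> R -> prod1 V V -> V) : chen T W WW ->
  forall s z, s \in `[0, T] -> WW s s z = 0.
Proof.
move=> ch s [x y] sT; have := ch x y s s s sT sT sT.
by rewrite /incr !subrr /= sub0r linear0 => /eqP; rewrite oppr_eq0 => /eqP.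
Qed.

(** Every power of the weight is replaced by the power [growth beta], except in
    the values of [W]: there the exponent [beta`_0] is kept, since it governs
    the growth of solutions. *)
Lemma rough_bounds (T alpha : R) (beta : 4.-tuple R) (W : R -> V -> V)
    (WW : R -> R -> prod1 V V -> V) :
  0 < T -> 0 < alpha -> (forall k, 0 <= tnth beta k) ->
  nonlinear_rough_path T alpha beta W WW ->
  exists2 K : R, 1 <= K & forall N h eps q : R, 1 <= N -> 0 < h ->
    4 * K * (N `^ growth beta * h `^ alpha) <= eps ->
    K * (N `^ beta`_0 * h `^ alpha) <= q ->
    forall s t, 0 <= s -> s <= t -> t <= T ->
    vf_bounds (weight_ball N) (q * scaled h s t `^ alpha)
      (eps * scaled h s t `^ alpha) (incr W s t) (fun x => WW s t (x, x))
      (fderiv (incr W s t) 1 : V -> clin V V).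
Proof.
move=> T0 a0 bt0 [WC WWC ch].
have [K1 K1ge K1P] := field_bound T0 a0 WC.
have a20 : 0 < 2 * alpha by rewrite mulr_gt0.
have [K2 K2ge K2P] := field2_bound T0 a20 WWC (chen_diag0 ch).
exists (K1 + K2); first by rewrite (le_trans K1ge)// lerDl (le_trans ler01).
set K := K1 + K2 => N h eps q N1 h0 epsK qK s t s0 st tT.
have N0 : 0 <= N by apply: le_trans N1.
have K1K : K1 <= K by rewrite lerDl (le_trans ler01).
have K2K : K2 <= K by rewrite lerDr (le_trans ler01).
have Kge1 : 1 <= K by apply: le_trans K1K.
have sT : s \in `[0, T] by rewrite in_itv/= s0 (le_trans st).
have tT' : t \in `[0, T] by rewrite in_itv/= tT (le_trans s0).
set G := growth beta in epsK *.
set d := scaled h s t.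
have d0 : 0 <= d by rewrite /d divr_ge0 ?subr_ge0// ltW.
have tsE : t - s = h * d by rewrite /d /scaled mulrC divfK// gt_eqF.
have ts0 : `|t - s| = t - s by rewrite ger0_norm// subr_ge0.
have tsa : `|t - s| `^ alpha = h `^ alpha * d `^ alpha.
  by rewrite ts0 tsE powRM// ltW.
have tsa2 : `|t - s| `^ (2 * alpha) = (h `^ alpha * d `^ alpha) ^+ 2.
  by rewrite mulrC powRrM tsa powR_mulrn// mulr_ge0// powR_ge0.
set ha := h `^ alpha in epsK qK tsa tsa2.
set da := d `^ alpha in tsa tsa2 *.
have ha0 : 0 <= ha by exact: powR_ge0.
have da0 : 0 <= da by exact: powR_ge0.
set NG := N `^ G in epsK.
have NG0 : 0 <= NG by exact: powR_ge0.
have Nb0 : 0 <= N `^ beta`_0 by exact: powR_ge0.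
have NGge1 : 1 <= NG.
  rewrite -(powRr0 N) ler_powR//.
  exact: le_trans (bt0 ord0) (beta_le_growth bt0 _).
have [WCs WCt] := cn_incr WC sT tT'.
have dW k x := differentiable_fderivB WCt WCs (k := k) x.
have WWCn := (WWC.1 s t sT tT').1.
have eps0 : 0 <= eps by apply: le_trans epsK; rewrite !mulr_ge0// (le_trans ler01).
have q0 : 0 <= q by apply: le_trans qK; rewrite !mulr_ge0// (le_trans ler01).
have NGle : K * (NG * ha) <= eps / 4 by rewrite ler_pdivlMr//; lra.
have NGle' : NG * ha <= eps / 4.
  by apply: le_trans NGle; rewrite -[leLHS]mul1r ler_wpM2r// mulr_ge0.
have Wb (k : 'I_4) x : weight_ball N x ->
    `|fderiv (incr W s t) k x| <= eps / 4 * da.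
  move=> xN; rewrite (le_trans (K1P k s t x sT tT'))// tsa.
  apply: le_trans (ler_wpM2r da0 NGle).
  rewrite (_ : K * _ * _ = K * (ha * da * NG)); last by ring.
  rewrite ler_pM ?mulr_ge0 ?powR_ge0// ?(le_trans ler01)//.
  by rewrite ler_wpM2l ?mulr_ge0// weight_powR_le// beta_le_growth.
have WWb (k : 'I_3) (z : prod1 V V) : weight_ball N z.1 -> weight_ball N z.2 ->
    `|fderiv (WW s t) k z| <= (eps / 4 * da) ^+ 2.
  move=> z1 z2; rewrite (le_trans (K2P k s t z sT tT'))// tsa2.
  have [bs0 bss0 bsG] := beta_star_sum_le bt0 k.
  have bsNG : (1 + `|z.1|) `^ tnth (beta_star beta) k *
      (1 + `|z.2|) `^ tnth (beta_star2 beta) k <= NG.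
    apply: (@le_trans _ _ (N `^ (tnth (beta_star beta) k + tnth (beta_star2 beta) k))).
      rewrite powRD; last by apply/implyP => _; rewrite gt_eqF// (lt_le_trans ltr01).
      by rewrite ler_pM ?powR_ge0// weight_powR_le.
    exact: ler_powR.
  apply: (@le_trans _ _ ((K * (NG * ha) * da) ^+ 2)); last first.
    by rewrite ler_pXn2r ?nnegrE ?mulr_ge0 ?ler_wpM2r// ?divr_ge0// (le_trans ler01).
  rewrite -[X in K2 * X]mulrA exprMn.
  rewrite (_ : (K * (NG * ha) * da) ^+ 2 =
     K * (ha ^+ 2 * da ^+ 2 * NG) * (K * NG)); last by ring.
  apply: (@le_trans _ _ (K * (ha ^+ 2 * da ^+ 2 * NG))).
    rewrite ler_pM ?mulr_ge0 ?exprn_ge0 ?powR_ge0// ?(le_trans ler01)//.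
    by rewrite ler_wpM2l ?mulr_ge0 ?exprn_ge0.
  rewrite ler_peMr ?mulr_ge0 ?exprn_ge0// ?(le_trans ler01)//.
  by rewrite mulr_ege1.
have e4 : eps / 4 * da <= eps * da by rewrite ler_wpM2r//; lra.
apply: (@vf_bounds_intro _ _ (weight_ball N) (q * da) (eps * da) (eps / 4 * da)
  ((eps / 4 * da) ^+ 2) (incr W s t) (fderiv (incr W s t) 1)
  (fderiv (incr W s t) 2) (fderiv (incr W s t) 3) (WW s t)
  (fderiv (WW s t) 1) (fderiv (WW s t) 2)) => //.
- exact: convex_weight_ball.
- by rewrite mulr_ge0// divr_ge0.
- rewrite (_ : 4 * _ = (eps * da) ^+ 2 / 4); last by field.
  by rewrite ler_pdivrMr// ler_peMr// ?exprn_ge0 ?mulr_ge0// ler1n.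
- by move=> x; apply: (fderiv_has_deriv (k := 0)); exact: dW.
- by move=> x; apply: (fderiv_has_deriv (k := 1)); exact: dW.
- by move=> x; apply: (fderiv_has_deriv (k := 2)); exact: dW.
- by move=> x; apply: (fderiv_has_deriv (k := 0)); exact: WWCn.
- by move=> x; apply: (fderiv_has_deriv (k := 1)); exact: WWCn.
- move=> x xN; rewrite (le_trans (K1P ord0 s t x sT tT'))// tsa.
  apply: le_trans (ler_wpM2r da0 qK).
  rewrite (_ : K * _ * _ = K * (ha * da * N `^ beta`_0)); last by ring.
  rewrite ler_pM ?mulr_ge0 ?powR_ge0// ?(le_trans ler01)//.
  by rewrite ler_wpM2l ?mulr_ge0// weight_powR_le// (tnth_nth 0).
- by move=> x xN; exact: (Wb (@Ordinal 4 1 isT)).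
- by move=> x xN; exact: (Wb (@Ordinal 4 2 isT)).
- by move=> x xN; exact: (Wb (@Ordinal 4 3 isT)).
- move=> x xN; rewrite (le_trans (K2P ord0 s t (x, x) sT tT'))// tsa2.
  rewrite beta_star0 beta_star20 /=.
  have N1G : N `^ beta`_1 * ha <= eps.
    apply: (@le_trans _ _ (NG * ha)); last by lra.
    rewrite ler_wpM2r// ler_powR// -(tnth_nth 0 beta (@Ordinal 4 1 isT)).
    exact: beta_le_growth.
  apply: (@le_trans _ _ (K * (N `^ beta`_0 * ha) * da * (N `^ beta`_1 * ha * da))).
    rewrite (_ : K * _ * _ * _ =
      K * ((ha * da) ^+ 2 * N `^ beta`_0 * N `^ beta`_1)); last by ring.
    rewrite ler_pM ?mulr_ge0 ?exprn_ge0 ?powR_ge0 ?mulr_ge0// ?(le_trans ler01)//.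
    rewrite ler_pM ?mulr_ge0 ?exprn_ge0 ?powR_ge0 ?mulr_ge0//.
      by rewrite ler_wpM2l ?exprn_ge0 ?mulr_ge0// weight_powR_le// beta_nth_ge0.
    by rewrite weight_powR_le// beta_nth_ge0.
  rewrite ler_pM ?mulr_ge0 ?powR_ge0// ?(le_trans ler01)// ler_wpM2r//.
- by move=> z z1 z2; exact: (WWb (@Ordinal 3 1 isT)).
- by move=> z z1 z2; exact: (WWb (@Ordinal 3 2 isT)).
Qed.

End RoughBounds.

(** * One step of the equation *)

Section Defect.
Context {R : realType} {V : normedModType R}.
Variables (C : set V) (w0 w : R) (F P F' P' : V -> V) (D D' : V -> clin V V).
Hypotheses (bF : vf_bounds C w0 w F P D) (bF' : vf_bounds C w0 w F' P' D').
Hypotheses (w00 : 0 <= w0) (w0w : w0 <= w) (w1 : w <= 1).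

Let wp : 0 <= w := le_trans w00 w0w.
Let w2w : w ^+ 2 <= w. Proof. by rewrite expr2 -[leRHS]mulr1 ler_wpM2l. Qed.
Let z x := F x + P x.

Lemma step_size x : C x -> `|z x| <= 2 * w0.
Proof.
move=> Cx; rewrite (le_trans (ler_normD _ _))//.
have := vf_F bF Cx; have := vf_P bF Cx; have : w0 * w <= w0 * 1.
  by rewrite ler_wpM2l.
lra.
Qed.

Lemma step_lip x y : C x -> C y -> `|z x - z y| <= 2 * w * `|x - y|.
Proof.
move=> Cx Cy; have -> : z x - z y = (F x - F y) + (P x - P y) by rewrite /z; zmod.
rewrite (le_trans (ler_normD _ _))//.
have := vf_lip bF Cx Cy; have := vf_P_lip bF Cx Cy.
have : w ^+ 2 * `|x - y| <= w * `|x - y|.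
  by rewrite ler_wpM2r.
lra.
Qed.

Lemma step_4pt x y u v : C x -> C y -> C u -> C v -> C (v + (x - y)) ->
  `|z x - z y - (z u - z v)| <=
    2 * w * `|x - y - (u - v)| + 2 * w * `|x - y| * `|y - v|.
Proof.
move=> Cx Cy Cu Cv Cm; set m := v + (x - y).
have xE : x = y + (x - y) by zmod.
have -> : z x - z y - (z u - z v) =
  (z x - z y - (z m - z v)) + (z m - z u) by zmod.
rewrite (le_trans (ler_normD _ _))// addrC lerD//.
  have -> : x - y - (u - v) = m - u by rewrite /m; zmod.
  exact: step_lip.
have -> : z x - z y - (z m - z v) = (F (y + (x - y)) - F y - (F m - F v)) +
    (P (y + (x - y)) - P y - (P m - P v)) by rewrite -xE /z; zmod.
have Cx' : C (y + (x - y)) by rewrite -xE.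
rewrite (le_trans (ler_normD _ _))//.
have := vf_4pt bF Cy Cx' Cv Cm; have := vf_P_4pt bF Cy Cx' Cv Cm.
have : w ^+ 2 * `|x - y| * `|y - v| <= w * `|x - y| * `|y - v|.
  by rewrite ler_wpM2r// ler_wpM2r.
set W2 := w ^+ 2; lra.
Qed.

(** The excess of two consecutive steps over a long one, once Chen's relation
    is taken into account: compare [chen_step]. *)
Let defect x := F' (x + z x) - F' x - D' x (F x) + (P' (x + z x) - P' x).

Let D'D x v v' : D' x (v + v') = D' x v + D' x v'.
Proof. by have := clin_linear (D' x) 1 v v'; rewrite !scale1r. Qed.

Let defectE x : defect x = (F' (x + z x) - F' x - D' x (z x)) + D' x (P x)
  + (P' (x + z x) - P' x).
Proof. by rewrite /defect /z D'D; zmod. Qed.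

(** The defect consists of the Taylor remainder of [F'], of [D'] applied to the
    second level, and of the increment of [P']: three small factors each. *)
Lemma defect_le x : C x -> C (x + z x) -> `|defect x| <= 7 * w ^+ 2 * w0.
Proof.
move=> Cx Cz; have zs := step_size Cx.
have w20 : 0 <= 2 * w0 by rewrite mulr_ge0.
have Cx0 : C (x + 0) by rewrite addr0.
have n0 : `|0 : V| <= 2 * w0 by rewrite normr0.
have := vf_taylor bF' Cx Cz Cx0 zs n0; rewrite addr0 subr0 => t1.
have t2 := vf_D bF' (P x) Cx.
have t3 := vf_P bF Cx.
have := vf_P_lip bF' Cz Cx; rewrite [x + z x - x]addrC addKr => t4.
have {}t2 : `|D' x (P x)| <= w ^+ 2 * w0.
  by rewrite (le_trans t2)// expr2 -mulrA ler_wpM2l// mulrC.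
have {}t4 : `|P' (x + z x) - P' x| <= w ^+ 2 * (2 * w0).
  by rewrite (le_trans t4)// ler_wpM2l// exprn_ge0.
have {}t1 : `|F' (x + z x) - F' x - D' x (z x)| <= w ^+ 2 * (4 * w0).
  rewrite (le_trans t1)//.
  apply: (@le_trans _ _ (w * (2 * w) * (2 * w0))).
    by rewrite ler_pM ?mulr_ge0// ler_wpM2l// ler_wpM2l.
  by rewrite le_eqVlt; apply/orP; left; apply/eqP; ring.
rewrite defectE (le_trans (ler_normD _ _))//.
have := ler_normD (F' (x + z x) - F' x - D' x (z x)) (D' x (P x)).
move: t1 t2 t4; set W := w ^+ 2; lra.
Qed.

(** The mixed point [y + z x] separates the change of the starting point from
    the change of the increment. *)
Lemma defect_lip x y : C x -> C (x + z x) -> C y -> C (y + z y) ->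
  C (y + z x) -> `|defect x - defect y| <= 14 * w ^+ 3 * `|x - y|.
Proof.
move=> Cx Cxz Cy Cyz Cyzx.
have zsx := step_size Cx; have zsy := step_size Cy.
have zl := step_lip Cx Cy.
have w20 : 0 <= 2 * w0 by rewrite mulr_ge0.
set n := `|x - y| in zl *; have n0 : 0 <= n by exact: normr_ge0.
have w30 : 0 <= w ^+ 3 := exprn_ge0 3 wp.
have t1 : `|F' (x + z x) - F' x - D' x (z x) - (F' (y + z x) - F' y - D' y (z x))|
    <= 4 * w ^+ 3 * n.
  rewrite (le_trans (vf_taylor_diff bF' Cx Cxz Cy Cyzx))// ler_wpM2r//.
  have -> : 4 * w ^+ 3 = w * (2 * w) ^+ 2 by ring.
  rewrite ler_wpM2l// ler_pXn2r ?nnegrE ?mulr_ge0//.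
  by rewrite (le_trans zsx)// ler_wpM2l.
have t2 : `|F' (y + z x) - F' (y + z y) - D' y (z x - z y)| <= 4 * w ^+ 3 * n.
  rewrite (le_trans (vf_taylor bF' Cy Cyzx Cyz zsx zsy))//.
  have -> : 4 * w ^+ 3 * n = w * (2 * w) * (2 * w * n) by ring.
  by rewrite ler_pM ?mulr_ge0// ler_wpM2l// ler_wpM2l.
have t3 : `|D' x (P x) - D' y (P x)| <= w ^+ 3 * n.
  rewrite (le_trans (vf_D_lip bF' (P x) Cx Cy))//.
  have -> : w ^+ 3 * n = w * n * (w * w) by ring.
  rewrite ler_wpM2l ?mulr_ge0// (le_trans (vf_P bF Cx))// ler_wpM2r//.
have t4 : `|D' y (P x - P y)| <= w ^+ 3 * n.
  rewrite (le_trans (vf_D bF' (P x - P y) Cy))//.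
  have -> : w ^+ 3 * n = w * (w ^+ 2 * n) by ring.
  by rewrite ler_wpM2l// (vf_P_lip bF).
have t5 : `|P' (x + z x) - P' x - (P' (y + z x) - P' y)| <= 2 * w ^+ 3 * n.
  rewrite (le_trans (vf_P_4pt bF' Cx Cxz Cy Cyzx))// ler_wpM2r//.
  have -> : 2 * w ^+ 3 = w ^+ 2 * (2 * w) by ring.
  by rewrite ler_wpM2l ?exprn_ge0// (le_trans zsx)// ler_wpM2l.
have t6 : `|P' (y + z x) - P' (y + z y)| <= 2 * w ^+ 3 * n.
  rewrite (le_trans (vf_P_lip bF' Cyzx Cyz))//.
  have -> : 2 * w ^+ 3 * n = w ^+ 2 * (2 * w * n) by ring.
  rewrite (_ : y + z x - (y + z y) = z x - z y); last by zmod.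
  by rewrite ler_wpM2l// exprn_ge0.
have -> : defect x - defect y =
  (F' (x + z x) - F' x - D' x (z x) - (F' (y + z x) - F' y - D' y (z x)))
  + (F' (y + z x) - F' (y + z y) - D' y (z x - z y))
  + (D' x (P x) - D' y (P x)) + D' y (P x - P y)
  + (P' (x + z x) - P' x - (P' (y + z x) - P' y))
  + (P' (y + z x) - P' (y + z y)).
  by rewrite !defectE !clin_subr; zmod.
have h := le_trans (ler_normD _ _) (lerD t1 t2).
have {}h := le_trans (ler_normD _ _) (lerD h t3).
have {}h := le_trans (ler_normD _ _) (lerD h t4).
have {}h := le_trans (ler_normD _ _) (lerD h t5).
have {}h := le_trans (ler_normD _ _) (lerD h t6).
apply: (le_trans h); rewrite le_eqVlt; apply/orP; left; apply/eqP; ring.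
Qed.

End Defect.

Section StepFlow.
Context {R : realType} {V : normedModType R}.
Variables (T alpha : R) (W : R -> V -> V) (WW : R -> R -> prod1 V V -> V).

Definition step s t (x : V) : V := x + (incr W s t x + WW s t (x, x)).

Notation D1 s t := (fderiv (incr W s t) 1 : V -> clin V V).

(** Chen's relation, in the form it is used: what a step misses when its
    starting point moves from [x] to [y] on the way. *)
Lemma chen_step s u t (x y : V) : chen T W WW ->
  (forall r r' z, r \in `[0, T] -> r' \in `[0, T] ->
     differentiable (incr W r r') z) ->
  s \in `[0, T] -> u \in `[0, T] -> t \in `[0, T] ->
  step u t y - step s t x - (y - step s u x) =
  incr W u t y - incr W u t x - D1 u t x (incr W s u x)
  + (WW u t (y, y) - WW u t (x, x)).
Proof.
move=> ch dW sT uT tT; have := ch x x s u t sT uT tT.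
have -> : D1 u t x (incr W s u x) = 'd (incr W u t) x (incr W s u x).
  by apply: (fderivSE (k := 0)); exact: dW.
move: ('d _ _ _) => dd /eqP; rewrite subr_eq => /eqP.
move=> /eqP; rewrite subr_eq => /eqP Wst.
have Wi : incr W s t x = incr W s u x + incr W u t x.
  by rewrite /incr -[LHS]/(W t x - W s x) -[RHS]/(W u x - W s x + (W t x - W u x)); zmod.
by rewrite /step Wst Wi; zmod.
Qed.

(** Second differences at four points of weight at most [2 * M] involve a fifth
    one of weight at most [6 * M]. *)
Lemma step_almost_flow (s0 s1 h eps q M N : R) :
  chen T W WW ->
  (forall r r' z, r \in `[0, T] -> r' \in `[0, T] ->
     differentiable (incr W r r') z) ->
  (forall s z, s \in `[0, T] -> WW s s z = 0) ->
  (forall s t, 0 <= s -> s <= t -> t <= T ->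
    vf_bounds (weight_ball N) (q * scaled h s t `^ alpha)
      (eps * scaled h s t `^ alpha) (incr W s t) (fun x => WW s t (x, x))
      (D1 s t)) ->
  0 < h -> 0 <= s0 -> s1 <= T -> s1 - s0 <= h -> 0 <= alpha ->
  0 <= q -> q <= eps -> eps <= 1 -> 2 * q <= 1 -> 1 <= M -> 6 * M <= N ->
  almost_flow s0 s1 h alpha (3 * alpha) eps q (weight_ball M)
    (weight_ball (2 * M)) step.
Proof.
move=> ch dW WW0 HB h0 s00 s1T s01 al0 q0 qe e1 q2 M1 MN.
have e0 : 0 <= eps := le_trans q0 qe.
have sc0 s t : s <= t -> 0 <= scaled h s t.
  by move=> st; rewrite divr_ge0 ?subr_ge0// ltW.
have sc1 s t : s0 <= s -> s <= t -> t <= s1 -> scaled h s t `^ alpha <= 1.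
  move=> ss st ts; have <- : 1 `^ alpha = 1 :> R by rewrite powR1.
  apply: ge0_ler_powR; rewrite ?nnegrE ?sc0//.
  by rewrite ler_pdivrMr// mul1r (le_trans _ s01)// lerB.
have HB' s t u v : s0 <= s -> s <= t -> t <= s1 -> u <= s -> t <= v ->
    vf_bounds (weight_ball N) (q * scaled h u v `^ alpha)
      (eps * scaled h u v `^ alpha) (incr W s t) (fun x => WW s t (x, x))
      (D1 s t).
  move=> ss st ts us tv.
  have p0 : 0 <= scaled h s t `^ alpha by exact: powR_ge0.
  have ple : scaled h s t `^ alpha <= scaled h u v `^ alpha.
    apply: ge0_ler_powR; rewrite ?nnegrE ?sc0// ?(le_trans us)// ?(le_trans st)//.
    by rewrite ler_pM2r ?invr_gt0// lerB.
  apply: (vf_bounds_mono (HB s t (le_trans s00 ss) st (le_trans ts s1T)));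
    rewrite ?mulr_ge0// ler_wpM2l//.
have inN M' (x : V) : M' <= N -> weight_ball M' x -> weight_ball N x.
  by move=> MN' /le_trans; apply.
have MN1 : M <= N by lra.
have MN2 : 2 * M <= N by lra.
have wqe s t : 0 <= q * scaled h s t `^ alpha <= eps * scaled h s t `^ alpha.
  by rewrite mulr_ge0 ?powR_ge0//= ler_wpM2r// powR_ge0.
have we s t : s0 <= s -> s <= t -> t <= s1 -> eps * scaled h s t `^ alpha <= eps.
  by move=> *; rewrite -[leRHS]mulr1 ler_wpM2l// sc1.
have we1 s t : s0 <= s -> s <= t -> t <= s1 -> eps * scaled h s t `^ alpha <= 1.
  by move=> ss st ts; rewrite (le_trans (we _ _ ss st ts)).
have mv s t x : s0 <= s -> s <= t -> t <= s1 -> weight_ball M x ->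
    `|incr W s t x + WW s t (x, x)| <= 2 * q * scaled h s t `^ alpha.
  move=> ss st ts Bx; have /andP[w00 w0w] := wqe s t.
  rewrite -mulrA.
  apply: (step_size (HB' s t s t ss st ts (lexx _) (lexx _)) w00 (we1 _ _ ss st ts)).
  exact: inN Bx.
have mv1 s t x : s0 <= s -> s <= t -> t <= s1 -> weight_ball M x ->
    `|incr W s t x + WW s t (x, x)| <= 1.
  move=> ss st ts Bx; rewrite (le_trans (mv _ _ _ ss st ts Bx))//.
  by rewrite (le_trans _ q2)// -[leRHS]mulr1 ler_wpM2l ?mulr_ge0// sc1.
have B2 s t x y : s0 <= s -> s <= t -> t <= s1 -> weight_ball M x ->
    weight_ball M y -> weight_ball (2 * M) (y + (incr W s t x + WW s t (x, x))).
  rewrite /weight_ball /= => ss st ts Bx By.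
  have := ler_normD y (incr W s t x + WW s t (x, x)).
  have := mv1 s t x ss st ts Bx; lra.
have inT s : s0 <= s -> s <= s1 -> s \in `[0, T].
  by move=> ss ts; rewrite in_itv/= (le_trans s00 ss) (le_trans ts).
have sub : weight_ball M `<=` (weight_ball (2 * M) : set V).
  by rewrite /weight_ball => x /= Bx; lra.
have pow3 s t : s <= t -> (scaled h s t `^ alpha) ^+ 3 = scaled h s t `^ (3 * alpha).
  by move=> st; rewrite [3 * alpha]mulrC powRrM powR_mulrn// powR_ge0.
split => //.
- by move=> s t x ss st ts Bx; exact: B2.
- move=> s x ss s1s; rewrite /step WW0 ?inT// /incr subrr -[(0 : V -> V) x]/(0 : V).
  by rewrite !addr0.
- move=> s t x ss st ts Bx; rewrite /step [x + _]addrC addrK.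
  exact: mv.
- move=> s t x y ss st ts Bx By; have /andP[w00 w0w] := wqe s t.
  have L := step_lip (HB' s t s t ss st ts (lexx _) (lexx _)) w00 w0w
    (we1 _ _ ss st ts) (inN _ _ MN2 Bx) (inN _ _ MN2 By).
  have -> : step s t x - step s t y = (x - y) +
    (incr W s t x + WW s t (x, x) - (incr W s t y + WW s t (y, y))).
    by rewrite /step; zmod.
  rewrite (le_trans (ler_normD _ _))// mulrDl mul1r lerD// (le_trans L)//.
  by rewrite ler_wpM2r// ler_wpM2l// we.
- move=> s t x y u v ss st ts Bx By Bu Bv; have /andP[w00 w0w] := wqe s t.
  have Bm : weight_ball N (v + (x - y)).
    move: Bx By Bv; rewrite /weight_ball /=.
    have := ler_normD v (x - y); have := ler_normB x y; lra.
  have L := step_4pt (HB' s t s t ss st ts (lexx _) (lexx _)) w00 w0w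
    (we1 _ _ ss st ts) (inN _ _ MN2 Bx) (inN _ _ MN2 By) (inN _ _ MN2 Bu)
    (inN _ _ MN2 Bv) Bm.
  have -> : step s t x - step s t y - (step s t u - step s t v) =
    (x - y - (u - v)) +
    (incr W s t x + WW s t (x, x) - (incr W s t y + WW s t (y, y)) -
    (incr W s t u + WW s t (u, u) - (incr W s t v + WW s t (v, v)))).
    by rewrite /step; zmod.
  rewrite (le_trans (ler_normD _ _))// mulrDl mul1r -[leRHS]addrA lerD//.
  rewrite (le_trans L)//.
  have w2e : 2 * (eps * scaled h s t `^ alpha) <= 2 * eps.
    by rewrite ler_wpM2l// we.
  rewrite lerD//; first by rewrite ler_wpM2r.
  by rewrite ler_wpM2r// ler_wpM2r.
- move=> s u t x ss su ut ts Bx; have st := le_trans su ut.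
  have us := le_trans ut ts; have su0 := le_trans ss su.
  have /andP[w00 w0w] := wqe s t.
  have := chen_step x (step s u x) ch dW (inT _ ss (le_trans su us))
    (inT _ su0 us) (inT _ (le_trans ss st) ts).
  rewrite subrr subr0 => ->.
  have Bz := inN _ _ MN2 (B2 s u x x ss su us Bx Bx).
  have := defect_le (HB' s u s t ss su us (lexx _) ut)
    (HB' u t s t su0 ut ts su (lexx _)) w00 w0w (we1 _ _ ss st ts)
    (inN _ _ MN1 Bx) Bz.
  move=> /le_trans; apply; rewrite -pow3//.
  have ee : 7 * eps ^+ 2 * q <= 7 * eps * q.
    by rewrite ler_wpM2r// ler_wpM2l// expr2 -[leRHS]mulr1 ler_wpM2l.
  move/(ler_wpM2r (exprn_ge0 3 (powR_ge0 (scaled h s t) alpha))): ee.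
  by move=> /(le_trans _); apply; rewrite le_eqVlt; apply/orP; left; apply/eqP; ring.
- move=> s u t x y ss su ut ts Bx By; have st := le_trans su ut.
  have us := le_trans ut ts; have su0 := le_trans ss su.
  have /andP[w00 w0w] := wqe s t.
  have := chen_step x (step s u x) ch dW (inT _ ss (le_trans su us))
    (inT _ su0 us) (inT _ (le_trans ss st) ts).
  have := chen_step y (step s u y) ch dW (inT _ ss (le_trans su us))
    (inT _ su0 us) (inT _ (le_trans ss st) ts).
  rewrite !subrr !subr0 => -> ->.
  have Bz := inN _ _ MN2 (B2 s u x x ss su us Bx Bx).
  have Bz' := inN _ _ MN2 (B2 s u y y ss su us By By).
  have Bzz := inN _ _ MN2 (B2 s u x y ss su us Bx By).
  have := defect_lip (HB' s u s t ss su us (lexx _) ut)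
    (HB' u t s t su0 ut ts su (lexx _)) w00 w0w (we1 _ _ ss st ts)
    (inN _ _ MN1 Bx) Bz (inN _ _ MN1 By) Bz' Bzz.
  move=> /le_trans; apply; rewrite -pow3// ler_wpM2r// exprMn mulrA.
  rewrite ler_wpM2r ?exprn_ge0 ?powR_ge0// ler_wpM2l//.
  by rewrite exprS -[leRHS]mulr1 ler_wpM2l// exprn_ile1.
Qed.

End StepFlow.

(** * Constants *)

Section Constants.
Context {R : realType} {V : normedModType R}.

Lemma sewing_const_mono (a b c del : R) : b <= a -> sewing_const b c del ->
  sewing_const a c del.
Proof.
move=> ba [d0 c1 bc]; split => //; apply: le_trans bc; rewrite lerD2r.
rewrite ler_wpM2r ?(le_trans ler01)// ler_wpM2l ?addr_ge0 ?exprn_ge0 ?addr_ge0//.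
by apply: ger_powR => //; lra.
Qed.

(** The order of choices matters: [b] and [c] depend on [alpha] only, [eps] on
    [c], and the length [h] of the intervals comes last, once the radius [M] is
    known. *)
Lemma flow_constants (T alpha : R) (beta : 4.-tuple R) (W : R -> V -> V)
    (WW : R -> R -> prod1 V V -> V) :
  0 < T -> 1 / 3 < alpha -> (forall k, 0 <= tnth beta k) ->
  nonlinear_rough_path T alpha beta W WW ->
  exists K b c eps : R,
  [/\ 1 <= K, 1 < b < 3 * alpha, 0 < eps <= 1 / 3,
    [/\ sewing_const (3 * alpha) c (2 * eps), sewing_const b c (2 * eps) &
      c * (20 * eps) <= 2^-1] &
    forall M h, 1 <= M -> 0 < h ->
      4 * K * ((6 * M) `^ growth beta * h `^ alpha) <= eps ->
      forall s0 s1, 0 <= s0 -> s1 <= T -> s1 - s0 <= h ->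
      almost_flow s0 s1 h alpha (3 * alpha) eps
        (K * ((6 * M) `^ beta`_0 * h `^ alpha))
        (weight_ball M) (weight_ball (2 * M)) (step W WW)].
Proof.
move=> T0 al bt0 RP; have [WC WWC ch] := RP.
have al0 : 0 < alpha by apply: lt_trans al; rewrite divr_gt0.
have [K K1 KP] := rough_bounds T0 al0 bt0 RP.
pose b := (1 + 3 * alpha) / 2.
have b1 : 1 < b by rewrite /b; lra.
have ba : b < 3 * alpha by rewrite /b; lra.
have [del0 del00 [c cP]] := sewing_const_ex b1.
have c1 : 1 <= c by have [] := cP 0 (introT andP (conj (lexx _) (ltW del00))).
have c0 : 0 < c by apply: lt_le_trans c1.
pose eps := Num.min (1 / 3) (Num.min (del0 / 2) (40 * c)^-1).
have eps0 : 0 < eps.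
  by rewrite !lt_min !divr_gt0//= invr_gt0 mulr_gt0.
have eps1 : eps <= 1 / 3 by rewrite ge_min lexx.
have eps2 : 2 * eps <= del0.
  by rewrite mulrC -ler_pdivlMr// !ge_min lexx orbT.
have eps3 : c * (20 * eps) <= 2^-1.
  have : eps <= (40 * c)^-1 by rewrite !ge_min lexx !orbT.
  rewrite -div1r ler_pdivlMr ?mulr_gt0//; lra.
have sb : sewing_const b c (2 * eps).
  by apply: cP; rewrite eps2 andbT mulr_ge0// ltW.
exists K, b, c, eps; split => //; first by rewrite b1.
- by rewrite eps0.
- by split => //; apply: sewing_const_mono sb; exact: ltW.
move=> M h M1 h0 epsh s0 s1 s00 s1T s01.
have N1 : 1 <= 6 * M by lra.
set q := K * _.
have b0G : (6 * M) `^ beta`_0 * h `^ alpha <= (6 * M) `^ growth beta * h `^ alpha.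
  rewrite ler_wpM2r ?powR_ge0// ler_powR//.
  by rewrite -(tnth_nth 0 beta (@Ordinal 4 0 isT)) beta_le_growth.
have qe : 4 * q <= eps.
  by rewrite (le_trans _ epsh)// /q mulrA ler_wpM2l// mulr_ge0// (le_trans ler01).
have q0 : 0 <= q by rewrite !mulr_ge0 ?powR_ge0// (le_trans ler01).
apply: (@step_almost_flow R V T alpha W WW s0 s1 h eps q M (6 * M) ch) => //.
- move=> r r' z rT r'T; have [Cr Cr'] := cn_incr WC rT r'T.
  exact: (differentiable_fderivB Cr' Cr (k := 0)).
- exact: chen_diag0 ch.
- by apply: KP => //.
- exact: ltW.
- lra.
- lra.
- lra.
Qed.

End Constants.

(** * Real powers *)


(** * Solutions in the sense of Davie *)

Section DavieDef.
Context {R : realType} {V : normedModType R}.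
Variables (alpha : R) (phi : R -> R -> V -> V).

(** A solution is described by its local expansion. Short intervals and an
    arbitrary constant suffice, which makes the notion easy to glue; the bound
    provides the balls on which the field is estimated. *)
Definition davie (l r : R) (Y : R -> V) : Prop :=
  (exists M, forall t, l <= t <= r -> 1 + `|Y t| <= M) /\
  exists C del, [/\ 0 <= C, 0 < del & forall s t, l <= s -> s <= t -> t <= r ->
    t - s <= del -> `|Y t - phi s t (Y s)| <= C * (t - s) `^ (3 * alpha)].

End DavieDef.

Section Davie.
Context {R : realType} {V : completeNormedModType R}.
Variables (T alpha : R) (phi : R -> R -> V -> V).
Implicit Types (Y Z : R -> V) (l r : R).
Local Notation davie := (davie alpha phi).

Variables (K b c eps g b0 : R).
Hypothesis alpha0 : 1 / 3 < alpha.
Hypothesis K1 : 1 <= K.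
Hypothesis b1 : 1 < b < 3 * alpha.
Hypothesis eps01 : 0 < eps <= 1 / 3.
Hypothesis ca : sewing_const (3 * alpha) c (2 * eps).
Hypothesis cb : sewing_const b c (2 * eps).
Hypothesis ceps : c * (20 * eps) <= 2^-1.
Hypothesis b00 : 0 <= b0.
Hypothesis b0g : b0 <= g.
Hypothesis gg : g / alpha - g + b0 <= 1.
Hypothesis AF : forall M h, 1 <= M -> 0 < h ->
  4 * K * ((6 * M) `^ g * h `^ alpha) <= eps ->
  forall s0 s1, 0 <= s0 -> s1 <= T -> s1 - s0 <= h ->
  almost_flow s0 s1 h alpha (3 * alpha) eps
    (K * ((6 * M) `^ b0 * h `^ alpha))
    (weight_ball M) (weight_ball (2 * M)) phi.

Let al0 : 0 < alpha. Proof. by apply: lt_trans alpha0; rewrite divr_gt0. Qed.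
Let a0 : 0 < 3 * alpha. Proof. by rewrite mulr_gt0. Qed.
Let K0 : 0 < K. Proof. exact: lt_le_trans K1. Qed.
Let eps0 : 0 < eps. Proof. by case/andP: eps01. Qed.
Let eK0 : 0 <= eps / (4 * K).
Proof. by rewrite divr_ge0 ?mulr_ge0// ltW. Qed.
Let epsle : 0 <= eps <= 1. Proof. by case/andP: eps01 => *; apply/andP; split; lra. Qed.

(** The length [h] with [4 * K * ((6 * M) ^ g * h ^ alpha) = eps], hence the
    largest one for which [AF] applies to the ball of weight [M]. *)
Definition time_step M : R := (eps / (4 * K) * (6 * M) `^ (- g)) `^ alpha^-1.

Lemma time_step_gt0 M : 0 < M -> 0 < time_step M.
Proof. by move=> M0; rewrite powR_gt0// !mulr_gt0 ?invr_gt0 ?powR_gt0 ?mulr_gt0. Qed.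

Lemma time_step_powR M : 0 < M ->
  time_step M `^ alpha = eps / (4 * K) * (6 * M) `^ (- g).
Proof.
move=> M0; rewrite -powRrM mulVf ?gt_eqF// powRr1//.
by rewrite mulr_ge0 ?powR_ge0.
Qed.

Lemma time_step_admissible M h : 0 < M -> 0 < h -> h <= time_step M ->
  4 * K * ((6 * M) `^ g * h `^ alpha) <= eps.
Proof.
move=> M0 h0 hM.
have N0 : 0 < (6 * M) `^ g by rewrite powR_gt0 ?mulr_gt0.
have : h `^ alpha <= time_step M `^ alpha.
  by apply: ge0_ler_powR; rewrite ?nnegrE ?powR_ge0 ?(ltW h0) ?(ltW al0).
rewrite time_step_powR// powRN => hle.
apply: (@le_trans _ _ (4 * K * ((6 * M) `^ g * (eps / (4 * K) / (6 * M) `^ g)))).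
  by rewrite ler_wpM2l ?mulr_ge0 ?(ltW K0)// ler_wpM2l ?(ltW N0).
rewrite le_eqVlt; apply/orP; left; apply/eqP; field.
by rewrite !gt_eqF.
Qed.

Lemma time_step_anti M M' : 0 < M -> M <= M' -> time_step M' <= time_step M.
Proof.
move=> M0 MM'; have M'0 := lt_le_trans M0 MM'.
apply: ge0_ler_powR; rewrite ?nnegrE ?invr_ge0 ?(ltW al0)//.
- by rewrite mulr_ge0 ?powR_ge0.
- by rewrite mulr_ge0 ?powR_ge0.
rewrite ler_wpM2l// !powRN.
rewrite lef_pV2 ?posrE ?powR_gt0 ?mulr_gt0//.
apply: ge0_ler_powR; rewrite ?nnegrE ?mulr_ge0 ?(ltW M0) ?(ltW M'0)//.
  exact: le_trans b0g.
by rewrite ler_wpM2l.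
Qed.

(** What remains of [K * (6 * M) ^ b0 * h ^ alpha / (M * h)], for
    [h = time_step M], when the powers of [6 * M] are collected and bounded by
    [6 * M] itself. *)
Definition growth_rate : R := K * (eps / (4 * K)) `^ (1 - alpha^-1) * 6.

(** The growth condition makes the increment over a maximal time step
    [h = time_step M] at most a multiple of [M * h]: indeed [h ^ alpha] is [h]
    times [h ^ (alpha - 1)], which is a power of [M] with exponent
    [g / alpha - g]. *)
Lemma time_step_growth M : 1 <= M ->
  K * ((6 * M) `^ b0 * time_step M `^ alpha) <= growth_rate * M * time_step M.
Proof.
move=> M1; have M0 : 0 < M by apply: lt_le_trans M1.
have N0 : 0 < 6 * M by rewrite mulr_gt0.
have N1 : 1 <= 6 * M by lra.
set u := eps / (4 * K) * (6 * M) `^ (- g).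
have u0 : 0 < u by rewrite !mulr_gt0 ?invr_gt0 ?powR_gt0 ?mulr_gt0.
have -> : time_step M `^ alpha = u `^ (1 - alpha^-1) * time_step M.
  rewrite time_step_powR// -/u /time_step -/u -powRD ?subrK ?powRr1 ?(ltW u0)//.
  by rewrite oner_eq0.
rewrite /growth_rate /u powRM ?powR_ge0//.
set e := (eps / (4 * K)) `^ _.
have E : (6 * M) `^ b0 * (6 * M) `^ (- g) `^ (1 - alpha^-1) <= 6 * M.
  rewrite -powRrM -powRD; last by rewrite (gt_eqF N0) implybT.
  rewrite -[leRHS]powRr1 ?(ltW N0)// ler_powR//.
  by apply: le_trans gg; rewrite le_eqVlt; apply/orP; left; apply/eqP; ring.
have e0 : 0 <= e by exact: powR_ge0.
have h0 := ltW (time_step_gt0 M0).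
rewrite (_ : K * _ = K * e * time_step M *
  ((6 * M) `^ b0 * (6 * M) `^ (- g) `^ (1 - alpha^-1))); last by ring.
rewrite (_ : K * e * 6 * M * _ = K * e * time_step M * (6 * M)); last by ring.
by rewrite ler_wpM2l// !mulr_ge0// ltW.
Qed.

(** The weight of the ball is twice that of [xi], which leaves room for a path
    that moves by at most [1]. *)
Lemma local_solution s0 s1 xi (h := time_step (2 * (1 + `|xi|))) :
  0 <= s0 -> s0 <= s1 -> s1 <= T -> s1 - s0 <= h ->
  exists Y, [/\ Y s0 = xi, davie s0 s1 Y &
    forall t, s0 <= t <= s1 ->
      `|Y t - xi| <= 3 * (growth_rate * (2 * (1 + `|xi|)) * h)].
Proof.
move=> s00 s01 s1T sh; set M := 2 * (1 + `|xi|) in h sh *.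
have xi1 : 1 <= 1 + `|xi| by rewrite lerDl.
have M1 : 1 <= M by rewrite /M; lra.
have M0 : 0 < M by apply: lt_le_trans M1.
have h0 : 0 < h by exact: time_step_gt0.
have hP := time_step_admissible M0 h0 (lexx _).
have := AF M1 h0 hP s00 s1T sh; have := time_step_growth M1.
rewrite -/h; set q := K * (_ * _) => qg af.
have q0 : 0 <= q by rewrite !mulr_ge0 ?powR_ge0 ?(ltW K0).
have qe : 4 * q <= eps.
  rewrite (le_trans _ hP)// /q mulrA ler_wpM2l ?mulr_ge0 ?(ltW K0)//.
  by rewrite ler_wpM2r ?powR_ge0// ler_powR//; lra.
have q1 : 3 * q <= 1 by have /andP[_ ?] := epsle; lra.
have ball1 x : `|x - xi| <= 1 -> weight_ball M x.
  rewrite /weight_ball /= => xx; have := ler_normD (x - xi) xi.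
  by rewrite subrK /M; lra.
have [b1' ba] := andP b1.
have [Y [Y0 Yn Yd]] := almost_flow_path af epsle q0 b1' ba (ltW al0) ca cb ceps
  s01 q1 ball1.
exists Y; split => //.
- split.
    by exists M => t /Yn tn; apply: ball1; apply: le_trans q1.
  exists (q * (h^-1) `^ (3 * alpha)), 1; split => //.
    by rewrite mulr_ge0 ?powR_ge0.
  move=> s t ss st ts _; rewrite (le_trans (Yd s t ss st ts))//.
  rewrite -[leRHS]mulrA ler_wpM2l// -powRM ?invr_ge0 ?(ltW h0) ?subr_ge0//.
  by rewrite [h^-1 * _]mulrC.
- by move=> t /Yn tn; rewrite (le_trans tn)// ler_wpM2l.
Qed.

(** Across [m] the two expansions are chained through [phi s m (Y s)], at the
    price of a Lipschitz constant and a defect. *)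
Lemma davie_glue l m r Y Z : 0 <= l -> l <= m -> m <= r -> r <= T ->
  davie l m Y -> davie m r Z -> Y m = Z m ->
  davie l r (fun t => if t <= m then Y t else Z t).
Proof.
move=> l0 lm mr rT [[MY YM] [CY [dY [CY0 dY0 YC]]]]
  [[MZ ZM] [CZ [dZ [CZ0 dZ0 ZC]]]] YZ.
pose M := Num.max 1 MY.
have M1 : 1 <= M by rewrite le_max lexx.
have M0 : 0 < M by apply: lt_le_trans M1.
split.
  exists (Num.max MY MZ) => t /andP[lt tr]; rewrite le_max.
  have [tm|mt] := leP t m; first by rewrite YM// lt.
  by rewrite (ZM t) ?orbT// (ltW mt).
have h0 := time_step_gt0 M0; set h := time_step M in h0.
have hP := time_step_admissible M0 h0 (lexx _).
set q := K * ((6 * M) `^ b0 * h `^ alpha).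
have q0 : 0 <= q by rewrite !mulr_ge0 ?powR_ge0 ?(ltW K0).
pose CD := 7 * eps * q * (h^-1) `^ (3 * alpha).
have CD0 : 0 <= CD by rewrite mulr_ge0 ?powR_ge0// mulr_ge0// mulr_ge0// ltW.
exists (CZ + 3 * CY + CD), (Num.min h (Num.min dY dZ)); split.
- by rewrite !addr_ge0// mulr_ge0.
- by rewrite !lt_min h0 dY0.
move=> s t ls st tr; rewrite !le_min => /and3P[th tY tZ].
have p0 : 0 <= (t - s) `^ (3 * alpha) by exact: powR_ge0.
have [tm|mt] := leP t m.
  rewrite (le_trans st tm) (le_trans (YC s t ls st tm tY))// ler_wpM2r//.
  by lra.
have [sm|ms] := leP s m; last first.
  rewrite (le_trans (ZC s t (ltW ms) st tr tZ))// ler_wpM2r//.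
  by lra.
have mt' := ltW mt.
have ple u v : s <= u -> u <= v -> v <= t ->
    (v - u) `^ (3 * alpha) <= (t - s) `^ (3 * alpha).
  by move=> su uv vt; apply: ge0_ler_powR;
    rewrite ?nnegrE ?subr_ge0 ?(ltW a0)// lerB.
have af := AF M1 h0 hP (le_trans l0 ls) (le_trans tr rT) th.
have ballY u : l <= u <= m -> weight_ball M (Y u).
  by move=> /YM um; rewrite /weight_ball /= le_max um orbT.
have Bs : weight_ball M (Y s) by apply: ballY; rewrite ls.
have Bm : weight_ball M (Y m) by apply: ballY; rewrite lm lexx.
have t1 : `|Z t - phi m t (Y m)| <= CZ * (t - s) `^ (3 * alpha).
  rewrite YZ (le_trans (ZC m t (lexx _) mt' tr _))//.
    by rewrite (le_trans _ tZ)// lerB.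
  by rewrite ler_wpM2l// ple.
have t2 : `|phi m t (Y m) - phi m t (phi s m (Y s))| <=
    3 * CY * (t - s) `^ (3 * alpha).
  rewrite (le_trans (af_lip af sm mt' (lexx _) (af_sub af Bm)
    (af_maps af (lexx _) sm mt' Bs)))//.
  rewrite -mulrA ler_pM ?addr_ge0 ?mulr_ge0 ?(ltW eps0)//.
    by have /andP[_ ?] := epsle; lra.
  rewrite (le_trans (YC s m ls sm (lexx _) _))//.
    by rewrite (le_trans _ tY)// lerB.
  by rewrite ler_wpM2l// ple.
have t3 : `|phi m t (phi s m (Y s)) - phi s t (Y s)| <=
    CD * (t - s) `^ (3 * alpha).
  rewrite (le_trans (af_defect af (lexx _) sm mt' (lexx _) Bs))//.
  rewrite (powR_scaled _ h0 st) /CD.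
  have hV : h^-1 `^ (3 * alpha) * h `^ (3 * alpha) = 1.
    by rewrite -powRM ?invr_ge0 ?(ltW h0)// mulVf ?gt_eqF// powR1.
  by rewrite [leRHS]mulrA -[X in _ <= X * _]mulrA hV mulr1.
have -> : Z t - phi s t (Y s) = (Z t - phi m t (Y m)) +
  (phi m t (Y m) - phi m t (phi s m (Y s))) +
  (phi m t (phi s m (Y s)) - phi s t (Y s)) by zmod.
have h1 := le_trans (ler_normD _ _) (lerD t1 t2).
by rewrite (le_trans (le_trans (ler_normD _ _) (lerD h1 t3)))// -!mulrDl.
Qed.

(** On partitions of vanishing mesh, the errors of single steps of both paths
    disappear in comparison with [scaled ^ b], whatever their constants are.
    Only the expansion of [Y] needs a constant [1], which holds on intervals
    that are short enough. *)
Lemma davie_unique l r Y Z : 0 <= l -> r <= T -> davie l r Y -> davie l r Z ->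
  Y l = Z l -> forall t, l <= t <= r -> Y t = Z t.
Proof.
move=> l0 rT [[MY YM] [CY [dY [CY0 dY0 YC]]]]
  [[MZ ZM] [CZ [dZ [CZ0 dZ0 ZC]]]] YZ.
pose M := Num.max 1 (Num.max MY MZ).
have M1 : 1 <= M by rewrite le_max lexx.
have M0 : 0 < M by apply: lt_le_trans M1.
have [b1' ba] := andP b1.
have [h1 h10 h1P] := @powR_small R CY (3 * alpha) 1 CY0 a0 ltr01.
pose h := Num.min h1 (Num.min (time_step M) (Num.min dY dZ)).
have h0 : 0 < h by rewrite !lt_min h10 time_step_gt0// dY0.
have hh1 : h <= h1 by rewrite ge_min lexx.
have hts : h <= time_step M by rewrite !ge_min lexx orbT.
have hdY : h <= dY by rewrite !ge_min lexx !orbT.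
have hdZ : h <= dZ by rewrite !ge_min lexx !orbT.
have hP := time_step_admissible M0 h0 hts.
have CYh : CY * h `^ (3 * alpha) <= 1.
  rewrite (le_trans _ h1P)// ler_wpM2l// ge0_ler_powR// ?nnegrE ?(ltW h10)//.
  - exact: ltW.
  - exact: ltW.
set q := K * ((6 * M) `^ b0 * h `^ alpha).
have q0 : 0 <= q by rewrite !mulr_ge0 ?powR_ge0 ?(ltW K0).
have c0 : 0 <= c by case: ca => _ /(le_trans ler01).
have short s t : l <= s -> s <= t -> t <= r -> t - s <= h -> Y s = Z s -> Y t = Z t.
  move=> ls st tr ts YZs; apply/eqP; rewrite -subr_eq0 -normr_le0.
  apply/ler_addgt0Pr => e e0; rewrite add0r.
  pose C := (CY + CZ) * h `^ (3 * alpha).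
  have C0 : 0 <= C by rewrite mulr_ge0 ?addr_ge0 ?powR_ge0.
  have ab0 : 0 < 3 * alpha - b by rewrite subr_gt0.
  have [|mu mu0 muP] := @powR_small R (2 * (c * C)) (3 * alpha - b) e _ ab0 e0.
    by rewrite mulr_ge0// mulr_ge0.
  have [p [[sp /eqP lp] pm]] := partition_ex st (mulr_gt0 mu0 h0).
  have af := AF M1 h0 hP (le_trans l0 ls) (le_trans tr rT) ts.
  have lpt : last s p <= t by rewrite lp.
  have tg := path_time_grid st sp lpt.
  set tau := nth s (s :: p) in tg.
  have tauP k : (k <= size p)%N -> l <= tau k <= r.
    move=> kp; have [k1 _ k2] := time_gridP tg (introT andP (conj (leqnn k) kp)).
    by rewrite (le_trans ls k1) (le_trans k2 tr).
  have ballY k : (k <= size p)%N -> weight_ball M (Y (tau k)).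
    by move=> /tauP /YM um; rewrite /weight_ball /= !le_max um orbT.
  have ballZ k : (k <= size p)%N -> weight_ball M (Z (tau k)).
    by move=> /tauP /ZM um; rewrite /weight_ball /= !le_max um !orbT.
  have tauh i j : (i <= j <= size p)%N -> tau j - tau i <= h.
    move=> ij; have [i1 i2 i3] := time_gridP tg ij.
    by rewrite (le_trans _ ts)// lerB.
  have stab := stability af epsle b1' (ltW ba) ca cb ceps tg ballY ballZ
    (eta := C * mu `^ (3 * alpha - b)) (D := 0).
  have := stab _ _ _ _ (size p) (leqnn _).
  rewrite (_ : tau (size p) = t); last first.
    by rewrite -[RHS]lp [LHS](nth_last s (s :: p)).
  rewrite mulr0 add0r => H; apply: le_trans (H _ _ _ _) _.
  - by rewrite mulr_ge0 ?powR_ge0.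
  - move=> i j ij; have [i1 i2 i3] := time_gridP tg ij.
    have /andP[li _] := tauP i (leq_trans (andP ij).1 (andP ij).2).
    have /andP[_ jr] := tauP j (andP ij).2.
    rewrite (le_trans (YC _ _ li i2 jr (le_trans (tauh _ _ ij) hdY)))//.
    rewrite (powR_scaled _ h0 i2) mulrA -[leRHS]mul1r ler_wpM2r ?powR_ge0//.
  - move=> k kp; have ij : (k <= k.+1 <= size p)%N by rewrite leqnSn.
    have [i1 i2 i3] := time_gridP tg ij.
    have /andP[li _] := tauP k (ltnW kp).
    have /andP[_ jr] := tauP k.+1 kp.
    have yk := YC _ _ li i2 jr (le_trans (tauh _ _ ij) hdY).
    have zk := ZC _ _ li i2 jr (le_trans (tauh _ _ ij) hdZ).
    set y1 := phi _ _ (Y _) in yk *; set z1 := phi _ _ (Z _) in zk *.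
    have -> : Y (tau k.+1) - Z (tau k.+1) - (y1 - z1) =
      Y (tau k.+1) - y1 - (Z (tau k.+1) - z1) by zmod.
    rewrite (le_trans (ler_normB _ _))// (le_trans (lerD yk zk))// -mulrDl.
    rewrite (powR_scaled _ h0 i2) [leLHS]mulrA -/C -[leRHS]mulrA ler_wpM2l//.
    apply: powR_split => //; last exact: ltW.
      by rewrite divr_ge0 ?subr_ge0// ltW.
    rewrite ler_pdivrMr//; apply: ltW.
    by apply: ((mesh_ltP _ _ _).1 pm k kp); rewrite mulr_gt0.
  - by rewrite /tau /= YZs subrr normr0.
  - by rewrite mulrA mulrA -[2 * c * C]mulrA.
have iter n t : l <= t <= r -> t <= l + n%:R * h -> Y t = Z t.
  elim: n t => [|n IH] t /andP[lt tr] tn.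
    by rewrite (_ : t = l)//; apply/le_anti; rewrite lt andbT; move: tn; lra.
  have [tn'|tn'] := leP t (l + n%:R * h); first by apply: IH => //; rewrite lt.
  have nh : 0 <= n%:R * h by rewrite mulr_ge0 ?ler0n ?(ltW h0).
  apply: (short (l + n%:R * h)) => //.
  - by rewrite lerDl.
  - exact: ltW.
  - by move: tn; rewrite -natr1 mulrDl mul1r; lra.
  - apply: IH => //; rewrite lerDl nh/=.
    by rewrite (le_trans (ltW tn')).
move=> t /andP[lt tr]; apply: (iter (Num.bound ((t - l) / h))); first by rewrite lt.
rewrite -lerBlDl -ler_pdivrMr//; apply/ltW/archi_boundP.
by rewrite divr_ge0 ?subr_ge0 ?(ltW h0).
Qed.

(** Each local solution runs for a time [h] and multiplies the weight by at most
    [1 + kap * h <= expR (kap * h)]. Up to time [T] all weights remain below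
    [rmax], all time steps above [hm], and finitely many steps suffice. *)
Lemma global_solution xi : 0 < T -> exists2 Y, Y 0 = xi & davie 0 T Y.
Proof.
move=> T0.
pose rho x : R := 1 + `|x : V|.
have rho1 x : 1 <= rho x by rewrite lerDl.
pose kap := 6 * growth_rate.
have kap0 : 0 <= kap by rewrite !mulr_ge0 ?powR_ge0 ?(ltW K0).
pose rmax := rho xi * expR (kap * T).
have rmax0 : 0 < rmax by rewrite mulr_gt0 ?expR_gt0// (lt_le_trans ltr01).
pose hm := time_step (2 * rmax).
have hm0 : 0 < hm by rewrite time_step_gt0// mulr_gt0.
suff H n : exists tn Y, [/\ 0 <= tn <= T, davie 0 tn Y, Y 0 = xi &
    tn = T \/ (n%:R * hm <= tn /\ rho (Y tn) <= rho xi * expR (kap * tn))].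
  have [tn [Y [/andP[tn0 tnT] dY Y0 [<-|[ntn _]]]]] := H (Num.bound (T / hm)).
    by exists Y.
  have := archi_boundP (divr_ge0 (ltW T0) (ltW hm0)).
  rewrite ltr_pdivrMr// => /lt_le_trans /(_ (le_trans ntn tnT)).
  by rewrite ltxx.
elim: n => [|n [tn [Y [/andP[tn0 tnT] dY Y0 [tnE|[ntn rY]]]]]].
- exists 0, (fun=> xi); split => //; first by rewrite lexx ltW.
    split; first by exists (1 + `|xi|).
    exists 0, 1; split => // s t s0 st t0 _.
    have -> : s = 0 by apply/le_anti; rewrite s0 (le_trans st t0).
    have t0E : t = 0 by apply/le_anti; rewrite t0 (le_trans s0 st).
    rewrite t0E.
    have ts1 := time_step_gt0 ltr01.
    have hP := time_step_admissible ltr01 ts1 (lexx _).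
    have h00 : 0 - 0 <= time_step 1 by rewrite subrr; exact: ltW.
    have af := AF (lexx 1) ts1 hP (lexx 0) (ltW T0) h00.
    rewrite (af_id af xi (lexx 0) (lexx 0)) subrr normr0 mul0r.
    exact: lexx.
  by right; rewrite mul0r mulr0 expR0 mulr1.
- by exists tn, Y; split => //; [rewrite tn0|left].
pose x := Y tn; pose h := time_step (2 * rho x).
have rx0 : 0 < 2 * rho x by rewrite mulr_gt0// (lt_le_trans ltr01).
have h0 : 0 < h by exact: time_step_gt0.
have hmh : hm <= h.
  apply: time_step_anti => //; rewrite ler_wpM2l// (le_trans rY)//.
  rewrite ler_wpM2l ?(le_trans ler01)// ler_expR ler_wpM2l//.
pose t' := Num.min T (tn + h).
have tt' : tn <= t' by rewrite le_min tnT lerDl ltW.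
have t'T : t' <= T by rewrite ge_min lexx.
have t'h : t' - tn <= h by rewrite lerBlDl ge_min lexx orbT.
have [Z [Z0 dZ Zn]] := local_solution tn0 tt' t'T t'h.
have Yx : Y tn = Z tn by rewrite Z0.
have t'0 : 0 <= t' by exact: le_trans tt'.
exists t', (fun t => if t <= tn then Y t else Z t); split.
- by rewrite t'0.
- exact: davie_glue.
- by rewrite tn0.
have [th|th] := leP T (tn + h).
  by left; rewrite /t'; apply/min_idPl.
have t'E : t' = tn + h by rewrite /t'; apply/min_idPr/ltW.
right; split.
  by rewrite -natr1 mulrDl mul1r t'E lerD.
have -> : (if t' <= tn then Y t' else Z t') = Z t'.
  case: ifPn => // t't; rewrite (_ : t' = tn) ?Yx//.
  by apply/le_anti; rewrite t't tt'.
have := Zn t' (introT andP (conj tt' (lexx _))); rewrite -/(rho x) -/h => Zx.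
have {}Zx : `|Z t' - x| <= kap * h * rho x.
  by rewrite (le_trans Zx)// le_eqVlt; apply/orP; left; apply/eqP; rewrite /kap; ring.
apply: (@le_trans _ _ (rho x * (1 + kap * h))).
  rewrite /rho; have := ler_normD (Z t' - x) x; rewrite subrK.
  by move: Zx; rewrite /rho; lra.
have kh0 : 0 <= kap * h := mulr_ge0 kap0 (ltW h0).
rewrite t'E [kap * (tn + h)]mulrDr expRD [leRHS]mulrA.
have rx1 : 0 <= rho x := le_trans ler01 (rho1 x).
have E1 : 1 + kap * h <= expR (kap * h) by exact: expR_ge1Dx.
apply: ler_pM rx1 _ rY E1.
by rewrite addr_ge0.
Qed.

End Davie.

(** * Riemann sums and rough integrals *)

Section RiemannSums.
Context {R : realType} {V : normedModType R}.
Implicit Types (W : R -> V -> V) (WW : R -> R -> prod1 V V -> V) (Y : R -> V).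

Lemma mesh_cons_lt s x (p : seq R) d :
  0 < d -> mesh s (x :: p) < d <-> (x - s < d /\ mesh x p < d).
Proof.
move=> d0; split.
  move=> /(mesh_ltP _ _ d0) H; split; first exact: (H 0%N).
  apply/mesh_ltP => // k kp; have := H k.+1 kp.
  by rewrite /= ![nth x _ _](set_nth_default s)//= ltnW.
move=> [xs /(mesh_ltP _ _ d0) H]; apply/mesh_ltP => // -[//|k] kp /=.
have := H k kp.
by rewrite /= ![nth x _ _](set_nth_default s)//= ltnW.
Qed.

Lemma mesh_cat_lt s (p p' : seq R) d : 0 < d ->
  mesh s p < d -> mesh (last s p) p' < d -> mesh s (p ++ p') < d.
Proof.
move=> d0; elim: p s => //= x p IH s /(mesh_cons_lt _ _ _ d0)[xs xp] pp'.
apply: (mesh_cons_lt s x (p ++ p') d0).2; split => //; exact: (IH _ xp pp').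
Qed.

Lemma rough_sum_cons W WW Y Yd s x p :
  rough_sum W WW Y Yd s (x :: p) =
  incr W s x (Y s) + WW s x (Yd s, Y s) + rough_sum W WW Y Yd x p.
Proof.
rewrite /rough_sum big_ord_recl /=; congr (_ + _); apply: eq_bigr => i _ /=.
have ip := ltn_ord i.
by rewrite ![nth x _ _](set_nth_default s)//= ltnW.
Qed.

Lemma rough_sum_cat W WW Y Yd s p p' :
  rough_sum W WW Y Yd s (p ++ p') =
  rough_sum W WW Y Yd s p + rough_sum W WW Y Yd (last s p) p'.
Proof.
elim: p s => [|x p IH] s; first by rewrite /= {2}/rough_sum big_ord0 add0r.
by rewrite /= !rough_sum_cons IH addrA.
Qed.

Lemma mesh_to0_proper (s t : R) : s <= t -> ProperFilter (mesh_to0 s t).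
Proof.
move=> st; apply: filter_from_proper; last first.
  by move=> d /= d0; have [p pP] := partition_ex st d0; exists p.
apply: filter_from_filter; first by exists 1 => /=.
move=> d d' /= d0 d'0; exists (Num.min d d') => /=; first by rewrite lt_min d0.
by move=> p /= [pst]; rewrite lt_min => /andP[pd pd'].
Qed.

Lemma rough_sum_diag W WW Y s p : rough_sum W WW Y Y s p =
  \sum_(i < size p) (step W WW (nth s (s :: p) i) (nth s (s :: p) i.+1)
    (Y (nth s (s :: p) i)) - Y (nth s (s :: p) i)).
Proof. by apply: eq_bigr => i _; rewrite /step [_ + (_ + _)]addrC addrK. Qed.

End RiemannSums.

Section HoelderNorms.
Context {R : realType} {V : normedModType R}.

Lemma in_C2_intro (T gamma C : R) (A : R -> R -> V) :
  (forall s t, s \in `[0, T] -> t \in `[0, T] -> s != t ->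
    `|A s t| <= C * `|t - s| `^ gamma) -> in_C2 T gamma A.
Proof.
move=> AC; rewrite /in_C2 /holder2_norm; apply: (@le_lt_trans _ _ C%:E).
  apply: ub_ereal_sup => _ [s [t [sT tT st ->]]]; rewrite lee_fin.
  rewrite ler_pdivrMr ?AC// powR_gt0// normr_gt0 subr_eq0.
  by rewrite eq_sym.
by rewrite ltry.
Qed.

Lemma in_C2_bound (T gamma : R) (A : R -> R -> V) : 0 < T -> in_C2 T gamma A ->
  exists2 C : R, 0 <= C & forall s t, s \in `[0, T] -> t \in `[0, T] -> s != t ->
    `|A s t| <= C * `|t - s| `^ gamma.
Proof.
move=> T0 AC.
pose S (k : 'I_1) : set (\bar R) := [set r | exists s t,
    [/\ s \in `[0, T], t \in `[0, T], s != t
      & r = (`|A s t| / `|t - s| `^ gamma)%:E]].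
have [||C C1 CP] := @bounded_of_sup_sum R 1 S.
- move=> k; eexists; first by exists 0, T; split; last reflexivity;
    rewrite ?in_itv/= ?lexx ?ltW// eq_sym gt_eqF.
  by rewrite lee_fin divr_ge0// powR_ge0.
- by rewrite big_ord1.
exists C => [|s t sT tT st]; first by apply: le_trans C1.
rewrite -ler_pdivrMr; first by apply: (CP ord0); exists s, t.
by rewrite powR_gt0// normr_gt0 subr_eq0 eq_sym.
Qed.

End HoelderNorms.

(** * Equivalence of the two notions of solution *)

Section Solutions.
Context {R : realType} {V : normedModType R}.
Variables (T alpha : R) (beta : 4.-tuple R) (W : R -> V -> V)
  (WW : R -> R -> prod1 V V -> V).
Hypothesis T0 : 0 < T.
Hypothesis al3 : 1 / 3 < alpha.
Hypothesis bt0 : forall k, 0 <= tnth beta k.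
Hypothesis RP : nonlinear_rough_path T alpha beta W WW.

Let al0 : 0 < alpha. Proof. by apply: lt_trans al3; rewrite divr_gt0. Qed.

Notation D1 s t := (fderiv (incr W s t) 1 : V -> clin V V).
Notation phi := (step W WW).

Lemma uniform_bounds N : 1 <= N -> exists2 C : R, 0 <= C &
  forall s t, 0 <= s -> s <= t -> t <= T ->
    vf_bounds (weight_ball N) (C * (t - s) `^ alpha) (C * (t - s) `^ alpha)
      (incr W s t) (fun x => WW s t (x, x)) (D1 s t).
Proof.
move=> N1; have [K K1 KP] := rough_bounds T0 al0 bt0 RP.
have K0 : 0 <= K by rewrite (le_trans ler01).
exists (4 * K * (N `^ growth beta * 1 `^ alpha)).
  by rewrite !mulr_ge0 ?powR_ge0.
move=> s t s0 st tT.
have := @KP N 1 _ _ N1 ltr01 (lexx _) _ s t s0 st tT.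
rewrite /scaled divr1; apply.
have b0G : N `^ beta`_0 <= N `^ growth beta.
  by rewrite ler_powR// -(tnth_nth 0 beta (@Ordinal 4 0 isT)) beta_le_growth.
have p1 : 0 <= (1 : R) `^ alpha by exact: powR_ge0.
have p2 : 0 <= N `^ growth beta by exact: powR_ge0.
rewrite ler_pM ?mulr_ge0 ?powR_ge0//; last by rewrite ler_wpM2r.
by lra.
Qed.

Lemma powR_le_time s t : 0 <= s -> s <= t -> t <= T ->
  (t - s) `^ alpha <= T `^ alpha.
Proof.
move=> s0 st tT; apply: ge0_ler_powR; rewrite ?nnegrE ?subr_ge0 ?(ltW al0) ?(ltW T0)//.
by lra.
Qed.

Lemma powR2 x : x `^ (2 * alpha) = (x `^ alpha) ^+ 2.
Proof. by rewrite mulrC powRrM powR_mulrn// powR_ge0. Qed.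

Lemma powR3 x : x `^ (3 * alpha) = (x `^ alpha) ^+ 3.
Proof. by rewrite mulrC powRrM powR_mulrn// powR_ge0. Qed.

Lemma in_T t : 0 <= t -> t <= T -> t \in `[0, T].
Proof. by move=> t0 tT; rewrite in_itv/= t0. Qed.

Lemma symmetric_bound (f : R -> R -> R) (g C : R) :
  (forall s t, f s t = f t s) ->
  (forall s t, 0 <= s -> s <= t -> t <= T -> f s t <= C * (t - s) `^ g) ->
  forall s t, s \in `[0, T] -> t \in `[0, T] -> f s t <= C * `|t - s| `^ g.
Proof.
move=> fC H s t; rewrite !in_itv/= => /andP[s0 sT] /andP[t0 tT].
have [st|ts] := leP s t; first by rewrite ger0_norm ?subr_ge0// H.
have ts' := ltW ts; rewrite fC distrC ger0_norm ?subr_ge0//.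
exact: H.
Qed.

(** For [t - s > del] the power [(t - s) ^ (3 * alpha)] is bounded below and
    boundedness of all terms is enough. *)
Lemma davie_global Y : davie alpha phi 0 T Y ->
  exists2 C, 0 <= C & forall s t, 0 <= s -> s <= t -> t <= T ->
    `|Y t - phi s t (Y s)| <= C * (t - s) `^ (3 * alpha).
Proof.
move=> [[M0 YM] [C [del [C0 del0 YC]]]].
pose M := Num.max 1 M0; have M1 : 1 <= M by rewrite le_max lexx.
have YN t : 0 <= t -> t <= T -> weight_ball M (Y t).
  by move=> t0 tT; rewrite /weight_ball /= le_max YM ?orbT// t0.
have [c c0 cP] := uniform_bounds M1.
have M00 : 0 <= M by apply: le_trans M1.
pose Th := T `^ alpha; have Th0 : 0 <= Th by exact: powR_ge0.
pose B := 2 * M + c * Th + (c * Th) ^+ 2.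
have B0 : 0 <= B.
  by rewrite /B !addr_ge0 ?exprn_ge0 ?mulr_ge0.
have d0 : 0 < del `^ (3 * alpha) by rewrite powR_gt0.
exists (C + B / del `^ (3 * alpha)).
  by rewrite addr_ge0// divr_ge0// ltW.
move=> s t s0 st tT.
have p0 : 0 <= (t - s) `^ (3 * alpha) by exact: powR_ge0.
have [tsd|dts] := leP (t - s) del.
  rewrite (le_trans (YC s t s0 st tT tsd))// ler_wpM2r// lerDl divr_ge0//.
  exact: ltW.
have Ys := YN s s0 (le_trans st tT); have Yt := YN t (le_trans s0 st) tT.
have bF := vf_F (cP s t s0 st tT) Ys; have bP := vf_P (cP s t s0 st tT) Ys.
have H0 : 0 <= (t - s) `^ alpha by exact: powR_ge0.
have HT := powR_le_time s0 st tT.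
have cH : c * (t - s) `^ alpha <= c * Th by rewrite ler_wpM2l.
have cH0 : 0 <= c * (t - s) `^ alpha by rewrite mulr_ge0.
have cH2 : c * (t - s) `^ alpha * (c * (t - s) `^ alpha) <= (c * Th) ^+ 2.
  by rewrite expr2 ler_pM.
apply: (@le_trans _ _ B).
  have -> : Y t - phi s t (Y s) = Y t - Y s - incr W s t (Y s) - WW s t (Y s, Y s).
    by rewrite /step; zmod.
  have h1 := le_trans (ler_normB (Y t) (Y s)) (lerD (lexx `|Y t|) (lexx `|Y s|)).
  have h2 := le_trans (ler_normB _ _) (lerD h1 bF).
  have h3 := le_trans (ler_normB _ _) (lerD h2 bP).
  apply: (le_trans h3); move: Ys Yt; rewrite /weight_ball /= /B => Ys Yt.
  by lra.
rewrite mulrDl (le_trans _ (ler_wpDl (mulr_ge0 C0 p0) (lexx _)))//.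
rewrite -mulrA ler_peMr// mulrC ler_pdivlMr// mul1r.
apply: ge0_ler_powR;
  by rewrite ?nnegrE ?mulr_ge0 ?(ltW al0) ?(ltW del0) ?subr_ge0 ?(ltW dts).
Qed.


Lemma davie_increments Y : davie alpha phi 0 T Y ->
  in_C T alpha Y /\ controlled T alpha W Y Y.
Proof.
move=> dY; have [C C0 YC] := davie_global dY; have [[M0 YM] _] := dY.
pose M := Num.max 1 M0; have M1 : 1 <= M by rewrite le_max lexx.
have YN t : 0 <= t -> t <= T -> weight_ball M (Y t).
  by move=> t0 tT; rewrite /weight_ball /= le_max YM ?orbT// t0.
have [c c0 cP] := uniform_bounds M1.
pose Th := T `^ alpha; have Th0 : 0 <= Th by exact: powR_ge0.
pose CY := C * Th ^+ 2 + c + c ^+ 2 * Th.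
pose CR := C * Th + c ^+ 2.
have YH s t : 0 <= s -> s <= t -> t <= T -> `|Y t - Y s| <= CY * (t - s) `^ alpha.
  move=> s0 st tT; have Ys := YN s s0 (le_trans st tT).
  have := YC s t s0 st tT; rewrite powR3 => h1.
  have h2 := vf_F (cP s t s0 st tT) Ys; have h3 := vf_P (cP s t s0 st tT) Ys.
  have HT := powR_le_time s0 st tT.
  have H0 : 0 <= (t - s) `^ alpha by exact: powR_ge0.
  have -> : Y t - Y s = (Y t - phi s t (Y s)) + incr W s t (Y s) + WW s t (Y s, Y s).
    by rewrite /step; zmod.
  have h4 := le_trans (ler_normD _ _) (lerD (le_trans (ler_normD _ _) (lerD h1 h2)) h3).
  apply: (le_trans h4); rewrite /CY; move: HT H0; rewrite -/Th.
  set H := (t - s) `^ alpha => HT H0.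
  have HT2 : H ^+ 2 <= Th ^+ 2 by rewrite ler_pXn2r.
  have e1 : C * H ^+ 3 <= C * Th ^+ 2 * H.
    by rewrite exprSr mulrA ler_wpM2r// ler_wpM2l.
  have e2 : c * H * (c * H) <= c ^+ 2 * Th * H.
    have -> : c * H * (c * H) = c ^+ 2 * H * H by ring.
    by rewrite ler_wpM2r// ler_wpM2l// exprn_ge0.
  by rewrite !mulrDl; lra.
have YR s t : 0 <= s -> s <= t -> t <= T ->
    `|Y t - Y s - incr W s t (Y s)| <= CR * (t - s) `^ (2 * alpha).
  move=> s0 st tT; have Ys := YN s s0 (le_trans st tT).
  have := YC s t s0 st tT; rewrite powR3 => h1.
  have h3 := vf_P (cP s t s0 st tT) Ys.
  have HT := powR_le_time s0 st tT.
  have H0 : 0 <= (t - s) `^ alpha by exact: powR_ge0.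
  have -> : Y t - Y s - incr W s t (Y s) = (Y t - phi s t (Y s)) + WW s t (Y s, Y s).
    by rewrite /step; zmod.
  apply: (le_trans (le_trans (ler_normD _ _) (lerD h1 h3))).
  rewrite powR2 /CR; move: HT H0; rewrite -/Th; set H := (t - s) `^ alpha => HT H0.
  have e1 : C * H ^+ 3 <= C * Th * H ^+ 2.
    by rewrite exprS mulrA ler_wpM2r ?exprn_ge0// ler_wpM2l.
  have e2 : c * H * (c * H) = c ^+ 2 * H ^+ 2 by ring.
  by rewrite mulrDl e2 lerD2r.
have YC1 : in_C T alpha Y.
  apply: (@in_C2_intro _ _ T alpha CY) => s t sT tT _.
  apply: (symmetric_bound (f := fun s t => `|Y t - Y s|)) => //.
  by move=> *; exact: distrC.
split => //; split => //.
have CY0 : 0 <= CY.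
  by rewrite !addr_ge0// mulr_ge0// exprn_ge0.
apply: (@in_C2_intro _ _ T _ (CR + c * CY)) => s t sT tT _.
have R0 : 0 <= CR by rewrite addr_ge0 ?mulr_ge0 ?exprn_ge0.
move: sT tT; rewrite !in_itv/= => /andP[s0 sT] /andP[t0 tT].
have [st|/ltW ts] := leP s t.
  rewrite ger0_norm ?subr_ge0// (le_trans (YR s t s0 st tT))//.
  by rewrite ler_wpM2r ?powR_ge0// lerDl mulr_ge0.
rewrite [`|t - s|]distrC [`|s - t|]ger0_norm ?subr_ge0//.
rewrite -[X in `|X|]/(incr Y s t - incr W s t (Y s)).
have -> : incr Y s t - incr W s t (Y s) = - (Y s - Y t - incr W t s (Y t)) +
  (incr W t s (Y s) - incr W t s (Y t)).
  rewrite -[incr W s t (Y s)]/(W t (Y s) - W s (Y s)).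
  rewrite -[incr W t s (Y s)]/(W s (Y s) - W t (Y s)).
  by rewrite -[incr Y s t]/(Y t - Y s); zmod.
rewrite (le_trans (ler_normD _ _))// normrN mulrDl lerD// ?YR//.
rewrite (le_trans (vf_lip (cP t s t0 ts sT) (YN s s0 sT) (YN t t0 tT)))//.
rewrite powR2 (le_trans (ler_wpM2l _ (YH t s t0 ts sT))) ?mulr_ge0 ?powR_ge0//.
by rewrite le_eqVlt; apply/orP; left; apply/eqP; ring.
Qed.

(** Up to the errors of the expansion, the Riemann sums telescope; the sum of
    these errors is at most [C * t] times the mesh to the power
    [3 * alpha - 1]. *)
Lemma davie_integral Y t : davie alpha phi 0 T Y -> 0 <= t <= T ->
  rough_sum W WW Y Y 0 p @[p --> mesh_to0 0 t] --> Y t - Y 0.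
Proof.
move=> dY /andP[t0 tT]; have [C C0 YC] := davie_global dY.
have PF := mesh_to0_proper t0.
apply/cvgrPdist_le => e e0.
have a1 : 0 < 3 * alpha - 1 by have := al3; lra.
have [d d0 dP] := @powR_small R (C * t) (3 * alpha - 1) e (mulr_ge0 C0 t0) a1 e0.
exists d => //= p [[sp /eqP lp] pm].
set tau := nth 0 (0 :: p).
have tau_size : tau (size p) = t.
  by rewrite -[RHS]lp [LHS](nth_last 0 (0 :: p)).
have tau_mono := path_nth_mono sp.
have tauT i j : (i <= j <= size p)%N -> [/\ 0 <= tau i, tau i <= tau j & tau j <= T].
  move=> /andP[ij jp]; split.
  - by apply: (tau_mono 0%N i); rewrite (leq_trans ij).
  - by rewrite tau_mono// ij.
  - by rewrite (le_trans _ tT)// -tau_size tau_mono// jp leqnn.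
have -> : Y t - Y 0 = \sum_(i < size p) (Y (tau i.+1) - Y (tau i)).
  by rewrite -(big_mkord xpredT (fun i => Y (tau i.+1) - Y (tau i)))
    (telescope_sumr (fun i => Y (tau i)))// tau_size.
rewrite rough_sum_diag -sumrB.
have tE : t = \sum_(i < size p) (tau i.+1 - tau i).
  by rewrite -(big_mkord xpredT (fun i => tau i.+1 - tau i))
    (telescope_sumr tau)// tau_size subr0.
apply: le_trans dP; rewrite mulrAC [in leRHS]tE mulr_sumr.
apply: (le_trans (ler_norm_sum _ _ _)); apply: ler_sum => i _.
have ii : (i <= i.+1 <= size p)%N by rewrite leqnSn ltn_ord.
have [t1 t2 t3] := tauT _ _ ii.
rewrite -/tau; set y1 := phi _ _ _.
have -> : Y (tau i.+1) - Y (tau i) - (y1 - Y (tau i)) = Y (tau i.+1) - y1 by zmod.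
rewrite (le_trans (YC _ _ t1 t2 t3))// -mulrA ler_wpM2l//.
rewrite -[tau i.+1 - tau i in leRHS]powRr1 ?subr_ge0//.
apply: powR_split; rewrite ?subr_ge0 ?mulr_gt0//; last by have := al3; lra.
by apply/ltW/((mesh_ltP _ _ d0).1 pm).
Qed.

Lemma davie_rde Y : davie alpha phi 0 T Y -> rde_solution T alpha W WW (Y 0) Y.
Proof.
move=> dY; have [YC Yc] := davie_increments dY; split => // t.
rewrite in_itv/= => t0T; have Yl := davie_integral dY t0T.
have PF : ProperFilter (mesh_to0 0 t) by apply: mesh_to0_proper; case/andP: t0T.
split; first by apply/cvg_ex; exists (Y t - Y 0).
rewrite /rough_integral (cvg_lim _ Yl); last exact: norm_hausdorff.
by zmod.
Qed.


(** By Chen's relation, the defect of additivity of the germ of the integral is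
    a Taylor remainder, plus the derivative of [W] applied to the remainder of
    the controlled path, plus an increment of [WW]: three quantities of order
    [3 * alpha]. *)
Lemma controlled_germ Y : controlled T alpha W Y Y ->
  exists2 Q, 0 <= Q & forall s u t, 0 <= s -> s <= u -> u <= t -> t <= T ->
    `|phi s u (Y s) - Y s + (phi u t (Y u) - Y u) - (phi s t (Y s) - Y s)| <=
      Q * (t - s) `^ (3 * alpha).
Proof.
move=> [YC _ YR]; have [WC _ ch] := RP.
have [c1 c10 c1P] := in_C2_bound T0 YC; have [c2 c20 c2P] := in_C2_bound T0 YR.
pose M := 1 + (`|Y 0| + c1 * T `^ alpha).
have M1 : 1 <= M by rewrite lerDl addr_ge0// mulr_ge0// powR_ge0.
have YH s t : 0 <= s -> s <= t -> t <= T -> `|Y t - Y s| <= c1 * (t - s) `^ alpha.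
  move=> s0; rewrite le_eqVlt => /predU1P[->|st] tT.
    by rewrite !subrr normr0 mulr_ge0// powR_ge0.
  have := c1P s t (in_T s0 (le_trans (ltW st) tT)) (in_T (le_trans s0 (ltW st)) tT).
  by rewrite (lt_eqF st) ger0_norm ?subr_ge0 ?(ltW st)// => /(_ isT).
have YRH s t : 0 <= s -> s <= t -> t <= T ->
    `|Y t - Y s - incr W s t (Y s)| <= c2 * (t - s) `^ (2 * alpha).
  move=> s0; rewrite le_eqVlt => /predU1P[->|st] tT.
    have -> : Y t - Y t - incr W t t (Y t) = 0.
      by rewrite -[incr W t t (Y t)]/(W t (Y t) - W t (Y t)); zmod.
    by rewrite normr0 mulr_ge0// powR_ge0.
  have := c2P s t (in_T s0 (le_trans (ltW st) tT)) (in_T (le_trans s0 (ltW st)) tT).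
  by rewrite (lt_eqF st) [`|t - s|]ger0_norm ?subr_ge0 ?(ltW st)// => /(_ isT).
have YN t : 0 <= t -> t <= T -> weight_ball M (Y t).
  move=> t0 tT; rewrite /weight_ball /= /M lerD2l.
  have := YH 0 t (lexx _) t0 tT; have := powR_le_time (lexx 0) t0 tT.
  move=> /(ler_wpM2l c10) h1 h2.
  by rewrite -[Y t](subrK (Y 0)) addrC (le_trans (ler_normD _ _))// lerD2l (le_trans h2).
have [c c0 cP] := uniform_bounds M1.
pose Q := c * c1 ^+ 2 + c * c2 + c ^+ 2 * c1.
exists Q; first by rewrite !addr_ge0 ?mulr_ge0 ?exprn_ge0.
move=> s u t s0 su ut tT.
have st := le_trans su ut; have uT := le_trans ut tT; have u0 := le_trans s0 su.
have sT := le_trans su uT; have t0 := le_trans u0 ut.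
have dW r r' z : r \in `[0, T] -> r' \in `[0, T] -> differentiable (incr W r r') z.
  move=> rT r'T; have [Cr Cr'] := cn_incr WC rT r'T.
  exact: (differentiable_fderivB Cr' Cr (k := 0)).
have chs := chen_step (Y s) (Y u) ch dW (in_T s0 sT) (in_T u0 uT) (in_T t0 tT).
have -> : phi s u (Y s) - Y s + (phi u t (Y u) - Y u) - (phi s t (Y s) - Y s) =
  phi u t (Y u) - phi s t (Y s) - (Y u - phi s u (Y s)) by zmod.
rewrite chs.
have bd := cP u t u0 ut tT; have Ys := YN s s0 sT; have Yu := YN u u0 uT.
set H := (t - s) `^ alpha; have H0 : 0 <= H by exact: powR_ge0.
have utH : (t - u) `^ alpha <= H.
  by apply: ge0_ler_powR; rewrite ?nnegrE ?subr_ge0 ?(ltW al0)// lerB.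
have suH : (u - s) `^ alpha <= H.
  by apply: ge0_ler_powR; rewrite ?nnegrE ?subr_ge0 ?(ltW al0)// lerB.
have {}bd := vf_bounds_mono bd (mulr_ge0 c0 (powR_ge0 _ _)) (ler_wpM2l c0 utH)
  (mulr_ge0 c0 (powR_ge0 _ _)) (ler_wpM2l c0 utH).
have cH0 : 0 <= c * H by rewrite mulr_ge0.
have dY : `|Y u - Y s| <= c1 * H by rewrite (le_trans (YH s u s0 su uT))// ler_wpM2l.
have dR : `|Y u - Y s - incr W s u (Y s)| <= c2 * H ^+ 2.
  rewrite (le_trans (YRH s u s0 su uT))// ler_wpM2l// powR2.
  by rewrite ler_pXn2r ?nnegrE ?powR_ge0.
have uE : Y u = Y s + (Y u - Y s) by zmod.
have Yu' : weight_ball M (Y s + (Y u - Y s)) by rewrite -uE.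
have Ys0 : weight_ball M (Y s + 0) by rewrite addr0.
have n0 : `|0 : V| <= c1 * H by rewrite normr0 mulr_ge0.
have := vf_taylor bd Ys Yu' Ys0 dY n0; rewrite -uE addr0 subr0 => t1.
have := vf_D bd (Y u - Y s - incr W s u (Y s)) Ys => t2.
have t3 := vf_P_lip bd Yu Ys.
have -> : incr W u t (Y u) - incr W u t (Y s) - D1 u t (Y s) (incr W s u (Y s)) =
  (incr W u t (Y u) - incr W u t (Y s) - D1 u t (Y s) (Y u - Y s)) +
  D1 u t (Y s) (Y u - Y s - incr W s u (Y s)).
  by rewrite (clin_subr _ (Y u - Y s) (incr W s u (Y s))); zmod.
have {}t1 := le_trans t1 (ler_wpM2l (mulr_ge0 cH0 (le_trans (normr_ge0 _) n0)) dY).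
have {}t2 := le_trans t2 (ler_wpM2l cH0 dR).
have {}t3 := le_trans t3 (ler_wpM2l (exprn_ge0 2 cH0) dY).
have h := le_trans (ler_normD _ _) (lerD (le_trans (ler_normD _ _) (lerD t1 t2)) t3).
apply: (le_trans h); rewrite powR3 -/H le_eqVlt; apply/orP; left; apply/eqP.
by rewrite /Q; ring.
Qed.

(** The sums over an interval from [s] to [t] are differences of sums from [0],
    so they approach [Z t - Z s] by the equation; on the other hand
    [discrete_sewing] bounds their distance from the sum with a single term,
    uniformly in the partition. *)
Lemma rde_davie xi Z : rde_solution T alpha W WW xi Z -> davie alpha phi 0 T Z.
Proof.
move=> [ZC Z0 Zc ZI]; have [Q Q0 QP] := controlled_germ Zc.
have [c1 c10 c1P] := in_C2_bound T0 ZC.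
have a1 : 1 < 3 * alpha by have := al3; lra.
have [del0 del00 [c cP]] := sewing_const_ex a1.
have c00 : sewing_const (3 * alpha) c 0 by apply: cP; rewrite lexx ltW.
have c0 : 0 <= c by case: c00 => _ /(le_trans ler01).
have sums s p : 0 <= s -> path <%R s p -> last s p <= T ->
    `|rough_sum W WW Z Z s p - (phi s (last s p) (Z s) - Z s)| <=
      c * Q * (last s p - s) `^ (3 * alpha).
  move=> s0 sp lp; set tau := nth s (s :: p).
  have tau_size : tau (size p) = last s p by rewrite [LHS](nth_last s (s :: p)).
  have tau_mono := path_nth_mono sp.
  have tauT i j : (i <= j <= size p)%N ->
      [/\ 0 <= tau i, tau i <= tau j & tau j <= T].
    move=> /andP[ij jp]; split.
    - rewrite (le_trans s0)//; apply: (tau_mono 0%N i).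
      by rewrite (leq_trans ij).
    - by rewrite tau_mono// ij.
    - by rewrite (le_trans _ lp)// -tau_size tau_mono// jp leqnn.
  pose xi_ i j := phi (tau i) (tau j) (Z (tau i)) - Z (tau i).
  pose e i j := `|\sum_(i <= k < j) xi_ k k.+1 - xi_ i j|.
  suff : e 0%N (size p) <= c * (Q + 0) * (tau (size p) - tau 0%N) `^ (3 * alpha).
    by rewrite addr0 /e big_mkord rough_sum_diag /xi_ tau_size.
  apply: (@discrete_sewing _ tau e (3 * alpha) c 0 Q 0 (size p)) => //.
  - by rewrite mulr_ge0// ltW.
  - move=> i ip; have [t1 _ t2] := tauT i i (introT andP (conj (leqnn _) ip)).
    have chn : chen T W WW by case: RP.
    rewrite /e big_geq// /xi_ /step (chen_diag0 chn) ?in_T//.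
    have -> : incr W (tau i) (tau i) (Z (tau i)) = 0.
      by rewrite -[LHS]/(W _ _ - W _ _) subrr.
    by rewrite !addr0 !subrr normr0.
  - by move=> i ip; rewrite /e big_nat1 subrr normr0 mul0r.
  - move=> i k j ik kj jp; rewrite /e addr0 mul1r.
    have [t1 t2 t3] := tauT i k (introT andP (conj (ltnW ik) (leq_trans (ltnW kj) jp))).
    have [t4 t5 t6] := tauT k j (introT andP (conj (ltnW kj) jp)).
    have := QP _ _ _ t1 t2 t5 t6.
    rewrite -/(xi_ i k) -/(xi_ k j) -/(xi_ i j) => h1.
    rewrite (big_cat_nat (ltnW ik) (ltnW kj))//=.
    set S1 := \sum_(i <= _ < k) _; set S2 := \sum_(k <= _ < j) _.
    have -> : S1 + S2 - xi_ i j = (S1 - xi_ i k) + (S2 - xi_ k j) +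
      (xi_ i k + xi_ k j - xi_ i j) by zmod.
    by rewrite (le_trans (ler_normD _ _))// lerD// ler_normD.
  - by rewrite leqnn.
split.
  exists (1 + (`|Z 0| + c1 * T `^ alpha)) => t; rewrite lerD2l => /andP[].
  rewrite le_eqVlt => /predU1P[<-|t0] tT.
    by rewrite lerDl mulr_ge0// powR_ge0.
  have := c1P 0 t (in_T (lexx _) (ltW T0)) (in_T (ltW t0) tT).
  rewrite (lt_eqF t0) => /(_ isT); rewrite ger0_norm ?subr_ge0 ?(ltW t0)// => h1.
  have h2 := ler_wpM2l c10 (powR_le_time (lexx 0) (ltW t0) tT).
  rewrite -[Z t](subrK (Z 0)) addrC (le_trans (ler_normD _ _))// lerD2l.
  exact: le_trans h1 h2.
exists (c * Q), 1; split => //; first by rewrite mulr_ge0.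
move=> s t s0 st tT _; apply/ler_addgt0Pr => e e0.
have near r : 0 <= r -> r <= T -> exists2 d, 0 < d & forall p,
    itv_partition 0 r p -> mesh 0 p < d ->
    `|Z r - Z 0 - rough_sum W WW Z Z 0 p| <= e / 2.
  move=> r0 rT; have [Zl Zr] := ZI r (in_T r0 rT).
  have PF := mesh_to0_proper r0.
  have ZrE : Z r - Z 0 = rough_integral W WW Z Z 0 r by rewrite Zr Z0; zmod.
  rewrite ZrE; have := Zl; rewrite /rough_integrable /rough_integral => /cvgrPdist_le.
  have e20 : 0 < e / 2 by rewrite divr_gt0.
  by move=> /(_ _ e20) [d /= d0 dP]; exists d => // p pr pm; exact: dP.
have t0 := le_trans s0 st; have sT := le_trans st tT.
have [d1 d10 d1P] := near s s0 sT; have [d2 d20 d2P] := near t t0 tT.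
have d0 : 0 < Num.min d1 d2 by rewrite lt_min d10.
have [p [ps pm]] := partition_ex s0 d0; have [p' [pt pm']] := partition_ex st d0.
have [sp /eqP lp] := ps; have [sp' /eqP lp'] := pt.
have {}d1P : `|Z s - Z 0 - rough_sum W WW Z Z 0 p| <= e / 2.
  by apply: d1P => //; rewrite (lt_le_trans pm)// ge_min lexx.
have pp't : itv_partition 0 t (p ++ p') := itv_partition_cat ps pt.
have := d2P _ pp't; rewrite rough_sum_cat lp => {}d2P.
have {}d2P : `|Z t - Z 0 - (rough_sum W WW Z Z 0 p + rough_sum W WW Z Z s p')| <= e / 2.
  apply: d2P; apply: mesh_cat_lt => //.
    by rewrite (lt_le_trans pm)// ge_min lexx orbT.
  by rewrite lp (lt_le_trans pm')// ge_min lexx orbT.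
have lT : last s p' <= T by rewrite lp'.
have := sums s p' s0 sp' lT; rewrite lp' => h.
set S := rough_sum W WW Z Z 0 p in d1P d2P.
set S' := rough_sum W WW Z Z s p' in d2P h.
have -> : Z t - phi s t (Z s) = (Z t - Z 0 - (S + S')) - (Z s - Z 0 - S) +
  (S' - (phi s t (Z s) - Z s)) by zmod.
have h2 := le_trans (ler_normB _ _) (lerD d2P d1P).
rewrite (le_trans (ler_normD _ _))// (le_trans (lerD h2 h))//.
by rewrite -splitr addrC.
Qed.

End Solutions.

Unset Implicit Arguments.

Theorem theorem4p4 (R : realType) (V : completeNormedModType R)
    (T alpha : R) (beta : 4.-tuple R)
    (W : R -> V -> V) (WW : R -> R -> prod1 V V -> V) :
  separable V ->
  0 < T ->
  1 / 3 < alpha <= 1 / 2 ->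
  (forall k, 0 <= tnth beta k) ->
  nonlinear_rough_path T alpha beta W WW ->
  let gamma2 := Num.max beta`_0 (Num.max beta`_1 beta`_2) +
                Num.max beta`_1 (Num.max beta`_2 beta`_3) + beta`_1 in
  gamma2 / alpha - gamma2 + beta`_0 <= 1 ->
  forall xi : V,
    exists2 Y : R -> V,
      rde_solution T alpha W WW xi Y &
      forall Z : R -> V, rde_solution T alpha W WW xi Z ->
        forall t, t \in `[0, T] -> Z t = Y t.
Proof.
move=> _ T0 /andP[al3 al2] bt0 RP gamma2 growth_cond xi.
have [K [b [c [eps [K1 b1 eps01 [ca cb ceps] AF]]]]] :=
  flow_constants T0 al3 bt0 RP.
have b00 := beta_nth_ge0 bt0 0.
have b0g : beta`_0 <= growth beta.
  by rewrite -(tnth_nth 0 beta (@Ordinal 4 0 isT)) beta_le_growth.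
have [Y Y0 dY] := global_solution al3 K1 b1 eps01 ca cb ceps b00 b0g
  growth_cond AF xi T0.
exists Y; first by rewrite -Y0; exact: (davie_rde T0 al3 bt0 RP).
move=> Z ZS t; rewrite in_itv => tT.
have dZ := rde_davie T0 al3 bt0 RP ZS.
apply: (davie_unique al3 K1 b1 eps01 ca cb ceps AF (lexx 0) (lexx T) dZ dY) => //.
by have [_ -> _ _] := ZS.
Qed.
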